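(* Let $d\ge 2$, let $C\subset\mathbb R^d$ be a closed convex cone that is pointed (contains no line) and has non-empty interior, and let $\mathbf k\in \mathbb Z^d\cap\operatorname{Int} C$. Then there is a convex set $T_0=T_0(C,\mathbf k)\subset\mathbb R^d$ such that for every $\varepsilon>0$, $$\lim_{n\to\infty}\frac{\operatorname{card}\{T\in\mathcal T(C,n\mathbf k)\;:\;\operatorname{dist}(\tfrac1n T,T_0)>\varepsilon\}}{p(C,n\mathbf k)}=0,$$ where $n$ ranges over the positive integers.
   Context: An integral zonotope in $C$ is a set of the form $T=\{\sum_{i=1}^m\alpha_i\mathbf v_i : (\alpha_1,\dots,\alpha_m)\in[0,1]^m\}$ with $m\in\mathbb N$ and $\mathbf v_1,\dots,\mathbf v_m\in\mathbb Z^d\cap C$; its endpoint is $\sum_{i=1}^m\mathbf v_i$. For $\mathbf m\in\mathbb Z^d\cap\operatorname{Int}C$, $\mathcal T(C,\mathbf m)$ denotes the (finite) family of all integral zonotopes in $C$ (as sets; different generating multisets giving the same set are counted once) whose endpoint is $\mathbf m$, and $p(C,\mathbf m)=\operatorname{card}\mathcal T(C,\mathbf m)$. $\operatorname{dist}(A,B)$ is the Hausdorff distance of the (non-empty) sets $A,B\subset\mathbb R^d$, with values in $[0,\infty]$. *)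

(* Defs.v *)
From HB Require Import structures.
From mathcomp Require Import all_boot all_order all_algebra finmap.
From mathcomp Require Import all_classical all_reals all_analysis.

Set Implicit Arguments.
Unset Strict Implicit.
Unset Printing Implicit Defensive.

Import Order.TTheory GRing.Theory Num.Theory.
Import numFieldNormedType.Exports.

Local Open Scope classical_set_scope.
Local Open Scope ring_scope.

Section Cones.
Context {R : realType} {d : nat}.
Implicit Types C : set 'rV[R]_d.

Definition is_cone C := forall (t : R) x, 0 <= t -> C x -> C (t *: x).

Definition contains_line C :=
  exists x v : 'rV[R]_d, v != 0 /\ forall t : R, C (x + t *: v).

Definition pointed C := ~ contains_line C.

Definition convex_cone C := is_cone C /\ convex_set C.

End Cones.

Section HausdorffDistance.
Context {R : realType} {d : nat}.
Implicit Types (x y : 'rV[R]_d) (A B : set 'rV[R]_d).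

(* The canonical norm on 'rV[R]_d is the sup norm, hence this definition. *)
Definition eucl_norm x : R := Num.sqrt (\sum_(i < d) x 0 i ^+ 2).

Definition excess A B : \bar R :=
  ereal_sup [set ereal_inf [set (eucl_norm (x - y))%:E | y in B] | x in A].

Definition hausdorff_dist A B : \bar R := Order.max (excess A B) (excess B A).

End HausdorffDistance.

Section Zonotopes.
Context {R : realType} {d : nat}.
Implicit Types (C T : set 'rV[R]_d) (x : 'rV[R]_d).

Definition integral_vector x : Prop := x \is a mxOver Num.int.

Definition zonotope (m : nat) (v : 'I_m -> 'rV[R]_d) : set 'rV[R]_d :=
  [set x | exists a : 'I_m -> R,
    (forall i, 0 <= a i <= 1) /\ x = \sum_(i < m) a i *: v i].

(* Members are sets, so generating families that yield the same set are
   identified. *)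
Definition zonotopes C (p : 'rV[R]_d) : set (set 'rV[R]_d) :=
  [set T | exists (m : nat) (v : 'I_m -> 'rV[R]_d),
    [/\ forall i, integral_vector (v i) /\ C (v i),
        T = zonotope v
      & \sum_(i < m) v i = p]].

End Zonotopes.

(* fset_set is fset0 on infinite sets, so this is the cardinal only of finite
   sets; zonotopes C p is finite when C is a pointed closed convex cone. *)
Definition finite_card {T : choiceType} (A : set T) : nat := #|` fset_set A|.

Definition num_zonotopes {R : realType} {d : nat} (C : set 'rV[R]_d)
  (p : 'rV[R]_d) : nat := finite_card (zonotopes C p).

(* Main.v *)
(* Every integral zonotope in C is the Minkowski sum of segments [0, w_p p] over the
   primitive vectors p of C, for a unique finitely supported family w of naturals: its
   support function sum_p w_p max(0, <u, p>) has its kinks on distinct hyperplanes.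
   Let the w_p be independent geometric variables, w having weight exp(-<a, X(w)>/t),
   where X(w) = sum_p w_p p. This weight depends on the endpoint only, hence it is uniform
   on the zonotopes with a given endpoint.

   Comparing scales shows that t^-d sum_(v in C) f(v/t) converges for f = exp(-phi), phi
   homogeneous and Lipschitz; differentiating in phi yields the moments m(g), the
   integrals of g exp(-<a, .>) over C for g homogeneous and Lipschitz. The functional
   a |-> I(a) + <a, k>, I(a) the limit for phi = <a, .>, has a minimizer, and
   stationarity says that m(<b, .>) = <b, k> for all b. A contraction argument gives the
   analogous limits over primitive vectors, and a Chernoff bound shows that
   g(w) = sum_p w_p g(p) is within del t^(d+1) of kappa m(g) t^(d+1) outside a set of
   relative weight exp(-c t^d).

   Finitely many functions g, forming a partition of <a, .> into parts concentrated near
   directions th_i, control the Hausdorff distance to the limit zonoid. For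
   n = (1 + e) kappa t^(d+1) the far zonotopes with endpoint nk number at most
   exp(n<a, k>/t - c t^d) Z, Z being the total weight, while padding typical
   configurations by one generator shows that the number of all zonotopes is at least
   exp(n<a, k>/t - O(e) t^d) Z up to a power of t; e small finishes the proof. *)
Require Import Defs.
From mathcomp Require Import all_boot all_order all_algebra finmap.
From mathcomp Require Import all_classical all_reals all_analysis.
From mathcomp Require Import ring lra zify.
Import Order.TTheory GRing.Theory Num.Theory.
Import numFieldNormedType.Exports.
Local Open Scope classical_set_scope.
Local Open Scope ring_scope.

Set Implicit Arguments.
Unset Strict Implicit.
Unset Printing Implicit Defensive.

(** * Sums of real families *)

Lemma eq_ler {R : numDomainType} (x y : R) : x = y -> x <= y.
Proof. by move=> ->. Qed.

Section RealSums.
Context {R : realType} {T : choiceType}.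
Implicit Types (f g : T -> R) (F G : {fset T}).

Definition rsummable f : Prop := summable [set: T] (EFin \o f).

Definition rsum f : R :=
  fine (esum [set: T] (EFin \o f)^\+ - esum [set: T] (EFin \o f)^\-)%E.

Lemma sum_le_esum f F : (forall i, 0 <= f i) ->
  ((\sum_(i <- F) f i)%:E <= \esum_(i in [set: T]) (f i)%:E)%E.
Proof.
move=> f0; apply: esum_ge; exists [set` F]; first by split.
by rewrite fsbig_finite //= set_fsetK sumEFin.
Qed.

Lemma esum_le_bound f (M : R) : (forall F, \sum_(i <- F) f i <= M) ->
  (\esum_(i in [set: T]) (f i)%:E <= M%:E)%E.
Proof.
move=> fM; apply: ge_ereal_sup => _ [X [finX _] <-].
by rewrite fsbig_finite //= sumEFin lee_fin.
Qed.

Lemma rsummable_bound f (M : R) : (forall F, \sum_(i <- F) `|f i| <= M) ->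
  rsummable f.
Proof. by move=> fM; apply: le_lt_trans (esum_le_bound fM) _; rewrite ltry. Qed.

Lemma ge0_rsummable f (M : R) : (forall i, 0 <= f i) ->
  (forall F, \sum_(i <- F) f i <= M) -> rsummable f.
Proof.
move=> f0 fM; apply: (@rsummable_bound _ M) => F.
by under eq_bigr do rewrite ger0_norm //.
Qed.

Lemma le_rsummable f g : (forall i, `|f i| <= g i) -> rsummable g -> rsummable f.
Proof.
move=> fg; apply: le_lt_trans; apply: le_esum => i _.
by rewrite lee_fin; apply: le_trans (fg i) (ler_norm _).
Qed.

Lemma rsummable_norm f : rsummable f -> rsummable (fun i => `|f i|).
Proof.
by apply: le_lt_trans; apply: le_esum => i _; rewrite lee_fin /= normr_id.
Qed.

Lemma rsummableD f g : rsummable f -> rsummable g ->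
  rsummable (fun i => f i + g i).
Proof. exact: summableD. Qed.

Lemma rsummableN f : rsummable f -> rsummable (fun i => - f i).
Proof. by rewrite /rsummable summableN. Qed.

Lemma rsummableB f g : rsummable f -> rsummable g ->
  rsummable (fun i => f i - g i).
Proof. by move=> sf /rsummableN; exact: rsummableD. Qed.

Lemma eq_rsum f g : f =1 g -> rsum f = rsum g.
Proof. by move=> /funext ->. Qed.

Lemma ge0_rsumE f : (forall i, 0 <= f i) ->
  rsum f = fine (\esum_(i in [set: T]) (f i)%:E).
Proof.
move=> f0; rewrite /rsum [X in (_ - X)%E]esum1 ?sube0 => [|i _].
  by congr fine; apply: eq_esum => i _; rewrite funeposE /= max_l ?lee_fin.
by rewrite funenegE /= max_r // lee_fin oppr_le0.
Qed.

Lemma ge0_rsumK f : (forall i, 0 <= f i) -> rsummable f ->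
  (rsum f)%:E = \esum_(i in [set: T]) (f i)%:E.
Proof.
move=> f0 sf; rewrite ge0_rsumE // fineK //.
have -> : \esum_(i in [set: T]) (f i)%:E = \esum_(i in [set: T]) `|(f i)%:E|%E.
  by apply: eq_esum => i _; rewrite gee0_abs // lee_fin.
by rewrite -summableE.
Qed.

Let norm_add_ge0 f i : 0 <= `|f i| + f i.
Proof. by rewrite -lerBlDr sub0r -normrN ler_norm. Qed.

Lemma sum_le_rsum f F : (forall i, 0 <= f i) -> rsummable f ->
  \sum_(i <- F) f i <= rsum f.
Proof. by move=> f0 sf; rewrite -lee_fin ge0_rsumK //; exact: sum_le_esum. Qed.

Lemma rsum_le_bound f (M : R) : (forall i, 0 <= f i) ->
  (forall F, \sum_(i <- F) f i <= M) -> rsum f <= M.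
Proof.
move=> f0 fM; rewrite -lee_fin ge0_rsumK //; first exact: esum_le_bound.
exact: ge0_rsummable fM.
Qed.

Lemma rsum_adherent f (e : R) : (forall i, 0 <= f i) -> rsummable f -> 0 < e ->
  exists F, rsum f - e < \sum_(i <- F) f i.
Proof.
move=> f0 sf e0; apply/not_existsP => small.
suff : rsum f <= rsum f - e by lra.
by apply: rsum_le_bound => // F; rewrite leNgt; apply/negP/small.
Qed.

Lemma rsum_ge0 f : (forall i, 0 <= f i) -> 0 <= rsum f.
Proof.
move=> f0; rewrite ge0_rsumE // fine_ge0 // esum_ge0 // => i _.
by rewrite lee_fin.
Qed.

Lemma ler_term_rsum f i : (forall i, 0 <= f i) -> rsummable f -> f i <= rsum f.
Proof.
by move=> f0 sf; have := sum_le_rsum [fset i]%fset f0 sf; rewrite big_seq_fset1.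
Qed.

Lemma rsum0 : rsum (fun=> 0) = 0.
Proof. by rewrite ge0_rsumE ?esum1. Qed.

Lemma ge0_rsumD f g : (forall i, 0 <= f i) -> (forall i, 0 <= g i) ->
  rsummable f -> rsummable g -> rsum (fun i => f i + g i) = rsum f + rsum g.
Proof.
move=> f0 g0 sf sg; apply: EFin_inj; rewrite EFinD !ge0_rsumK //.
- by rewrite -esumD // => i _; rewrite lee_fin.
- by move=> i; rewrite addr_ge0.
exact: rsummableD.
Qed.

Lemma ge0_rsumB f g : (forall i, 0 <= f i) -> (forall i, 0 <= g i) ->
  rsummable f -> rsummable g -> rsum (fun i => f i - g i) = rsum f - rsum g.
Proof.
move=> f0 g0 sf sg.
rewrite /rsum (esumB sf sg) => [|i _|i _]; rewrite ?lee_fin //.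
by rewrite -!ge0_rsumK.
Qed.

Lemma ge0_rsumZ (a : R) f : 0 <= a -> (forall i, 0 <= f i) -> rsummable f ->
  rsum (fun i => a * f i) = a * rsum f.
Proof.
move=> a0 f0 sf; have [->|a_neq0] := eqVneq a 0.
  by rewrite mul0r -[RHS]rsum0; apply: eq_rsum => i; rewrite mul0r.
have {a_neq0}a_gt0 : 0 < a by rewrite lt_def a_neq0.
have af0 i : 0 <= a * f i by exact: mulr_ge0.
have bound F : \sum_(i <- F) a * f i <= a * rsum f.
  by rewrite -mulr_sumr ler_wpM2l // sum_le_rsum.
apply/eqP; rewrite eq_le rsum_le_bound //=.
rewrite mulrC -ler_pdivlMr //; apply: rsum_le_bound => // F.
rewrite ler_pdivlMr // mulrC mulr_sumr; apply: sum_le_rsum => //.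
exact: ge0_rsummable bound.
Qed.

Lemma rsum_norm_decomp f : rsummable f ->
  rsum f = rsum (fun i => `|f i| + f i) - rsum (fun i => `|f i|).
Proof.
move=> sf; have sn := rsummable_norm sf; rewrite -ge0_rsumB //.
  by apply: eq_rsum => i; rewrite addrAC subrr add0r.
exact: rsummableD.
Qed.

Lemma rsumN f : rsummable f -> rsum (fun i => - f i) = - rsum f.
Proof.
move=> sf; have sn := rsummable_norm sf.
rewrite (rsum_norm_decomp sf) opprB -ge0_rsumB //.
  by apply: eq_rsum => i; rewrite opprD addrA subrr sub0r.
exact: rsummableD.
Qed.

Lemma rsumD f g : rsummable f -> rsummable g ->
  rsum (fun i => f i + g i) = rsum f + rsum g.
Proof.
move=> sf sg; have [nf ng] := (rsummable_norm sf, rsummable_norm sg).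
have [pf pg] := (rsummableD nf sf, rsummableD ng sg).
have pos i : 0 <= (`|f i| + f i) + (`|g i| + g i) by rewrite addr_ge0.
have nneg i : 0 <= `|f i| + `|g i| by rewrite addr_ge0.
rewrite (rsum_norm_decomp sf) (rsum_norm_decomp sg) addrACA -opprD -!ge0_rsumD //.
rewrite -ge0_rsumB //; [|exact: rsummableD|exact: rsummableD].
by apply: eq_rsum => i; ring.
Qed.

Lemma rsumB f g : rsummable f -> rsummable g ->
  rsum (fun i => f i - g i) = rsum f - rsum g.
Proof. by move=> sf sg; rewrite rsumD ?rsumN //; exact: rsummableN. Qed.

Lemma rsummableZ (a : R) f : rsummable f -> rsummable (fun i => a * f i).
Proof.
move=> /rsummable_norm sn; apply: (@rsummable_bound _ (`|a| * rsum (fun i => `|f i|))) => F.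
under eq_bigr do rewrite normrM.
by rewrite -mulr_sumr ler_wpM2l // sum_le_rsum.
Qed.

Lemma rsumZ (a : R) f : rsummable f -> rsum (fun i => a * f i) = a * rsum f.
Proof.
wlog a0 : a f / 0 <= a => [nneg_case sf|sf].
  have [a0|a0] := leP 0 a; first exact: nneg_case.
  rewrite -[a]opprK mulNr -nneg_case ?oppr_ge0 1?ltW // -rsumN.
    by apply: eq_rsum => i; rewrite mulNr.
  exact: rsummableZ.
have sn := rsummable_norm sf; have sp := rsummableD sn sf.
rewrite (rsum_norm_decomp sf) mulrBr -!ge0_rsumZ // -rsumB; try exact: rsummableZ.
by apply: eq_rsum => i; ring.
Qed.

Lemma le_rsum f g : rsummable f -> rsummable g -> (forall i, f i <= g i) ->
  rsum f <= rsum g.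
Proof.
move=> sf sg fg; rewrite -subr_ge0 -rsumB //.
by apply: rsum_ge0 => i; rewrite subr_ge0.
Qed.

Lemma ler_norm_rsum f : rsummable f -> `|rsum f| <= rsum (fun i => `|f i|).
Proof.
move=> sf; have sn := rsummable_norm sf.
rewrite ler_norml lerNl -rsumN //; apply/andP; split; apply: le_rsum => //.
- exact: rsummableN.
- by move=> i; rewrite -normrN ler_norm.
by move=> i; exact: ler_norm.
Qed.

Lemma rsummable_sum (I : Type) (s : seq I) (h : I -> T -> R) :
  (forall a, rsummable (h a)) -> rsummable (fun i => \sum_(a <- s) h a i).
Proof.
move=> sh; elim: s => [|a s IH]; under eq_fun do rewrite ?big_nil ?big_cons.
  by apply: (@rsummable_bound _ 0) => F; rewrite big1 // => i _; rewrite normr0.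
exact: rsummableD.
Qed.

Lemma rsum_sum (I : Type) (s : seq I) (h : I -> T -> R) :
  (forall a, rsummable (h a)) ->
  rsum (fun i => \sum_(a <- s) h a i) = \sum_(a <- s) rsum (h a).
Proof.
move=> sh; elim: s => [|a s IH]; under eq_fun do rewrite ?big_nil ?big_cons.
  by rewrite big_nil rsum0.
by rewrite big_cons rsumD ?IH //; exact: rsummable_sum.
Qed.

Lemma sum_inj_le_rsum (I : eqType) (s : seq I) (h : I -> T) f :
  (forall i, 0 <= f i) -> rsummable f -> uniq s -> {in s &, injective h} ->
  \sum_(i <- s) f (h i) <= rsum f.
Proof.
move=> f0 sf us h_inj; rewrite -(big_map h xpredT f).
have -> : \sum_(x <- map h s) f x = \sum_(x <- [fset y in map h s]%fset) f x.
  by apply: perm_big; apply: uniq_perm => [||x]; rewrite ?map_inj_in_uniq // !inE.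
exact: sum_le_rsum.
Qed.

Lemma ler_sum_fsubset f F G : (forall i, 0 <= f i) -> (F `<=` G)%fset ->
  \sum_(i <- F) f i <= \sum_(i <- G) f i.
Proof.
move=> f0 FG; rewrite [leRHS](bigID (mem F)) /= -[leLHS]addr0; apply: lerD.
  rewrite -[leRHS]big_filter; apply/eq_ler/perm_big.
  by apply: uniq_perm => [||i]; rewrite ?filter_uniq // mem_filter andb_idr // => /(fsubsetP FG).
exact: sumr_ge0.
Qed.

End RealSums.

Section RealSumReindexing.
Context {R : realType} {T U : choiceType}.

Lemma ge0_rsum_pair (f : T -> U -> R) : (forall i j, 0 <= f i j) ->
  rsummable (fun p => f p.1 p.2) ->
  [/\ forall i, rsummable (f i), rsummable (fun i => rsum (f i)) &
      rsum (fun p => f p.1 p.2) = rsum (fun i => rsum (f i))].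
Proof.
move=> f0 sf; have f0' p : 0 <= f p.1 p.2 by [].
have sfi i : rsummable (f i).
  apply: (@ge0_rsummable _ _ _ (rsum (fun p => f p.1 p.2))) => // F.
  by apply: (sum_inj_le_rsum (h := pair i) f0' sf (fset_uniq F)) => j k _ _ [].
have s0 i : 0 <= rsum (f i) by exact: rsum_ge0.
have iterE : \esum_(i in [set: T]) (rsum (f i))%:E = (rsum (fun p => f p.1 p.2))%:E.
  rewrite ge0_rsumK // (eq_esum (fun i _ => ge0_rsumK (f0 i) (sfi i))).
  rewrite esum_esum => [|i j _ _]; last by rewrite lee_fin.
  by congr esum; apply/seteqP; split.
split => //; last by rewrite [RHS]ge0_rsumE // iterE.
rewrite /rsummable /summable (eq_esum (b := fun i => (rsum (f i))%:E)) => [|i _].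
  by rewrite iterE ltry.
by rewrite /= ger0_norm.
Qed.

Lemma ge0_rsum_bij (h : U -> T) (f : T -> R) : bijective h -> (forall i, 0 <= f i) ->
  rsummable f -> rsummable (f \o h) /\ rsum (f \o h) = rsum f.
Proof.
rewrite -setTT_bijective => h_bij f0 sf; split; last first.
  by rewrite !ge0_rsumE //= [in RHS](reindex_esum _ _ _ _ h_bij).
by move: sf; rewrite /rsummable /summable (reindex_esum _ _ _ _ h_bij).
Qed.

End RealSumReindexing.

Lemma ge0_rsum_exchange {R : realType} {T U : choiceType} (f : T -> U -> R) :
  (forall i j, 0 <= f i j) -> rsummable (fun p => f p.1 p.2) ->
  rsummable (fun j => rsum (f^~ j)) /\
  rsum (fun j => rsum (f^~ j)) = rsum (fun i => rsum (f i)).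
Proof.
move=> f0 sf; pose swap (q : U * T) := (q.2, q.1).
have swap_bij : bijective swap by exists (fun p => (p.2, p.1)) => -[].
have [sfs fsE] := ge0_rsum_bij swap_bij (fun p => f0 p.1 p.2) sf.
have [_ _ <-] := ge0_rsum_pair f0 sf.
by have [_ s <-] := @ge0_rsum_pair _ _ _ (fun j i => f i j) (fun j i => f0 i j) sfs.
Qed.

Section RealSumSplitting.
Context {R : realType} {T : choiceType}.
Implicit Types (f : T -> R) (F : {fset T}).

Let ge0_delta (a i : T) : 0 <= (i == a)%:R :> R.
Proof. by case: (i == a). Qed.

Let sum_delta_le1 (a : T) F : \sum_(i <- F) (i == a)%:R <= 1 :> R.
Proof.
have [aF|aF] := boolP (a \in F).
  rewrite (big_fsetD1 a) //= eqxx big_seq big1 ?addr0 // => i.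
  by rewrite !inE => /andP[/negbTE ->].
by rewrite big_seq big1 // => i iF; case: eqP => // ia; rewrite -ia iF in aF.
Qed.

Lemma rsummable_delta (a : T) : rsummable (fun i => (i == a)%:R : R).
Proof. exact: (ge0_rsummable (ge0_delta a) (sum_delta_le1 a)). Qed.

Lemma rsum_delta (a : T) : rsum (fun i => (i == a)%:R : R) = 1.
Proof.
apply/eqP; rewrite eq_le rsum_le_bound //=.
have := ler_term_rsum a (ge0_delta a) (rsummable_delta a).
by rewrite eqxx.
Qed.

Lemma rsum_split F f : rsummable f ->
  rsummable (fun i => if i \in F then 0 else f i) /\
  rsum f = \sum_(i <- F) f i + rsum (fun i => if i \in F then 0 else f i).
Proof.
move=> sf; pose restr i := \sum_(a <- F) f a * (i == a)%:R.
have s_delta a : rsummable (fun i => f a * (i == a)%:R).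
  by apply: rsummableZ; exact: rsummable_delta.
have s_restr : rsummable restr by exact: rsummable_sum.
have restrE i : restr i = if i \in F then f i else 0.
  case: ifPn => iF; rewrite /restr.
    rewrite (big_fsetD1 i) //= eqxx mulr1 big_seq big1 ?addr0 // => a.
    by rewrite !inE eq_sym => /andP[/negbTE ->]; rewrite mulr0.
  rewrite big_seq big1 // => a aF; case: eqP => [ia|]; rewrite ?mulr0 //.
  by rewrite ia aF in iF.
have restE : (fun i => if i \in F then 0 else f i) = (fun i => f i - restr i).
  by apply/funext => i; rewrite restrE; case: ifP; rewrite ?subrr ?subr0.
have sumE : rsum restr = \sum_(i <- F) f i.
  rewrite rsum_sum //; apply: eq_bigr => a _.
  by rewrite rsumZ ?rsum_delta ?mulr1 //; exact: rsummable_delta.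
by rewrite restE; split; [exact: rsummableB|rewrite rsumB // sumE addrC subrK].
Qed.

End RealSumSplitting.

Section RealSumNat.
Context {R : realType}.
Implicit Type f : nat -> R.

Lemma ge0_rsum_series f (M : R) : (forall n, 0 <= f n) ->
  series f @ \oo --> M -> rsummable f /\ rsum f = M.
Proof.
move=> f0 fM.
have seriesE : \esum_(i in [set: nat]) (f i)%:E = M%:E.
  rewrite -nneseries_esumT => [|n]; last by rewrite lee_fin.
  under eq_fun do rewrite sumEFin.
  by rewrite EFin_lim; [rewrite (cvg_lim _ fM)|apply/cvg_ex; exists M].
split; last by rewrite ge0_rsumE // seriesE.
rewrite /rsummable /summable (eq_esum (b := fun i => (f i)%:E)) ?seriesE ?ltry // => i _.
by rewrite /= ger0_norm.
Qed.

Lemma rsum_geometric (q : R) : 0 <= q < 1 ->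
  rsummable (fun j => q ^+ j) /\ rsum (fun j => q ^+ j) = (1 - q)^-1.
Proof.
move=> /andP[q0 q1]; apply: ge0_rsum_series => [n|]; first exact: exprn_ge0.
rewrite -[(1 - q)^-1]mul1r (_ : (fun j => q ^+ j) = geometric 1 q).
  by apply: cvg_geometric_series; rewrite ger0_norm.
by apply/funext => j; rewrite /= mul1r.
Qed.

Definition zeta_coef (m j : nat) : R := (j.+1%:R ^+ m)^-1.

Lemma zeta_coef_ge0 m j : 0 <= zeta_coef m j.
Proof. by rewrite invr_ge0 exprn_ge0. Qed.

Lemma zeta_coef0 m : zeta_coef m 0 = 1.
Proof. by rewrite /zeta_coef expr1n invr1. Qed.

Let sum_zeta2_le n : series (zeta_coef 2) n.+2 <= 7 / 4 - n.+2%:R^-1.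
Proof.
elim: n => [|n IH].
  by rewrite /series /= !big_nat_recr //= big_nil /zeta_coef; lra.
rewrite /series /= big_nat_recr //=; apply: le_trans (lerD IH (lexx _)) _.
rewrite /zeta_coef -[n.+3]addn1 natrD; have : 0 < n.+2%:R :> R by rewrite ltr0n.
move: (n.+2%:R : R) => x x0; have x1 : 0 < x + 1 by rewrite addr_gt0.
have : (x + 1)^-1 * (x + 1)^-1 <= x^-1 * (x + 1)^-1.
  by rewrite ler_wpM2r ?invr_ge0 ?(ltW x1) // lef_pV2 ?posrE //; lra.
have -> : x^-1 * (x + 1)^-1 = x^-1 - (x + 1)^-1 by field; rewrite !gt_eqF.
by rewrite expr2 invfM; lra.
Qed.

Let sum_zeta_le m n : (2 <= m)%N -> series (zeta_coef m) n <= 7 / 4.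
Proof.
move=> m2; apply: (@le_trans _ _ (series (zeta_coef 2) n.+2)); last first.
  by apply: le_trans (sum_zeta2_le n) _; rewrite lerBlDr lerDl invr_ge0.
apply: (@le_trans _ _ (series (zeta_coef 2) n)).
  apply: ler_sum => j _; rewrite lef_pV2 ?posrE ?exprn_gt0 //.
  by apply: ler_weXn2l; rewrite ?ler1n.
by apply: nondecreasing_series (leqW (leqnSn n)) => j _ _; exact: zeta_coef_ge0.
Qed.

Lemma zeta_series m : (2 <= m)%N ->
  rsummable (zeta_coef m) /\ rsum (zeta_coef m) <= 7 / 4.
Proof.
move=> m2; have zeta_cvg : cvgn (series (zeta_coef m)).
  apply: nondecreasing_is_cvgn.
    by apply: nondecreasing_series => j _ _; exact: zeta_coef_ge0.
  by exists (7 / 4) => _ [n _ <-]; exact: sum_zeta_le.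
have [s ->] := ge0_rsum_series (zeta_coef_ge0 m) zeta_cvg; split => //.
by apply: limr_le => //; apply: nearW => n; exact: sum_zeta_le.
Qed.

End RealSumNat.

(** * Real and integer row vectors *)

Section RowVectors.
Context {R : realType} {d : nat}.
Implicit Types (x y a b : 'rV[R]_d) (A : set 'rV[R]_d).

Definition dot a x : R := \sum_(j < d) a 0 j * x 0 j.

Lemma dotC a x : dot a x = dot x a.
Proof. by apply: eq_bigr => j _; rewrite mulrC. Qed.

Lemma dotDr a x y : dot a (x + y) = dot a x + dot a y.
Proof. by rewrite /dot -big_split; apply: eq_bigr => j _; rewrite !mxE mulrDr. Qed.

Lemma dotZr a s x : dot a (s *: x) = s * dot a x.
Proof. by rewrite /dot mulr_sumr; apply: eq_bigr => j _; rewrite !mxE mulrCA. Qed.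

Lemma dot0r a : dot a 0 = 0.
Proof. by rewrite /dot big1 // => j _; rewrite mxE mulr0. Qed.

Lemma dotNr a x : dot a (- x) = - dot a x.
Proof. by rewrite -scaleN1r dotZr mulN1r. Qed.

Lemma dotBr a x y : dot a (x - y) = dot a x - dot a y.
Proof. by rewrite dotDr dotNr. Qed.

Lemma dotDl a b x : dot (a + b) x = dot a x + dot b x.
Proof. by rewrite ![dot _ x]dotC dotDr. Qed.

Lemma dotZl a s x : dot (s *: a) x = s * dot a x.
Proof. by rewrite ![dot _ x]dotC dotZr. Qed.

Lemma dotNl a x : dot (- a) x = - dot a x.
Proof. by rewrite ![dot _ x]dotC dotNr. Qed.

Lemma dotBl a b x : dot (a - b) x = dot a x - dot b x.
Proof. by rewrite ![dot _ x]dotC dotBr. Qed.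

Lemma dot_sumr a (I : Type) (s : seq I) (P : pred I) (F : I -> 'rV[R]_d) :
  dot a (\sum_(i <- s | P i) F i) = \sum_(i <- s | P i) dot a (F i).
Proof.
by elim/big_rec2: _ => [|i u v _ <-]; [exact: dot0r|rewrite dotDr].
Qed.

Lemma dot_suml (I : Type) (s : seq I) (P : pred I) (F : I -> 'rV[R]_d) x :
  dot (\sum_(i <- s | P i) F i) x = \sum_(i <- s | P i) dot (F i) x.
Proof. by rewrite dotC dot_sumr; apply: eq_bigr => i _; rewrite dotC. Qed.

Lemma dot_delta x j : dot (delta_mx 0 j) x = x 0 j.
Proof.
rewrite /dot (bigD1 j) //= big1 => [|i ij]; first by rewrite mxE !eqxx mul1r addr0.
by rewrite mxE (negbTE ij) andbF mul0r.
Qed.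

Lemma dotxx_ge0 x : 0 <= dot x x.
Proof. by apply: sumr_ge0 => j _; rewrite -expr2 sqr_ge0. Qed.

Lemma dotxx_eq0 x : dot x x = 0 -> x = 0.
Proof.
move=> /eqP; rewrite psumr_eq0 => [/allP xx|j _]; last by rewrite -expr2 sqr_ge0.
apply/rowP => j; rewrite mxE; apply/eqP.
by have := xx j; rewrite mem_index_enum mulf_eq0 orbb; apply.
Qed.

Lemma dotxx_gt0 x : x != 0 -> 0 < dot x x.
Proof.
by move=> x0; rewrite lt_def dotxx_ge0 andbT; apply: contra x0 => /eqP/dotxx_eq0 ->.
Qed.

Lemma dot_sqD b s x :
  dot (b + s *: x) (b + s *: x) = dot b b + 2 * s * dot b x + s ^+ 2 * dot x x.
Proof. by rewrite !dotDl !dotDr !dotZl !dotZr (dotC x b); ring. Qed.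

Lemma ler_coord_norm x j : `|x 0 j| <= `|x|.
Proof.
rewrite [leRHS]/Num.norm /= mx_normrE.
exact: (le_bigmax _ (fun ij => `|x ij.1 ij.2|) (0, j)).
Qed.

Lemma row_norm_le x (e : R) : 0 <= e -> (forall j, `|x 0 j| <= e) -> `|x| <= e.
Proof.
move=> e0 xe; rewrite [leLHS]/Num.norm /= mx_normrE.
by apply: bigmax_le => // -[i j] _; rewrite ord1.
Qed.

Lemma ler_norm_dot a x : `|dot a x| <= d%:R * `|a| * `|x|.
Proof.
apply: le_trans (ler_norm_sum _ _ _) _.
apply: (@le_trans _ _ (\sum_(j < d) `|a| * `|x|)).
  by apply: ler_sum => j _; rewrite normrM ler_pM ?ler_coord_norm.
by rewrite sumr_const card_ord -mulrA mulr_natl.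
Qed.

Lemma eucl_norm_le x : eucl_norm x <= d%:R * `|x|.
Proof.
rewrite /eucl_norm -[leRHS]ger0_norm ?mulr_ge0 // -sqrtr_sqr ler_wsqrtr //.
apply: (@le_trans _ _ (\sum_(j < d) `|x| ^+ 2)).
  by apply: ler_sum => j _; rewrite -[leLHS]real_normK ?num_real // lerXn2r ?nnegrE ?ler_coord_norm.
rewrite sumr_const card_ord exprMn -[leLHS]mulr_natl ler_wpM2r ?sqr_ge0 //.
by rewrite -natrX ler_nat; case: (d) => // n; rewrite expnS leq_pmulr // expn1.
Qed.

Lemma dot_continuous a : continuous (dot a).
Proof.
apply: continuous_big => [|j _ x]; first exact: add_continuous.
by apply: continuousM; [exact: cst_continuous|exact: coord_continuous].
Qed.

Lemma dot_continuousl x : continuous (dot^~ x).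
Proof.
by rewrite (_ : dot^~ x = dot x); [exact: dot_continuous|apply/funext => a; rewrite dotC].
Qed.

Lemma dotxx_continuous : continuous (fun x => dot x x).
Proof.
apply: continuous_big => [|j _ x]; first exact: add_continuous.
by apply: continuousM; exact: coord_continuous.
Qed.

Lemma closed_norm_le_compact A (M : R) :
  closed A -> (forall x, A x -> `|x| <= M) -> compact A.
Proof.
move=> A_closed AM; apply: bounded_closed_compact => //.
by exists M; split=> [|M' MM' x Ax]; [exact: num_real|exact: le_trans (AM x Ax) (ltW MM')].
Qed.

Lemma interior_norm_le A x : A° x ->
  exists2 r : R, 0 < r & forall y, `|y - x| <= r -> A y.
Proof.
move=> /nbhs_closedballP[r rA]; exists r%:num => // y yx; apply: rA.
by rewrite closed_ballE //= /closed_ball_ /= distrC.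
Qed.

End RowVectors.

Section IntegerRows.
Context {R : realType} {d : nat}.
Implicit Types (v w : 'rV[int]_d) (x : 'rV[R]_d).

Definition intr_row v : 'rV[R]_d := map_mx intr v.

Definition floor_row x : 'rV[int]_d := map_mx Num.floor x.

Lemma intr_rowD v w : intr_row (v + w) = intr_row v + intr_row w.
Proof. exact: map_mxD. Qed.

Lemma intr_rowB v w : intr_row (v - w) = intr_row v - intr_row w.
Proof. exact: map_mxB. Qed.

Lemma intr_row0 : intr_row 0 = 0.
Proof. exact: map_mx0. Qed.

Lemma intr_rowMn v n : intr_row (v *+ n) = n%:R *: intr_row v.
Proof. by rewrite /intr_row raddfMn /= scaler_nat. Qed.

Lemma intr_row_inj : injective intr_row.
Proof.
by move=> v w /rowP vw; apply/rowP => j; have := vw j; rewrite !mxE => /intr_inj.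
Qed.

Lemma intr_row_eq0 v : (intr_row v == 0) = (v == 0).
Proof. by rewrite -intr_row0 (inj_eq intr_row_inj). Qed.

Lemma intr_row_integral v : integral_vector (intr_row v).
Proof. by apply/mxOverP => i j; rewrite mxE intr_int. Qed.

Lemma integral_intr_row x : integral_vector x -> exists v, x = intr_row v.
Proof.
by move=> /mxOverP xi; exists (floor_row x); apply/rowP => j; rewrite !mxE floorK.
Qed.

Lemma row_neq0P v : v != 0 -> exists j, v 0 j != 0.
Proof.
move=> v0; apply/existsP; apply: contraNT v0 => /existsPn vn.
by apply/eqP/rowP => j; rewrite mxE; apply/eqP; have := vn j; rewrite negbK.
Qed.

Lemma norm_intr_row_ge1 v : v != 0 -> 1 <= `|intr_row v|.
Proof.
move=> /row_neq0P[j vj]; apply: le_trans (ler_coord_norm _ j); rewrite mxE -intr_norm.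
by rewrite -[1]/(1%:~R) ler_int -gtz0_ge1 normr_gt0.
Qed.

Lemma floor_row_coord x j : 0 <= (x - intr_row (floor_row x)) 0 j < 1.
Proof.
rewrite !mxE; have := floor_itv (x 0 j); rewrite intrD => /andP[lo hi].
by rewrite subr_ge0 lo /= ltrBlDl.
Qed.

Lemma floor_row_dist x : `|x - intr_row (floor_row x)| <= 1.
Proof.
apply: row_norm_le => // j; have /andP[lo hi] := floor_row_coord x j.
by rewrite ger0_norm // ltW.
Qed.

End IntegerRows.

Lemma first_order_ge0 {R : realType} (e u w : R) : 0 < e ->
  (forall s, 0 < s -> s <= e -> 0 <= s * u + s ^+ 2 * w) -> 0 <= u.
Proof.
move=> e0 quad; rewrite leNgt; apply/negP => u0.
have w1 : 0 < `|w| + 1 by rewrite ltr_wpDl.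
pose s := Num.min e (- u / (2 * (`|w| + 1))).
have s0 : 0 < s by rewrite lt_min e0 divr_gt0 ?oppr_gt0 // mulr_gt0.
have /(quad s s0) : s <= e by rewrite ge_min lexx.
have : s * (2 * (`|w| + 1)) <= - u by rewrite -ler_pdivlMr ?mulr_gt0 // ge_min lexx orbT.
have := ler_norm w; nra.
Qed.

(** * Pointed cones *)

Section ConvexCones.
Context {R : realType} {d : nat}.
Implicit Types (A C : set 'rV[R]_d) (a b x y z p : 'rV[R]_d).

Lemma ler_norm_sqrt_dot x : `|x| <= Num.sqrt (dot x x).
Proof.
apply: row_norm_le => [|j]; first exact: sqrtr_ge0.
rewrite -sqrtr_sqr ler_wsqrtr // /dot (bigD1 j) //= expr2 lerDl.
by apply: sumr_ge0 => i _; rewrite -expr2 sqr_ge0.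
Qed.

Lemma closest_point A z : closed A -> A !=set0 ->
  exists2 p, A p & forall x, A x -> dot (p - z) (p - z) <= dot (x - z) (x - z).
Proof.
move=> A_closed [x0 Ax0]; pose sqdist x := dot (x - z) (x - z).
have sqdist_cts : continuous sqdist.
  move=> x; apply: (@continuous_comp _ _ _ (fun y => y - z) (fun y => dot y y)).
    by apply: continuousB; [exact: cvg_id|exact: cst_continuous].
  exact: dotxx_continuous.
pose K := A `&` [set x | sqdist x <= sqdist x0].
have K_compact : compact K.
  apply: (@closed_norm_le_compact _ _ _ (Num.sqrt (sqdist x0) + `|z|)) => [|x [_ /= xx0]].
    apply: closedI => //; apply: (@preimage_closed _ _ sqdist [set y | y <= sqdist x0]).
      by move=> x _; exact: sqdist_cts.
    exact: closed_le.
  rewrite -[x in leLHS](subrK z); apply: le_trans (ler_normD _ _) _; rewrite lerD2r.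
  by apply: le_trans (ler_norm_sqrt_dot _) _; exact: ler_wsqrtr.
have K_neq0 : K !=set0 by exists x0; split => //=.
have [p /set_mem[Ap p_le] p_min] :=
  EVT_min_rV K_neq0 K_compact (continuous_subspaceT sqdist_cts).
exists p => // x Ax; have [xx0|/ltW xx0] := leP (sqdist x) (sqdist x0).
  by apply: p_min; apply/mem_set; split.
exact: le_trans p_le xx0.
Qed.

Section Cone.
Variable C : set 'rV[R]_d.
Hypothesis C_cone : convex_cone C.

Lemma coneZ (s : R) x : 0 <= s -> C x -> C (s *: x).
Proof. by case: C_cone => H _; exact: H. Qed.

Lemma coneV (s : R) x : 0 < s -> C (s *: x) -> C x.
Proof.
move=> s0 Csx; rewrite -[x]scale1r -(mulVf (lt0r_neq0 s0)) -scalerA.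
by apply: coneZ => //; rewrite invr_ge0 ltW.
Qed.

Lemma coneD x y : C x -> C y -> C (x + y).
Proof.
case: C_cone => _ cvx Cx Cy.
have half : 0 <= (2^-1 : R) <= 1 by apply/andP; split; lra.
have := cvx x y (Itv01 (andP half).1 (andP half).2); rewrite !inE => /(_ Cx Cy).
rewrite /conv /= /unstable.onem; have -> : 1 - 2^-1 = 2^-1 :> R by lra.
by rewrite -scalerDr; apply: coneV; rewrite invr_gt0.
Qed.

Lemma cone0 : C !=set0 -> C 0.
Proof. by move=> [x Cx]; rewrite -(scale0r x); exact: coneZ. Qed.

Lemma closest_point_cone z p : C p ->
  (forall x, C x -> dot (p - z) (p - z) <= dot (x - z) (x - z)) ->
  (forall x, C x -> 0 <= dot (p - z) x) /\ dot (p - z) p = 0.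
Proof.
move=> Cp p_min; pose b := p - z.
have quad x (s : R) : C (p + s *: x) -> 0 <= s * (2 * dot b x) + s ^+ 2 * dot x x.
  move=> /p_min; rewrite addrAC dot_sqD -addrA lerDl.
  by rewrite -/b mulrA [s * 2]mulrC.
have dual x : C x -> 0 <= dot b x.
  move=> Cx; rewrite -(pmulr_rge0 _ (ltr0Sn _ 1)).
  apply: (first_order_ge0 ltr01) => s s0 _; apply: quad.
  by apply: coneD => //; apply: coneZ => //; exact: ltW.
split=> //; apply/eqP; rewrite eq_le dual // andbT -oppr_ge0 -dotNr.
rewrite -(pmulr_rge0 _ (ltr0Sn _ 1)).
apply: (first_order_ge0 ltr01) => s _ s1; apply: quad.
by rewrite scalerN -{1}[p]scale1r -scalerBl; apply: coneZ; rewrite ?subr_ge0.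
Qed.

Lemma cone_separation z : closed C -> C !=set0 -> ~ C z ->
  exists2 b, forall x, C x -> 0 <= dot b x & dot b z < 0.
Proof.
move=> C_closed C_neq0 Cz; have [p Cp p_min] := closest_point z C_closed C_neq0.
have [dual ortho] := closest_point_cone Cp p_min.
exists (p - z) => //.
have -> : dot (p - z) z = - dot (p - z) (p - z) by rewrite dotBr ortho sub0r opprK.
rewrite oppr_lt0 dotxx_gt0 // subr_eq0.
by apply/eqP => pz; rewrite pz in Cp.
Qed.

Lemma pointed_coneN x : pointed C -> C x -> x != 0 -> ~ C (- x).
Proof.
move=> C_pointed Cx x0 CNx; apply: C_pointed; exists 0, x; split => // t.
rewrite add0r; have [t0|t0] := leP 0 t; first exact: coneZ.
by rewrite -[t]opprK scaleNr -scalerN; apply: coneZ => //; rewrite oppr_ge0 ltW.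
Qed.

Lemma cone_normalize x : C x -> x != 0 -> C (`|x|^-1 *: x) /\ `| `|x|^-1 *: x| = 1.
Proof.
move=> Cx x0; split; first by apply: coneZ => //; rewrite invr_ge0.
by rewrite normrZ ger0_norm ?invr_ge0 // mulVf // normr_eq0.
Qed.

Definition coercive a := exists2 c : R, 0 < c & forall x, C x -> c * `|x| <= dot a x.

Lemma coercive_ge0 a x : coercive a -> C x -> 0 <= dot a x.
Proof.
by move=> [c c0 ac] Cx; apply: le_trans (ac _ Cx); rewrite mulr_ge0 // ltW.
Qed.

Lemma coercive_gt0 a x : coercive a -> C x -> x != 0 -> 0 < dot a x.
Proof.
by move=> [c c0 ac] Cx x0; apply: lt_le_trans (ac _ Cx); rewrite mulr_gt0 ?normr_gt0.
Qed.

Lemma coercive_eq0 a x : coercive a -> C x -> dot a x = 0 -> x = 0.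
Proof.
move=> a_coercive Cx ax0; apply/eqP/negPn/negP => x0.
by have := coercive_gt0 a_coercive Cx x0; rewrite ax0 ltxx.
Qed.

Let sphere_compact : closed C -> compact (C `&` [set x : 'rV[R]_d | `|x| = 1]).
Proof.
move=> C_closed; apply: (@closed_norm_le_compact _ _ _ 1) => [|x [_ /= ->] //].
apply: closedI => //; apply: (@preimage_closed _ _ (fun x : 'rV[R]_d => `|x|) [set y | y = 1]).
  by move=> x _; exact: norm_continuous.
exact: closed_eq.
Qed.

Lemma pos_coercive b : closed C -> (forall x, C x -> x != 0 -> 0 < dot b x) ->
  coercive b.
Proof.
move=> C_closed b_pos; set K := C `&` [set x : 'rV[R]_d | `|x| = 1].
have [K_neq0|K_empty] := pselect (K !=set0); last first.
  exists 1 => // x Cx; have [->|x0] := eqVneq x 0; first by rewrite normr0 mulr0 dot0r.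
  by case: K_empty; exists (`|x|^-1 *: x); have [? ?] := cone_normalize Cx x0.
have [p /set_mem[Cp /= p1] p_min] := EVT_min_rV K_neq0 (sphere_compact C_closed)
  (continuous_subspaceT (@dot_continuous _ _ b)).
have p0 : p != 0 by apply/eqP => p0; move: p1; rewrite p0 normr0; lra.
exists (dot b p) => [|x Cx]; first exact: b_pos.
have [->|x0] := eqVneq x 0; first by rewrite normr0 mulr0 dot0r.
rewrite -ler_pdivlMr ?normr_gt0 // [leRHS]mulrC -dotZr.
by apply: p_min; apply/mem_set; have [? ?] := cone_normalize Cx x0.
Qed.

Lemma coercive_exists : closed C -> C !=set0 -> pointed C -> exists a, coercive a.
Proof.
move=> C_closed C_neq0 C_pointed.
pose dual := [set b | forall x, C x -> 0 <= dot b x].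
have : finite_subset_cover dual (fun b => [set x | 0 < dot b x])
    (C `&` [set x : 'rV[R]_d | `|x| = 1]).
  have := sphere_compact C_closed; rewrite compact_cover; apply => [b _|x [Cx /= x1]].
    apply: (@open_comp _ _ (dot b) [set y | 0 < y]); last exact: open_gt.
    by move=> x _; exact: dot_continuous.
  have x0 : x != 0 by apply/eqP => x0; move: x1; rewrite x0 normr0; lra.
  have [b bC bx] := cone_separation C_closed C_neq0 (pointed_coneN C_pointed Cx x0).
  by exists b => //=; rewrite dotNr oppr_lt0 in bx.
move=> [D D_dual cover]; exists (\sum_(b <- D) b); apply: pos_coercive => // x Cx x0.
have [b bD /= bx] := cover _ (cone_normalize Cx x0).
rewrite dot_suml (big_fsetD1 b) //=; apply: ltr_pwDl.
  by move: bx; rewrite dotZr pmulr_rgt0 // invr_gt0 normr_gt0.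
rewrite big_seq; apply: sumr_ge0 => e; rewrite !inE => /andP[_ eD].
by have := D_dual _ eD; rewrite inE; apply.
Qed.

Lemma dual_norm_le k (r : R) a : 0 < r -> (forall y, `|y - k| <= r -> C y) ->
  (forall x, C x -> 0 <= dot a x) -> r * `|a| <= dot a k.
Proof.
move=> r0 kr a_ge0; have ak0 : 0 <= dot a k by apply/a_ge0/kr; rewrite subrr normr0 ltW.
rewrite mulrC -ler_pdivlMr //; apply: row_norm_le => [|j]; first by rewrite divr_ge0 // ltW.
pose e : 'rV[R]_d := (r * Num.sg (a 0 j)) *: delta_mx 0 j.
have ae : dot a e = r * `|a 0 j|.
  by rewrite dotZr dotC dot_delta -mulrA -normrEsg.
have /a_ge0 : C (k - e).
  apply: kr; rewrite addrAC subrr add0r normrN; apply: row_norm_le => [|i]; first exact: ltW.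
  rewrite !mxE eqxx /= !normrM gtr0_norm // -mulrA ler_piMr ?(ltW r0) //.
  by rewrite normr_sg normr_nat; case: (a 0 j != 0); case: (i == j); rewrite /= ?mulr1 ?mulr0.
by rewrite dotBr ae ler_pdivlMr // mulrC; lra.
Qed.

Lemma deep_lattice_point : C° !=set0 ->
  exists u : 'rV[int]_d, forall y, `|y - intr_row u| <= 1 -> C y.
Proof.
move=> [x /interior_norm_le[r r0 xr]].
pose m := (Num.truncn (2 / r)).+1; have m0 : 0 < m%:R :> R by rewrite ltr0n.
exists (floor_row (m%:R *: x)) => y yu; apply: (@coneV m%:R^-1); first by rewrite invr_gt0.
apply: xr; rewrite -[x](scalerK (lt0r_neq0 m0)) -scalerBr normrZ gtr0_norm ?invr_gt0 //.
rewrite ler_pdivrMl //; apply: (@le_trans _ _ 2).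
  rewrite -[y](subrK (intr_row (floor_row (m%:R *: x)))) -addrA.
  apply: le_trans (ler_normD _ _) _; apply: lerD => //.
  by rewrite distrC floor_row_dist.
by rewrite -ler_pdivrMr // ltW // truncnS_gt.
Qed.

End Cone.

End ConvexCones.

(** * Lattice sums over cones *)

Lemma sum_inj_le_sum {R : realType} (T : finType) (I : eqType) (s : seq I)
    (h : I -> T) (f : T -> R) :
  (forall i, 0 <= f i) -> uniq s -> {in s &, injective h} ->
  \sum_(i <- s) f (h i) <= \sum_x f x.
Proof.
move=> f0 s_uniq h_inj; rewrite -(big_map h xpredT f) big_uniq ?map_inj_in_uniq //=.
by rewrite [leRHS](bigID (mem (map h s))) /= lerDl sumr_ge0.
Qed.

Lemma ge0_rsum_fintype {R : realType} (T : finType) (f : T -> R) :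
  (forall i, 0 <= f i) -> rsummable f -> rsum f = \sum_i f i.
Proof.
move=> f0 sf; apply/eqP; rewrite eq_le; apply/andP; split.
  apply: rsum_le_bound => // F.
  exact: (sum_inj_le_sum (h := id) (f := f) f0 (fset_uniq F)).
by apply: (sum_inj_le_rsum (h := id) (f := f)) => //; exact: index_enum_uniq.
Qed.

Section IntegerRowSums.
Context {R : realType}.

Lemma rsummable_pow_absz (q : R) : 0 <= q < 1 -> rsummable (fun z : int => q ^+ `|z|).
Proof.
move=> q01; have [s _] := rsum_geometric q01.
have q0 n : 0 <= q ^+ n by rewrite exprn_ge0 //; case/andP: q01.
pose G := rsum (fun n => q ^+ n).
apply: (@ge0_rsummable _ _ _ (G + G)) => // F; rewrite (bigID (fun z => 0 <= z)) /=.
apply: lerD; rewrite -big_filter; apply: (sum_inj_le_rsum (h := absz) q0 s).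
- exact: filter_uniq (fset_uniq _).
- by move=> z w; rewrite !mem_filter => /andP[? _] /andP[? _]; lia.
- exact: filter_uniq (fset_uniq _).
by move=> z w; rewrite !mem_filter => /andP[? _] /andP[? _]; lia.
Qed.

Lemma rsummable_row_prod d (g : int -> R) : (forall z, 0 <= g z) -> rsummable g ->
  rsummable (fun v : 'rV[int]_d => \prod_(j < d) g (v 0 j)).
Proof.
move=> g0 sg; apply: (@ge0_rsummable _ _ _ (rsum g ^+ d)) => [v|F].
  by apply: prodr_ge0.
pose A := (0 |` [fset z in [seq (v : 'rV[int]_d) 0 j | v <- F, j <- enum 'I_d]])%fset.
have A0 : 0 \in A by rewrite !inE eqxx.
have inA v j : v \in F -> v 0 j \in A.
  by move=> vF; rewrite !inE; apply/orP; right; apply: allpairs_f; rewrite ?mem_enum.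
pose h (v : 'rV[int]_d) := [ffun j => insubd (FSetSub A0) (v 0 j)].
have hE v j : v \in F -> val (h v j) = v 0 j.
  by move=> vF; rewrite ffunE insubdK // inA.
have -> : \sum_(v <- F) \prod_(j < d) g (v 0 j) = \sum_(v <- F) \prod_j g (val (h v j)).
  by apply: eq_big_seq => v vF; apply: eq_bigr => j _; rewrite hE.
apply: (@le_trans _ _ (\sum_(w : {ffun 'I_d -> A}) \prod_j g (val (w j)))).
  apply: (sum_inj_le_sum (f := fun w : {ffun 'I_d -> A} => \prod_j g (val (w j))) _
    (fset_uniq F)) => [w|v w vF wF vw]; first exact: prodr_ge0.
  apply/rowP => j.
  by rewrite -(hE v) // -(hE w) // vw.
rewrite -(bigA_distr_bigA (fun _ z => g (val z))) prodr_const card_ord.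
apply: lerXn2r; rewrite ?nnegrE ?rsum_ge0 ?sumr_ge0 //.
by rewrite -(big_seq_fsetE _ A xpredT g); exact: sum_le_rsum.
Qed.

Lemma rsummable_exp_norm d (c : R) : 0 < c ->
  rsummable (fun v : 'rV[int]_d => expR (- (c * `|intr_row v : 'rV[R]_d|))).
Proof.
move=> c0; pose q := expR (- (c / d.+1%:R)).
have q01 : 0 <= q < 1 by rewrite expR_ge0 expR_lt1 oppr_lt0 divr_gt0.
have q0 z : 0 <= q ^+ `|z|%N by rewrite exprn_ge0 // expR_ge0.
apply: le_rsummable (rsummable_row_prod d q0 (rsummable_pow_absz q01)) => v.
rewrite ger0_norm ?expR_ge0 //.
rewrite (eq_bigr (fun j => expR (- (c / d.+1%:R * `|(v 0 j)%:~R|)))) => [|j _].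
  rewrite -expR_sum ler_expR sumrN lerN2 -mulr_sumr -mulrA ler_pM2l //.
  rewrite ler_pdivrMl //; apply: (@le_trans _ _ (d%:R * `|intr_row v : 'rV[R]_d|)).
    rewrite mulr_natl -[X in _ <= _ *+ X]card_ord -sumr_const; apply: ler_sum => j _.
    by have := ler_coord_norm (intr_row v : 'rV[R]_d) j; rewrite mxE.
  by rewrite ler_wpM2r // ler_nat.
by rewrite /q -expRM_natl natr_absz intr_norm mulrN mulrC.
Qed.

End IntegerRowSums.

Section DivisionWithRemainder.
Context {d : nat} (N : nat).

Definition remainder_row (r : {ffun 'I_d -> 'I_N.+1}) : 'rV[int]_d := \row_j (r j : nat)%:Z.

Lemma divmod_row_bij : bijective
  (fun q : {ffun 'I_d -> 'I_N.+1} * 'rV[int]_d => q.2 *+ N.+1 + remainder_row q.1).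
Proof.
have N0 : N.+1%:Z != 0 by [].
have modE (z : int) (r : 'I_N.+1) : ((z * N.+1%:Z + (r : nat)%:Z) %% N.+1%:Z)%Z = (r : nat).
  by rewrite modzMDl modz_nat modn_small.
exists (fun w : 'rV[int]_d => ([ffun j : 'I_d => inord `|(w 0%R j %% N.+1)%Z|%N : 'I_N.+1],
                               \row_j (w 0%R j %/ N.+1)%Z)).
  move=> [r v]; congr pair.
    apply/ffunP => j; rewrite ffunE !mxE mulmxnE -mulr_natr natz modE absz_nat.
    exact: inord_val.
  apply/rowP => j; rewrite !mxE mulmxnE -mulr_natr natz divzMDl //.
  by rewrite divz_nat divn_small ?addr0.
move=> w; apply/rowP => j; rewrite mxE mulmxnE -mulr_natr natz !mxE ffunE inordK; last by lia.
by rewrite [RHS](divz_eq _ N.+1); congr (_ + _); lia.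
Qed.

Lemma rsum_divmod {R : realType} (g : 'rV[int]_d -> R) : (forall v, 0 <= g v) -> rsummable g ->
  (forall r, rsummable (fun v => g (v *+ N.+1 + remainder_row r))) /\
  rsum g = \sum_r rsum (fun v => g (v *+ N.+1 + remainder_row r)).
Proof.
move=> g0 sg; have [sgb <-] := ge0_rsum_bij divmod_row_bij g0 sg.
have gb0 (r : {ffun 'I_d -> 'I_N.+1}) v : 0 <= g (v *+ N.+1 + remainder_row r) by [].
have [s1 s2 E] := ge0_rsum_pair gb0 sgb; split => //; rewrite [LHS]E.
rewrite ge0_rsum_fintype // => r; exact: rsum_ge0.
Qed.

End DivisionWithRemainder.

Lemma rsum_translate {R : realType} (T : zmodType) (g : T -> R) (u : T) :
  (forall v, 0 <= g v) -> rsummable g ->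
  rsummable (fun v => g (v + u)) /\ rsum (fun v => g (v + u)) = rsum g.
Proof.
move=> g0 sg; apply: (ge0_rsum_bij (h := +%R^~ u)) => //.
by exists (fun v => v - u) => v /=; rewrite ?addrK ?subrK.
Qed.

Section LatticeDensity.
Context {R : realType} {d : nat} (C : set 'rV[R]_d).
Hypothesis C_cone : convex_cone C.
Implicit Types (v : 'rV[int]_d) (f g phi : 'rV[R]_d -> R) (x : 'rV[R]_d) (t : R).

Definition lattice_term f t v : R :=
  if `[< C (intr_row v) >] then f (t^-1 *: intr_row v) else 0.

Definition lattice_density f t : R := rsum (lattice_term f t) / t ^+ d.

(* For the functions considered here these are Riemann sums, so this is the integral of
   [f] over [C]. *)
Definition cone_integral f : R := lim (lattice_density f t @[t --> +oo]).

Definition exp_decay f := exists c M : R,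
  0 < c /\ forall x, C x -> `|f x| <= M * expR (- (c * `|x|)).

Definition homogeneous phi := forall (s : R) x, 0 <= s -> C x -> phi (s *: x) = s * phi x.

Lemma lattice_term_ge0 f t v : (forall x, C x -> 0 <= f x) -> 0 < t ->
  0 <= lattice_term f t v.
Proof.
move=> f0 t0; rewrite /lattice_term; case: asboolP => // Cv; apply: f0.
by apply: (coneZ C_cone); rewrite ?invr_ge0 ?ltW.
Qed.

Lemma lattice_term_le f g t v : (forall x, C x -> f x <= g x) -> 0 < t ->
  lattice_term f t v <= lattice_term g t v.
Proof.
move=> fg t0; rewrite /lattice_term; case: asboolP => // Cv; apply: fg.
by apply: (coneZ C_cone); rewrite ?invr_ge0 ?ltW.
Qed.

Lemma exp_decay_summable f t : exp_decay f -> 0 < t -> rsummable (lattice_term f t).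
Proof.
move=> [c [M [c0 fM]]] t0.
apply: (@le_rsummable _ _ _ (fun v => `|M| * expR (- (c / t * `|intr_row v : 'rV[R]_d|)))).
  move=> v; rewrite /lattice_term; case: asboolP => [Cv|_]; last first.
    by rewrite normr0 mulr_ge0 // expR_ge0.
  have ti : 0 < t^-1 by rewrite invr_gt0.
  apply: le_trans (fM _ (coneZ C_cone (ltW ti) Cv)) _.
  rewrite normrZ gtr0_norm // mulrA.
  by apply: ler_wpM2r; [exact: expR_ge0|exact: ler_norm].
by apply/rsummableZ/rsummable_exp_norm; rewrite divr_gt0.
Qed.

Lemma le_exp_decay f g : exp_decay g -> (forall x, C x -> `|f x| <= g x) -> exp_decay f.
Proof.
move=> [c [M [c0 gM]]] fg; exists c, M; split => // x Cx.
apply: le_trans (gM _ Cx); apply: le_trans (fg _ Cx) _; exact: ler_norm.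
Qed.

Let exp_decay_weaken f (c c' M M' : R) :
  (forall x, C x -> `|f x| <= M * expR (- (c * `|x|))) -> c' <= c -> `|M| <= M' ->
  forall x, C x -> `|f x| <= M' * expR (- (c' * `|x|)).
Proof.
move=> fM cc MM x Cx; apply: le_trans (fM _ Cx) _.
apply: (@le_trans _ _ (M' * expR (- (c * `|x|)))).
  by rewrite ler_wpM2r ?expR_ge0 //; apply: le_trans MM; exact: ler_norm.
rewrite ler_wpM2l //; first exact: le_trans (normr_ge0 _) MM.
by rewrite ler_expR lerN2 ler_wpM2r.
Qed.

Lemma exp_decayD f g : exp_decay f -> exp_decay g -> exp_decay (fun x => f x + g x).
Proof.
move=> [c [M [c0 fM]]] [c' [M' [c'0 gM]]].
exists (Num.min c c'), (`|M| + `|M'|); split; first by rewrite lt_min c0.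
move=> x Cx; apply: le_trans (ler_normD _ _) _; rewrite mulrDl; apply: lerD.
  by apply: (exp_decay_weaken fM) => //; rewrite ge_min lexx.
by apply: (exp_decay_weaken gM) => //; rewrite ge_min lexx orbT.
Qed.

Lemma exp_decayZ (a : R) f : exp_decay f -> exp_decay (fun x => a * f x).
Proof.
move=> [c [M [c0 fM]]]; exists c, (`|a| * M); split => // x Cx.
by rewrite normrM -mulrA ler_wpM2l // fM.
Qed.

Lemma exp_decay_expR phi : (exists2 c : R, 0 < c & forall x, C x -> c * `|x| <= phi x) ->
  exp_decay (fun x => expR (- phi x)).
Proof.
move=> [c c0 cphi]; exists c, 1; split => // x Cx.
by rewrite ger0_norm ?expR_ge0 // mul1r ler_expR lerN2 cphi.
Qed.

Lemma lattice_densityD f g t : exp_decay f -> exp_decay g -> 0 < t ->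
  lattice_density (fun x => f x + g x) t = lattice_density f t + lattice_density g t.
Proof.
move=> df dg t0; rewrite /lattice_density -mulrDl -rsumD; try exact: exp_decay_summable.
congr (_ / _); apply: eq_rsum => v; rewrite /lattice_term; case: asboolP => // _.
by rewrite addr0.
Qed.

Lemma lattice_densityZ (a : R) f t : exp_decay f -> 0 < t ->
  lattice_density (fun x => a * f x) t = a * lattice_density f t.
Proof.
move=> df t0; rewrite /lattice_density mulrA -rsumZ; last exact: exp_decay_summable.
congr (_ / _); apply: eq_rsum => v; rewrite /lattice_term; case: asboolP => // _.
by rewrite mulr0.
Qed.

Lemma le_lattice_density f g t : exp_decay f -> exp_decay g -> 0 < t ->
  (forall x, C x -> f x <= g x) -> lattice_density f t <= lattice_density g t.
Proof.
move=> df dg t0 fg; rewrite /lattice_density ler_pM2r ?invr_gt0 ?exprn_gt0 //.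
apply: le_rsum; try exact: exp_decay_summable.
by move=> v; exact: lattice_term_le.
Qed.

Lemma lattice_density_ge0 f t : 0 < t -> (forall x, C x -> 0 <= f x) ->
  0 <= lattice_density f t.
Proof.
move=> t0 f0; apply: divr_ge0; last by apply/exprn_ge0/ltW.
by apply: rsum_ge0 => v; exact: lattice_term_ge0.
Qed.

Lemma ler_norm_lattice_density f g t : exp_decay f -> exp_decay g -> 0 < t ->
  (forall x, C x -> `|f x| <= g x) -> `|lattice_density f t| <= lattice_density g t.
Proof.
move=> df dg t0 fg; rewrite ler_norml lerNl -mulN1r -lattice_densityZ //.
apply/andP; split; apply: le_lattice_density => //; try exact: exp_decayZ; move=> x Cx.
  by rewrite mulN1r; have := fg _ Cx; rewrite ler_norml => /andP[]; lra.
by have := fg _ Cx; rewrite ler_norml => /andP[]; lra.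
Qed.

Lemma cone_integral_eq f (g : R -> R) (l : R) : (forall t, 0 < t -> lattice_density f t = g t) ->
  g t @[t --> +oo] --> l -> cone_integral f = l.
Proof.
move=> fg gl; apply: cvg_lim => //; apply: cvg_trans gl; apply: near_eq_cvg.
by near=> t; rewrite fg //; near: t; exact: nbhs_pinfty_gt.
Unshelve. all: by end_near. Qed.

End LatticeDensity.

Section ScaleLimits.
Context {R : realType}.
Implicit Types (c t : R).

Lemma expR_div_cvg1 c : expR (c / t) @[t --> +oo] --> (1 : R).
Proof.
have c_cvg0 : c / t @[t --> +oo] --> (0 : R).
  rewrite -[X in _ --> X](mulr0 c); apply: cvgMr.
  by apply/gtr0_cvgV0; [near=> t; near: t; exact: nbhs_pinfty_gt|exact: cvg_id].
rewrite -[X in _ --> X]expR0.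
by apply: (continuous_cvg _ _ c_cvg0); exact: continuous_expR.
Unshelve. all: by end_near. Qed.

Lemma le_of_powD1_harmonic (u A s : R) n : 0 <= A ->
  (forall N, u <= A * (1 + s / N.+1%:R) ^+ n) -> u <= A.
Proof.
move=> A0 uA; have harm : (1 + s / N.+1%:R) ^+ n @[N --> \oo] --> (1 : R).
  have H : 1 + s * harmonic N @[N --> \oo] --> 1 + s * 0.
    by apply: cvgD; [exact: cvg_cst|apply: cvgMr; exact: cvg_harmonic].
  rewrite mulr0 addr0 in H; rewrite -[X in _ --> X](expr1n _ n).
  exact: (@continuous_cvg _ _ _ _ _ _ (fun x : R => x ^+ n) _ (@exprn_continuous R n 1) H).
have : A * (1 + s / N.+1%:R) ^+ n @[N --> \oo] --> A * 1 by exact: cvgMr.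
rewrite mulr1 => lim_A; apply: (ler_cvg_to (cvg_cst u) lim_A).
by apply: nearW => N; exact: uA.
Qed.

Lemma two_scale_cvg (l : R -> R) c : 0 <= c -> (forall t, 0 < t -> 0 <= l t) ->
  (forall t t', 0 < t -> 0 < t' -> l t <= expR (c / t) * (expR (c / t') * l t')) ->
  exists I : R, [/\ 0 <= I, l t @[t --> +oo] --> I &
    forall t, 0 < t -> l t <= expR (c / t) * I].
Proof.
move=> c0 l0 ll; pose E := [set expR (- (c / t)) * l t | t in [set t | 0 < t]].
have expK t x : expR (- (c / t)) * (expR (c / t) * x) = x.
  by rewrite mulrA -expRD addNr expR0 mul1r.
have Eub t' : 0 < t' -> ubound E (expR (c / t') * l t').
  move=> t'0 _ [t /= t0 <-].
  by have := ler_wpM2l (expR_ge0 (- (c / t))) (ll _ _ t0 t'0); rewrite expK.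
have supE : has_sup E.
  split; last by exists (expR (c / 1) * l 1); apply: Eub.
  by exists (expR (- (c / 1)) * l 1); exists 1 => //=; exact: ltr01.
have sup_le t : 0 < t -> sup E <= expR (c / t) * l t.
  by move=> t0; apply: ge_sup (Eub _ t0); exact: supE.1.
have le_sup t : 0 < t -> l t <= expR (c / t) * sup E.
  move=> t0; have : expR (- (c / t)) * l t <= sup E by apply: (ub_le_sup supE.2); exists t.
  by rewrite expRN ler_pdivrMl ?expR_gt0.
exists (sup E); split => //.
  apply: le_trans (ub_le_sup supE.2 (ex_intro2 _ _ 1 ltr01 erefl)).
  by rewrite mulr_ge0 ?expR_ge0 ?l0.
have exp_sup (s : R) : expR (s / t) * sup E @[t --> +oo] --> sup E.
  by rewrite -[X in _ --> X]mul1r; apply: cvgMl; exact: expR_div_cvg1.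
apply: (squeeze_cvgr _ (exp_sup (- c)) (exp_sup c)); near=> t.
have t0 : 0 < t by near: t; exact: nbhs_pinfty_gt.
by rewrite le_sup // andbT mulNr expRN ler_pdivrMl ?expR_gt0 // sup_le.
Unshelve. all: by end_near. Qed.

End ScaleLimits.

Section ScaleComparison.
Context {R : realType} {d : nat} (C : set 'rV[R]_d).
Hypothesis C_cone : convex_cone C.
Implicit Types (v : 'rV[int]_d) (x y : 'rV[R]_d) (t : R) (N : nat).

(* [u] lies so deep inside the cone that rounding [x + u], for [x] in the cone, to a
   lattice point does not leave the cone. *)
Variable u : 'rV[int]_d.
Hypothesis u_deep : forall y, `|y - intr_row u| <= 1 -> C y.

Local Notation radius := (`|intr_row u : 'rV[R]_d| + 1).

Variables (phi : 'rV[R]_d -> R) (K : R).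
Hypotheses (phi_homog : homogeneous C phi) (K_ge0 : 0 <= K) (phi_lip : K.-lipschitz_C phi).
Hypothesis phi_coercive : exists2 c : R, 0 < c & forall x, C x -> c * `|x| <= phi x.

Let f x := expR (- phi x).

Let f_ge0 x : C x -> 0 <= f x. Proof. by move=> _; exact: expR_ge0. Qed.

Let f_decay : exp_decay C f. Proof. exact: exp_decay_expR. Qed.

Let deep_shift x y : C x -> `|y - x - intr_row u| <= 1 -> C y.
Proof.
by move=> Cx yxu; rewrite -[y](subrK x); apply: (coneD C_cone) => //; exact: u_deep.
Qed.

Let f_shift_le t x y : 0 < t -> C x -> `|y - x - intr_row u| <= 1 ->
  f (t^-1 *: x) <= expR (K * radius / t) * f (t^-1 *: y).
Proof.
move=> t0 Cx yxu; have ti : 0 <= t^-1 by rewrite invr_ge0 ltW.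
have Cy := deep_shift Cx yxu.
rewrite /f -expRD ler_expR !phi_homog // -lerBlDr opprK addrC -mulrBr mulrC.
rewrite ler_wpM2r //; have := phi_lip (conj Cy Cx : (C `*` C) (y, x)).
move=> /ler_normlW/le_trans; apply; rewrite ler_wpM2l //= -[y - x](subrK (intr_row u)).
by rewrite [leRHS]addrC; apply: le_trans (ler_normD _ _) _; rewrite lerD2r.
Qed.

Let quotient_dist N v (r : {ffun 'I_d -> 'I_N.+1}) :
  `|N.+1%:R^-1 *: intr_row (v *+ N.+1 + remainder_row r) - intr_row v : 'rV[R]_d| <= 1.
Proof.
have N0 : 0 < N.+1%:R :> R by rewrite ltr0n.
rewrite intr_rowD intr_rowMn scalerDr scalerA mulVf ?gt_eqF // scale1r addrAC subrr add0r.
rewrite normrZ gtr0_norm ?invr_gt0 // ler_pdivrMl // mulr1.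
apply: row_norm_le => // j; rewrite !mxE -pmulrn normr_nat ler_nat.
by rewrite ltnW.
Qed.

Let sum_remainders N (s : R) : \sum_(r : {ffun 'I_d -> 'I_N.+1}) s = N.+1%:R ^+ d * s.
Proof. by rewrite sumr_const card_ffun !card_ord -[LHS]mulr_natl natrX. Qed.

Lemma lattice_sum_refine N t : 0 < t ->
  N.+1%:R ^+ d * rsum (lattice_term C f t)
    <= expR (K * radius / t) * rsum (lattice_term C f (N.+1%:R * t)).
Proof.
move=> t0; have N0 : 0 < N.+1%:R :> R by rewrite ltr0n.
have Nt0 : 0 < N.+1%:R * t by rewrite mulr_gt0.
have g0 v : 0 <= lattice_term C f (N.+1%:R * t) v by exact: lattice_term_ge0.
have sg := exp_decay_summable C_cone f_decay Nt0.
have [sr ->] := rsum_divmod N g0 sg.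
rewrite -sum_remainders mulr_sumr; apply: ler_sum => r _.
have [s <-] := rsum_translate u (fun v => g0 (v *+ N.+1 + remainder_row r)) (sr r).
rewrite -rsumZ //; apply: le_rsum => [||v]; [exact: exp_decay_summable|exact: rsummableZ|].
rewrite {1}/lattice_term; case: asboolP => [Cv|_]; last by rewrite mulr_ge0 ?expR_ge0.
set w := _ *+ _ + _; set z := N.+1%:R^-1 *: intr_row w : 'rV[R]_d.
have zvu : `|z - intr_row v - intr_row u| <= 1.
  by rewrite -addrA -opprD -intr_rowD; exact: quotient_dist.
have Cw : C (intr_row w).
  by apply: (@coneV _ _ _ C_cone N.+1%:R^-1); rewrite ?invr_gt0 //; exact: deep_shift zvu.
rewrite /lattice_term asboolT // invfM [N.+1%:R^-1 * _]mulrC -scalerA -/z.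
exact: f_shift_le.
Qed.

Lemma lattice_sum_coarsen N t : 0 < t ->
  rsum (lattice_term C f (N.+1%:R * t))
    <= N.+1%:R ^+ d * (expR (K * radius / t) * rsum (lattice_term C f t)).
Proof.
move=> t0; have N0 : 0 < N.+1%:R :> R by rewrite ltr0n.
have Nt0 : 0 < N.+1%:R * t by rewrite mulr_gt0.
have g0 v : 0 <= lattice_term C f (N.+1%:R * t) v by exact: lattice_term_ge0.
have h0 v : 0 <= lattice_term C f t v by exact: lattice_term_ge0.
have [s] := rsum_translate u h0 (exp_decay_summable C_cone f_decay t0).
move: (rsum (lattice_term C f t)) => L <-.
have [sr ->] := rsum_divmod N g0 (exp_decay_summable C_cone f_decay Nt0).
rewrite -rsumZ // -sum_remainders; apply: ler_sum => r _.
apply: le_rsum => [||v]; [exact: sr|exact: rsummableZ|].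
rewrite {1}/lattice_term; case: asboolP => [Cw|_]; last by rewrite mulr_ge0 ?expR_ge0.
set w := _ *+ _ + _ in Cw *; set z := N.+1%:R^-1 *: intr_row w : 'rV[R]_d.
have Cz : C z by apply: (coneZ C_cone); rewrite ?invr_ge0.
have vuz : `|intr_row (v + u) - z - intr_row u| <= 1.
  by rewrite intr_rowD addrAC addrK distrC; exact: quotient_dist.
have Cvu := deep_shift Cz vuz; rewrite /lattice_term (asboolT Cvu).
rewrite invfM [N.+1%:R^-1 * _]mulrC -scalerA -/z.
exact: f_shift_le.
Qed.

Lemma lattice_sum_nondecreasing t t' : 0 < t -> t <= t' ->
  rsum (lattice_term C f t) <= rsum (lattice_term C f t').
Proof.
move=> t0 tt'; have t'0 := lt_le_trans t0 tt'.
apply: le_rsum => [||v]; try exact: exp_decay_summable.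
rewrite /lattice_term; case: asboolP => // Cv.
rewrite /f ler_expR lerN2 !phi_homog ?invr_ge0 ?(ltW t0) ?(ltW t'0) //.
have [c c0 c_le] := phi_coercive.
rewrite ler_wpM2r ?lef_pV2 ?posrE //.
by apply: le_trans (c_le _ Cv); rewrite mulr_ge0 // ltW.
Qed.

Lemma lattice_density_two_scale t t' : 0 < t -> 0 < t' ->
  lattice_density C f t
    <= expR (K * radius / t) * (expR (K * radius / t') * lattice_density C f t').
Proof.
move=> t0 t'0; have l0 : 0 <= lattice_density C f t' by exact: lattice_density_ge0.
apply: (@le_of_powD1_harmonic _ _ _ (t' / t) d) => [|N].
  by rewrite mulr_ge0 ?expR_ge0 // mulr_ge0 ?expR_ge0.
set E := expR _; set E' := expR _; have N0 : 0 < N.+1%:R :> R by rewrite ltr0n.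
pose T := N.+1%:R * t; pose M := Num.truncn (T / t').
have T0 : 0 < T by rewrite mulr_gt0.
have M_le : M.+1%:R * t' <= T + t'.
  rewrite -natr1 mulrDl mul1r lerD2r -ler_pdivlMr //.
  by rewrite truncn_le // divr_ge0 // ltW.
have le_M : T <= M.+1%:R * t' by rewrite -ler_pdivrMr // ltW // truncnS_gt.
have sums : N.+1%:R ^+ d * rsum (lattice_term C f t)
    <= E * (M.+1%:R ^+ d * (E' * rsum (lattice_term C f t'))).
  apply: le_trans (lattice_sum_refine N t0) _; rewrite ler_wpM2l ?expR_ge0 //.
  apply: le_trans (lattice_sum_nondecreasing T0 le_M) _; exact: lattice_sum_coarsen.
have td0 : 0 < T ^+ d by rewrite exprn_gt0.
have t'd0 : 0 < t' ^+ d by rewrite exprn_gt0.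
apply: (@le_trans _ _ (E * (E' * lattice_density C f t') * (M.+1%:R * t' / T) ^+ d)).
  rewrite /lattice_density ler_pdivrMr ?exprn_gt0 // -(ler_pM2l (exprn_gt0 d N0)).
  apply: le_trans sums _; apply: eq_ler; rewrite /T expr_div_n !exprMn; field.
  by rewrite !expf_neq0 ?gt_eqF.
apply: ler_wpM2l; first by rewrite mulr_ge0 ?expR_ge0 // mulr_ge0 ?expR_ge0.
apply: lerXn2r; rewrite ?nnegrE.
- by rewrite divr_ge0 ?mulr_ge0 ?ltW.
- by rewrite addr_ge0 // !divr_ge0 // ltW.
rewrite ler_pdivrMr //; apply: le_trans M_le _; apply: eq_ler; rewrite /T; field.
by rewrite !gt_eqF.
Qed.

Lemma exp_density_cvg : [/\ 0 <= cone_integral C f,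
  lattice_density C f t @[t --> +oo] --> cone_integral C f &
  forall t, 0 < t -> lattice_density C f t <= expR (K * radius / t) * cone_integral C f].
Proof.
have rate_ge0 : 0 <= K * radius by rewrite mulr_ge0 // addr_ge0.
have density_ge0 t : 0 < t -> 0 <= lattice_density C f t.
  by move=> t0; exact: lattice_density_ge0.
have [I [I0 I_cvg I_ge]] := two_scale_cvg rate_ge0 density_ge0 lattice_density_two_scale.
by have -> : cone_integral C f = I by exact: cvg_lim I_cvg.
Qed.

End ScaleComparison.

Lemma exp_density_cvg_uniform {R : realType} {d : nat} (C : set 'rV[R]_d) :
  convex_cone C -> C° !=set0 -> exists2 S : R, 0 <= S &
  forall (phi : 'rV[R]_d -> R) (K : R), homogeneous C phi -> 0 <= K -> K.-lipschitz_C phi ->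
    (exists2 c : R, 0 < c & forall x, C x -> c * `|x| <= phi x) ->
  let f x := expR (- phi x) in
  [/\ 0 <= cone_integral C f,
      lattice_density C f t @[t --> +oo] --> cone_integral C f &
      forall t, 0 < t -> lattice_density C f t <= expR (K * S / t) * cone_integral C f].
Proof.
move=> C_cone C_int; have [u u_deep] := deep_lattice_point C_cone C_int.
exists (`|intr_row u : 'rV[R]_d| + 1) => [|phi K phi_homog K0 phi_lip phi_coercive].
  by rewrite addr_ge0.
exact: exp_density_cvg.
Qed.

(** * Moments of the exponential measure on a cone *)

Section HomogeneousLipschitz.
Context {R : realType} {d : nat} (C : set 'rV[R]_d).
Hypothesis C_cone : convex_cone C.
Implicit Types (f g : 'rV[R]_d -> R) (x y a th : 'rV[R]_d).

Definition homlip g := homogeneous C g /\ exists2 K : R, 0 <= K & K.-lipschitz_C g.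

Let lipschitzE (K : R) g x y : K.-lipschitz_C g -> C x -> C y ->
  `|g x - g y| <= K * `|x - y|.
Proof. by move=> gl Cx Cy; exact: (gl (x, y)). Qed.

Lemma homlip_eq0 g : homlip g -> C !=set0 -> g 0 = 0.
Proof. by move=> [gh _] [x Cx]; rewrite -(scale0r x) gh // mul0r. Qed.

Lemma eq_homlip f g : (forall x, C x -> f x = g x) -> homlip f -> homlip g.
Proof.
move=> fg [fh [K K0 fl]]; split.
  move=> s x s0 Cx; rewrite -!fg //; first exact: fh.
  exact: (coneZ C_cone).
by exists K => // -[x y] [/= Cx Cy]; rewrite -!fg //; exact: lipschitzE.
Qed.

Lemma homlip_dot a : homlip (dot a).
Proof.
split; first by move=> s x _ _; rewrite dotZr.
by exists (d%:R * `|a|) => [|[x y] _]; rewrite ?mulr_ge0 //= -dotBr ler_norm_dot.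
Qed.

Lemma homlip_coord j : homlip (fun x => x 0 j).
Proof. by apply: eq_homlip (homlip_dot (delta_mx 0 j)) => x _; exact: dot_delta. Qed.

Lemma homlipD f g : homlip f -> homlip g -> homlip (fun x => f x + g x).
Proof.
move=> [fh [K K0 fl]] [gh [L L0 gl]]; split.
  by move=> s x s0 Cx; rewrite fh // gh // mulrDr.
exists (K + L) => [|[x y] [/= Cx Cy]]; first exact: addr_ge0.
rewrite opprD addrACA mulrDl.
by apply: le_trans (ler_normD _ _) _; apply: lerD; exact: lipschitzE.
Qed.

Lemma homlipZ (s : R) g : homlip g -> homlip (fun x => s * g x).
Proof.
move=> [gh [L L0 gl]]; split; first by move=> r x r0 Cx; rewrite gh // mulrCA.
exists (`|s| * L) => [|[x y] [/= Cx Cy]]; first by rewrite mulr_ge0.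
by rewrite -mulrBr normrM -mulrA ler_wpM2l //; exact: lipschitzE.
Qed.

Lemma homlipN f : homlip f -> homlip (fun x => - f x).
Proof. by move=> /(homlipZ (-1)); apply: eq_homlip => x _; rewrite mulN1r. Qed.

Lemma homlipB f g : homlip f -> homlip g -> homlip (fun x => f x - g x).
Proof. by move=> hf /homlipN; exact: homlipD. Qed.

Lemma homlip0 : homlip (fun=> 0).
Proof. by apply: eq_homlip (homlipZ 0 (homlip_dot 0)) => x _; rewrite mul0r. Qed.

Lemma homlip_sum (I : Type) (s : seq I) (F : I -> 'rV[R]_d -> R) :
  (forall i, homlip (F i)) -> homlip (fun x => \sum_(i <- s) F i x).
Proof.
move=> hF; elim: s => [|i s IH].
  by apply: eq_homlip homlip0 => x _; rewrite big_nil.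
by apply: eq_homlip (homlipD (hF i) IH) => x _; rewrite big_cons.
Qed.

Lemma homlip_max f g : homlip f -> homlip g -> homlip (fun x => Num.max (f x) (g x)).
Proof.
move=> [fh [K K0 fl]] [gh [L L0 gl]]; split.
  by move=> s x s0 Cx; rewrite fh // gh // maxr_pMr.
exists (K + L) => [|[x y] [/= Cx Cy]]; first exact: addr_ge0.
have := lipschitzE fl Cx Cy; have := lipschitzE gl Cx Cy.
have := mulr_ge0 K0 (normr_ge0 (x - y)); have := mulr_ge0 L0 (normr_ge0 (x - y)).
rewrite mulrDl !ler_norml => pK pL /andP[? ?] /andP[? ?].
by case: (leP (f x) (g x)) => ?; case: (leP (f y) (g y)) => ?; apply/andP; split; lra.
Qed.

Lemma homlip_min f g : homlip f -> homlip g -> homlip (fun x => Num.min (f x) (g x)).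
Proof.
move=> /homlipN hf /homlipN hg; have := homlipN (homlip_max hf hg).
by apply: eq_homlip => x _; rewrite oppr_max !opprK.
Qed.

Lemma homlip_dist a th : homlip (fun x => `|x - dot a x *: th|).
Proof.
split; first by move=> s x s0 Cx; rewrite dotZr -scalerA -scalerBr normrZ ger0_norm.
exists (1 + d%:R * `|a| * `|th|) => [|[x y] _]; first by rewrite addr_ge0 ?mulr_ge0.
apply: le_trans (ler_dist_dist _ _) _ => /=.
have -> : x - dot a x *: th - (y - dot a y *: th) = (x - y) - dot a (x - y) *: th.
  by rewrite dotBr scalerBl !opprD !opprK addrACA.
apply: le_trans (ler_normB _ _) _; rewrite normrZ mulrDl mul1r lerD2l.
by rewrite mulrAC ler_wpM2r // ler_norm_dot.
Qed.

Section CoerciveRatio.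
Variable a : 'rV[R]_d.
Hypothesis a_coercive : coercive C a.

Lemma homlip_le_dot g : homlip g ->
  exists2 G : R, 0 <= G & forall x, C x -> `|g x| <= G * dot a x.
Proof.
move=> hg; have [c c0 ac] := a_coercive; have [_ [K K0 gl]] := hg.
exists (K / c) => [|x Cx]; first by rewrite divr_ge0 // ltW.
have C_neq0 : C !=set0 by exists x.
have := lipschitzE gl Cx (cone0 C_cone C_neq0); rewrite homlip_eq0 // !subr0.
by move=> /le_trans; apply; rewrite -mulrA ler_wpM2l // ler_pdivlMl // ac.
Qed.

Let ratio_bound g : homlip g ->
  exists2 G : R, 0 <= G & forall x, C x -> `|g x / dot a x| <= G.
Proof.
move=> hg; have [G G0 gG] := homlip_le_dot hg; exists G => // x Cx.
have [ax0|ax0] := eqVneq (dot a x) 0; first by rewrite ax0 invr0 mulr0 normr0.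
have ax_gt0 : 0 < dot a x by rewrite lt_def ax0 (coercive_ge0 a_coercive).
by rewrite normrM normfV (gtr0_norm ax_gt0) ler_pdivrMr // gG.
Qed.

Let ratio_diff f g x y : homlip f -> homlip g -> C x -> C y ->
  f x * g x / dot a x - f y * g y / dot a y
    = (f x - f y) * (g x / dot a x)
      + (f y / dot a y) * ((g x - g y) + (g x / dot a x) * dot a (y - x)).
Proof.
move=> hf hg Cx Cy; have C_neq0 : C !=set0 by exists x.
have [f0 g0] := (homlip_eq0 hf C_neq0, homlip_eq0 hg C_neq0).
rewrite dotBr; have [ax0|ax0] := eqVneq (dot a x) 0.
  by rewrite (coercive_eq0 a_coercive Cx ax0) f0 g0 dot0r invr0; ring.
have [ay0|ay0] := eqVneq (dot a y) 0; last by field; rewrite ax0 ay0.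
by rewrite (coercive_eq0 a_coercive Cy ay0) f0 g0 dot0r invr0; ring.
Qed.

Lemma homlip_mul_div f g : homlip f -> homlip g ->
  homlip (fun x => f x * g x / dot a x).
Proof.
move=> hf hg; have [F F0 fF] := ratio_bound hf; have [G G0 gG] := ratio_bound hg.
have [[fh [K K0 fl]] [gh [L L0 gl]]] := (hf, hg); split.
  move=> s x s0 Cx; rewrite fh // gh // dotZr.
  have [->|s_neq0] := eqVneq s 0; first by rewrite !mul0r.
  by rewrite invfM -!mulrA; congr (_ * _); rewrite [s * _]mulrCA mulVKf // mulrC -mulrA mulrC.
pose A := d%:R * `|a|; have A0 : 0 <= A by rewrite mulr_ge0.
exists (G * K + F * (L + G * A)) => [|[x y] [/= Cx Cy]]; first by rewrite !(addr_ge0, mulr_ge0).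
rewrite ratio_diff // [leRHS]mulrDl; apply: le_trans (ler_normD _ _) _; apply: lerD.
  by rewrite normrM mulrC -mulrA ler_pM ?gG //; exact: lipschitzE.
rewrite normrM -[leRHS]mulrA ler_pM ?fF // [leRHS]mulrDl; apply: le_trans (ler_normD _ _) _.
apply: lerD; first exact: lipschitzE.
by rewrite normrM -[leRHS]mulrA ler_pM ?gG // distrC ler_norm_dot.
Qed.

End CoerciveRatio.

End HomogeneousLipschitz.

Section ExponentialEstimates.
Context {R : realType}.
Implicit Types (u x : R).

Lemma norm_expR_sub1Dx_le u : `|expR u - 1 - u| <= u ^+ 2 * expR `|u|.
Proof.
have ge1 := expR_ge1Dx u; have geN := expR_ge1Dx (- u).
have e0 := expR_gt0 u; have eN0 := expR_gt0 (- u).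
have expRNK : expR u * expR (- u) = 1 by rewrite -expRD subrr expR0.
have chord : expR u - 1 <= u * expR u by nra.
rewrite ger0_norm; last by lra.
have [u0|u0] := leP 0 u.
  by have := ler_wpM2l u0 chord; rewrite (ger0_norm u0) expr2 -mulrA mulrBr mulr1; lra.
have eN1 : 1 <= expR (- u) by rewrite -expR0 ler_expR; lra.
have slope : u * (expR u - 1) <= u * u by rewrite ler_nM2l; lra.
have := ler_wpM2l (sqr_ge0 u) eN1.
by rewrite (ltr0_norm u0); move: slope; rewrite expr2 mulr1 mulrBr mulr1; lra.
Qed.

Lemma sqr_le_expR x : 0 <= x -> x ^+ 2 <= 32 * expR (x / 4).
Proof.
move=> x0; have x4 : 0 <= x / 4 by rewrite divr_ge0.
by have := expR_ge1Dxn 1 x4; rewrite (_ : 2`!%:R = 2 :> R) //; lra.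
Qed.

Lemma mul_expRN_le x : x * expR (- x) <= 2 * expR (- (2^-1 * x)).
Proof.
have -> : - x = - (2^-1 * x) - 2^-1 * x by field.
rewrite expRD mulrA ler_pM2r ?expR_gt0 // [X in _ * X]expRN ler_pdivrMr ?expR_gt0 //.
by have := expR_ge1Dx (2^-1 * x); lra.
Qed.

Lemma expR_tilt_second_order (G l y s : R) : 0 <= G -> 0 <= l -> `|y| <= G * l ->
  `|s * y| <= l / 2 ->
  `|expR (- (l - s * y)) - expR (- l) - s * (y * expR (- l))|
    <= 32 * G ^+ 2 * s ^+ 2 * expR (- (4^-1 * l)).
Proof.
move=> G0 l0 yG syl.
have -> : expR (- (l - s * y)) - expR (- l) - s * (y * expR (- l))
    = expR (- l) * (expR (s * y) - 1 - s * y) by rewrite opprB expRD; ring.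
rewrite normrM ger0_norm ?expR_ge0 //.
apply: le_trans (ler_wpM2l (expR_ge0 _) (norm_expR_sub1Dx_le _)) _.
have sy2 : (s * y) ^+ 2 <= s ^+ 2 * (G ^+ 2 * (32 * expR (l / 4))).
  rewrite exprMn ler_wpM2l ?sqr_ge0 //; apply: (@le_trans _ _ ((G * l) ^+ 2)).
    by rewrite -[y ^+ 2]real_normK ?num_real // lerXn2r ?nnegrE // mulr_ge0.
  by rewrite exprMn ler_wpM2l ?sqr_ge0 // sqr_le_expR.
have -> : expR (- (4^-1 * l)) = expR (- l) * (expR (l / 4) * expR (l / 2)).
  by rewrite -!expRD; congr expR; field.
apply: (@le_trans _ _ (expR (- l) * (s ^+ 2 * (G ^+ 2 * (32 * expR (l / 4))) * expR (l / 2)))).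
  rewrite ler_wpM2l ?expR_ge0 //; apply: ler_pM => //; rewrite ?sqr_ge0 ?expR_ge0 //.
  by rewrite ler_expR.
by apply: eq_ler; ring.
Qed.

End ExponentialEstimates.

Lemma cvg_uniform_approx {R : realType} (h : R -> R) :
  (forall e : R, 0 < e -> exists (g : R -> R) (l : R), g t @[t --> +oo] --> l /\
     \forall t \near +oo, `|g t - h t| <= e) ->
  exists l : R, h t @[t --> +oo] --> l.
Proof.
move=> approx; apply/cvg_ex/cauchy_cvgP/cauchy_exP => e e0.
have e4 : 0 < e / 4 by rewrite divr_gt0.
have [g [l [/cvgrPdist_le/(_ _ e4) gl gh]]] := approx _ e4.
exists l; apply: filterS2 gl gh => t lt ht; rewrite /ball /=.
have := ler_normD (l - g t) (g t - h t); rewrite addrA subrK; lra.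
Qed.

Section Moments.
Context {R : realType} {d : nat} (C : set 'rV[R]_d).
Hypotheses (C_cone : convex_cone C) (C_int : C° !=set0).
Implicit Types (g : 'rV[R]_d -> R) (x : 'rV[R]_d) (s t : R).

Definition laplace (a : 'rV[R]_d) g x := g x * expR (- dot a x).

Definition moment (a : 'rV[R]_d) g : R := cone_integral C (laplace a g).

Variable a : 'rV[R]_d.
Hypothesis a_coercive : coercive C a.

Lemma coerciveZ s : 0 < s ->
  exists2 c : R, 0 < c & forall x, C x -> c * `|x| <= s * dot a x.
Proof.
move=> s0; have [c c0 ac] := a_coercive.
by exists (s * c) => [|x Cx]; [rewrite mulr_gt0|rewrite -mulrA ler_pM2l // ac].
Qed.

Lemma exp_dot_decay s : 0 < s -> exp_decay C (fun x => expR (- (s * dot a x))).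
Proof. by move=> s0; apply: exp_decay_expR; exact: coerciveZ. Qed.

Lemma laplace_bound g : homlip C g -> exists2 G : R, 0 <= G &
  forall x, C x -> `|laplace a g x| <= G * expR (- (2^-1 * dot a x)).
Proof.
move=> hg; have [G G0 gG] := homlip_le_dot C_cone a_coercive hg.
exists (G * 2) => [|x Cx]; first by rewrite mulr_ge0.
rewrite normrM [X in _ * X]ger0_norm ?expR_ge0 //.
apply: le_trans (ler_wpM2r (expR_ge0 _) (gG _ Cx)) _.
by rewrite -!mulrA ler_wpM2l // mul_expRN_le.
Qed.

Lemma laplace_decay g : homlip C g -> exp_decay C (laplace a g).
Proof.
move=> hg; have [G _ gG] := laplace_bound hg.
have half : 0 < (2^-1 : R) by rewrite invr_gt0.
exact: le_exp_decay (exp_decayZ G (exp_dot_decay half)) gG.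
Qed.

Lemma exp_density_bounded s : 0 < s -> exists2 B : R, 0 <= B &
  forall t, 1 <= t -> lattice_density C (fun x => expR (- (s * dot a x))) t <= B.
Proof.
move=> s0; have [S S0 unif] := exp_density_cvg_uniform C_cone C_int.
have [sh [K K0 sl]] := homlipZ s (homlip_dot C a).
have [I0 _ I_ge] := unif _ _ sh K0 sl (coerciveZ s0).
set I := cone_integral _ _ in I0 I_ge.
exists (expR (K * S) * I) => [|t t1]; first by rewrite mulr_ge0 ?expR_ge0.
apply: le_trans (I_ge _ (lt_le_trans ltr01 t1)) _.
rewrite ler_wpM2r // ler_expR ler_pdivrMr ?(lt_le_trans ltr01) //.
by rewrite ler_peMr // mulr_ge0.
Qed.

Definition tilted_exp g s x := expR (- (dot a x - s * g x)).

Lemma tilted_exp0 g : tilted_exp g 0 = fun x => expR (- dot a x).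
Proof. by apply/funext => x; rewrite /tilted_exp mul0r subr0. Qed.

Lemma small_tilt g : homlip C g -> exists2 s0 : R, 0 < s0 &
  forall s x, `|s| <= s0 -> C x -> `|s * g x| <= dot a x / 2.
Proof.
move=> hg; have [G G0 gG] := homlip_le_dot C_cone a_coercive hg.
have G1 : 0 < 2 * (G + 1) by rewrite mulr_gt0 // ltr_wpDl.
exists (2 * (G + 1))^-1 => [|s x sG Cx]; first by rewrite invr_gt0.
have ax0 := coercive_ge0 a_coercive Cx.
rewrite normrM; apply: le_trans (ler_pM _ _ sG (gG _ Cx)) _ => //.
by rewrite ler_pdivrMl //; nra.
Qed.

Lemma small_tilt_coercive g s : (forall x, C x -> `|s * g x| <= dot a x / 2) ->
  exists2 c : R, 0 < c & forall x, C x -> c * `|x| <= dot a x - s * g x.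
Proof.
move=> sg; have [c c0 ac] := a_coercive.
exists (c / 2) => [|x Cx]; first by rewrite divr_gt0.
by have := ac _ Cx; have := sg _ Cx; have := ler_norm (s * g x); lra.
Qed.

Lemma tilted_exp_density_cvg g s : homlip C g ->
  (forall x, C x -> `|s * g x| <= dot a x / 2) ->
  lattice_density C (tilted_exp g s) t @[t --> +oo] --> cone_integral C (tilted_exp g s).
Proof.
move=> hg sg; have [S S0 unif] := exp_density_cvg_uniform C_cone C_int.
have [h [K K0 l]] := homlipB C_cone (homlip_dot C a) (homlipZ s hg).
by have [] := unif _ _ h K0 l (small_tilt_coercive sg).
Qed.

Lemma tilted_exp_second_order g : homlip C g -> exists s0 D : R, [/\ 0 < s0, 0 <= D,
  forall s x, `|s| <= s0 -> C x -> `|s * g x| <= dot a x / 2 &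
  forall s t, `|s| <= s0 -> 1 <= t ->
    `|lattice_density C (tilted_exp g s) t - lattice_density C (tilted_exp g 0) t
      - s * lattice_density C (laplace a g) t| <= D * s ^+ 2].
Proof.
move=> hg; have [G G0 gG] := homlip_le_dot C_cone a_coercive hg.
have [s0 s00 s0P] := small_tilt hg.
have quarter : 0 < (4^-1 : R) by rewrite invr_gt0.
have [B B0 BP] := exp_density_bounded quarter.
exists s0, (32 * G ^+ 2 * B); split => //; first by rewrite mulr_ge0 ?mulr_ge0 ?sqr_ge0.
move=> s t ss0 t1; have t0 := lt_le_trans ltr01 t1.
have tilt_decay r : `|r| <= s0 -> exp_decay C (tilted_exp g r).
  by move=> rs0; apply/exp_decay_expR/small_tilt_coercive => x; exact: s0P.
have [ds dg] := (tilt_decay s ss0, laplace_decay hg).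
have d0 : exp_decay C (tilted_exp g 0) by apply: tilt_decay; rewrite normr0 ltW.
have [dN0 dNg] := (exp_decayZ (-1) d0, exp_decayZ (- s) dg).
have d4 := exp_dot_decay quarter.
rewrite -[- (s * _)]mulNr -[- lattice_density _ _ _]mulN1r.
rewrite -!lattice_densityZ // -!lattice_densityD //; last exact: exp_decayD.
apply: (@le_trans _ _ (32 * G ^+ 2 * s ^+ 2 * lattice_density C (fun x =>
    expR (- (4^-1 * dot a x))) t)); last first.
  by rewrite [leRHS]mulrAC ler_wpM2l ?BP // mulr_ge0 ?sqr_ge0 // mulr_ge0 ?sqr_ge0.
rewrite -lattice_densityZ //; apply: ler_norm_lattice_density => //.
- by apply: exp_decayD => //; exact: exp_decayD.
- exact: exp_decayZ.
move=> x Cx; rewrite tilted_exp0 mulN1r mulNr.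
by apply: expR_tilt_second_order; rewrite ?gG ?s0P ?(coercive_ge0 a_coercive).
Qed.

(* The moment is the derivative at [s = 0] of the integrals of [tilted_exp g s]. *)
Lemma moment_cvg g : homlip C g ->
  lattice_density C (laplace a g) t @[t --> +oo] --> moment a g.
Proof.
move=> hg; suff [m mP] : exists m : R, lattice_density C (laplace a g) t @[t --> +oo] --> m.
  by apply/cvg_ex; exists m.
have [s0 [D [s00 D0 s0P DP]]] := tilted_exp_second_order hg.
apply: cvg_uniform_approx => e e0.
have D1 : 0 < D + 1 by rewrite ltr_wpDl.
pose s := Num.min s0 (e / (D + 1)).
have s_gt0 : 0 < s by rewrite lt_min s00 divr_gt0.
have ss0 : `|s| <= s0 by rewrite gtr0_norm // ge_min lexx.
have sD : s * D <= e.
  have : s * (D + 1) <= e by rewrite -ler_pdivlMr // ge_min lexx orbT.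
  by apply: le_trans; rewrite ler_pM2l // lerDl.
have tilt_cvg r : `|r| <= s0 -> lattice_density C (tilted_exp g r) t @[t --> +oo]
    --> cone_integral C (tilted_exp g r).
  by move=> rs0; apply: tilted_exp_density_cvg => // x; exact: s0P.
exists (fun t => s^-1 * (lattice_density C (tilted_exp g s) t
  - lattice_density C (tilted_exp g 0) t)); eexists; split.
  by apply: cvgMr; apply: cvgB; apply: tilt_cvg => //; rewrite normr0 ltW.
near=> t; have t1 : 1 <= t by near: t; apply: nbhs_pinfty_ge; exact: num_real.
have := DP s t ss0 t1.
set p := lattice_density C (tilted_exp g s) t; set q := lattice_density C (tilted_exp g 0) t.
set r := lattice_density C _ t => pqr.
have -> : s^-1 * (p - q) - r = s^-1 * (p - q - s * r) by field; rewrite gt_eqF.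
rewrite normrM gtr0_norm ?invr_gt0 // ler_pdivrMl //; apply: le_trans pqr _.
by rewrite expr2 mulrCA ler_pM2l // mulrC.
Unshelve. all: by end_near. Qed.

Lemma cone_integral_tilt_le g : homlip C g -> exists s0 D : R, [/\ 0 < s0,
  forall s x, `|s| <= s0 -> C x -> `|s * g x| <= dot a x / 2 &
  forall s, `|s| <= s0 -> cone_integral C (tilted_exp g s)
    <= cone_integral C (tilted_exp g 0) + s * moment a g + s ^+ 2 * D].
Proof.
move=> hg; have [s0 [D [s00 D0 s0P DP]]] := tilted_exp_second_order hg.
exists s0, D; split => // s ss0.
have tilt_cvg r : `|r| <= s0 -> lattice_density C (tilted_exp g r) t @[t --> +oo]
    --> cone_integral C (tilted_exp g r).
  by move=> rs0; apply: tilted_exp_density_cvg => // x; exact: s0P.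
have zero_small : `|0 : R| <= s0 by rewrite normr0 ltW.
have rhs_cvg : lattice_density C (tilted_exp g 0) t + s * lattice_density C (laplace a g) t
    + s ^+ 2 * D @[t --> +oo]
    --> cone_integral C (tilted_exp g 0) + s * moment a g + s ^+ 2 * D.
  apply: cvgD; last exact: cvg_cst.
  by apply: cvgD; [exact: tilt_cvg|apply: cvgMr; exact: moment_cvg].
apply: (ler_cvg_to (tilt_cvg s ss0) rhs_cvg); near=> t.
have t1 : 1 <= t by near: t; apply: nbhs_pinfty_ge; exact: num_real.
have := le_trans (ler_norm _) (DP s t ss0 t1).
by rewrite /= [D * _]mulrC; lra.
Unshelve. all: by end_near. Qed.

End Moments.

Section MomentAlgebra.
Context {R : realType} {d : nat} (C : set 'rV[R]_d) (a : 'rV[R]_d).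
Hypotheses (C_cone : convex_cone C) (C_int : C° !=set0) (a_coercive : coercive C a).
Implicit Types (f g xi : 'rV[R]_d -> R) (x th : 'rV[R]_d).

Local Notation moment := (moment C a).

Let moment_cvg_homlip g : homlip C g ->
  lattice_density C (laplace a g) t @[t --> +oo] --> moment g.
Proof. exact: moment_cvg. Qed.

Lemma eq_moment f g : homlip C g -> (forall x, C x -> f x = g x) -> moment f = moment g.
Proof.
move=> hg fg; apply: cone_integral_eq (moment_cvg_homlip hg) => t t0.
rewrite /lattice_density; congr (_ / _); apply: eq_rsum => v; rewrite /lattice_term.
case: asboolP => // Cv; rewrite /laplace fg //.
by apply: (coneZ C_cone); rewrite ?invr_ge0 ?ltW.
Qed.

Lemma momentD f g : homlip C f -> homlip C g ->
  moment (fun x => f x + g x) = moment f + moment g.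
Proof.
move=> hf hg.
have sum_cvg : lattice_density C (laplace a f) t + lattice_density C (laplace a g) t
    @[t --> +oo] --> moment f + moment g by apply: cvgD; exact: moment_cvg_homlip.
apply: cone_integral_eq sum_cvg => t t0; rewrite -lattice_densityD //; try exact: laplace_decay.
by congr (lattice_density C _ t); apply/funext => x; rewrite /laplace mulrDl.
Qed.

Lemma momentZ (s : R) g : homlip C g -> moment (fun x => s * g x) = s * moment g.
Proof.
move=> hg; have scaled_cvg : s * lattice_density C (laplace a g) t @[t --> +oo]
    --> s * moment g by apply: cvgMr; exact: moment_cvg_homlip.
apply: cone_integral_eq scaled_cvg => t t0; rewrite -lattice_densityZ //; last exact: laplace_decay.
by congr (lattice_density C _ t); apply/funext => x; rewrite /laplace mulrA.
Qed.

Lemma le_moment f g : homlip C f -> homlip C g -> (forall x, C x -> f x <= g x) ->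
  moment f <= moment g.
Proof.
move=> hf hg fg; apply: ler_cvg_to (moment_cvg_homlip hf) (moment_cvg_homlip hg) _.
near=> t; have t0 : 0 < t by near: t; exact: nbhs_pinfty_gt.
apply: le_lattice_density => //; try exact: laplace_decay.
by move=> x Cx; rewrite /laplace ler_wpM2r ?expR_ge0 // fg.
Unshelve. all: by end_near. Qed.

Lemma moment0 : moment (fun=> 0) = 0.
Proof.
rewrite -[RHS](mul0r (moment (fun=> 0))) -(momentZ 0 (homlip0 C_cone)).
by congr moment; apply/funext => x; rewrite mul0r.
Qed.

Lemma moment_sum (I : Type) (s : seq I) (F : I -> 'rV[R]_d -> R) :
  (forall i, homlip C (F i)) ->
  moment (fun x => \sum_(i <- s) F i x) = \sum_(i <- s) moment (F i).
Proof.
move=> hF; elim: s => [|i s IH].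
  rewrite big_nil -[RHS]moment0; apply: eq_moment; first exact: homlip0.
  by move=> x _; rewrite big_nil.
rewrite big_cons -IH -momentD //; last exact: homlip_sum.
by congr moment; apply/funext => x; rewrite big_cons.
Qed.

Lemma moment_ge0 g : homlip C g -> (forall x, C x -> 0 <= g x) -> 0 <= moment g.
Proof. by move=> hg g0; rewrite -moment0; apply: le_moment => //; exact: homlip0. Qed.

Lemma ler_norm_moment f g : homlip C f -> homlip C g -> (forall x, C x -> `|f x| <= g x) ->
  `|moment f| <= moment g.
Proof.
move=> hf hg fg; rewrite ler_norml lerNl -mulN1r -momentZ //.
apply/andP; split; apply: le_moment => //; try exact: homlipZ; move=> x Cx.
  by rewrite mulN1r; have := fg _ Cx; rewrite ler_norml => /andP[]; lra.
by have := fg _ Cx; rewrite ler_norml => /andP[]; lra.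
Qed.

Definition vector_moment xi : 'rV[R]_d := \row_j moment (fun x => xi x * x 0 j / dot a x).

Let homlip_vector_moment xi j : homlip C xi -> homlip C (fun x => xi x * x 0 j / dot a x).
Proof. by move=> hxi; apply: homlip_mul_div => //; exact: homlip_coord. Qed.

Lemma eq_vector_moment xi xi' : homlip C xi' -> (forall x, C x -> xi x = xi' x) ->
  vector_moment xi = vector_moment xi'.
Proof.
move=> hxi' E; apply/rowP => j; rewrite !mxE; apply: eq_moment => [|x Cx].
  exact: homlip_vector_moment.
by rewrite E.
Qed.

Lemma vector_momentD xi xi' : homlip C xi -> homlip C xi' ->
  vector_moment (fun x => xi x + xi' x) = vector_moment xi + vector_moment xi'.
Proof.
move=> hxi hxi'; apply/rowP => j; rewrite !mxE -momentD; try exact: homlip_vector_moment.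
by congr moment; apply/funext => x; ring.
Qed.

Lemma vector_momentZ (s : R) xi : homlip C xi ->
  vector_moment (fun x => s * xi x) = s *: vector_moment xi.
Proof.
move=> hxi; apply/rowP => j; rewrite !mxE -momentZ; last exact: homlip_vector_moment.
by congr moment; apply/funext => x; ring.
Qed.

Lemma vector_moment_sum (I : finType) (F : I -> 'rV[R]_d -> R) :
  (forall i, homlip C (F i)) ->
  vector_moment (fun x => \sum_i F i x) = \sum_i vector_moment (F i).
Proof.
move=> hF; apply/rowP => j; rewrite mxE summxE; under eq_bigr do rewrite mxE.
rewrite -(moment_sum _ (fun i => homlip_vector_moment j (hF i))).
by congr moment; apply/funext => x; rewrite !mulr_suml.
Qed.

Definition concentrated (eta : R) th xi :=
  forall x, C x -> xi x * `|x - dot a x *: th| <= eta * dot a x * xi x.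

Lemma vector_moment_concentrated (eta : R) th xi : homlip C xi -> 0 <= eta ->
  (forall x, C x -> 0 <= xi x) -> concentrated eta th xi ->
  `|vector_moment xi - moment xi *: th| <= eta * moment xi.
Proof.
move=> hxi eta0 xi0 xi_conc; apply: row_norm_le => [|j].
  by rewrite mulr_ge0 // moment_ge0.
have [hj hth] := (homlip_vector_moment j hxi, homlipZ (- th 0 j) hxi).
rewrite !mxE [moment xi * _]mulrC -mulNr -(momentZ (- th 0 j)) // -momentD // -(momentZ eta) //.
apply: ler_norm_moment => [||x Cx]; [exact: homlipD|exact: homlipZ|].
have [ax0|ax0] := eqVneq (dot a x) 0.
  have x0 := coercive_eq0 a_coercive Cx ax0.
  by rewrite x0 (homlip_eq0 hxi) ?dot0r ?invr0 ?mulr0 ?addr0 ?normr0 //; exists x.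
have ax_gt0 : 0 < dot a x by rewrite lt_def ax0 (coercive_ge0 a_coercive).
have -> : xi x * x 0 j / dot a x + - th 0 j * xi x
    = xi x * (x 0 j - dot a x * th 0 j) / dot a x by field.
rewrite normrM normfV (gtr0_norm ax_gt0) ler_pdivrMr // normrM (ger0_norm (xi0 _ Cx)).
rewrite mulrAC; apply: le_trans (xi_conc _ Cx); rewrite ler_wpM2l ?xi0 //.
by have := ler_coord_norm (x - dot a x *: th) j; rewrite !mxE.
Qed.

End MomentAlgebra.

Section Stationarity.
Context {R : realType} {d : nat} (C : set 'rV[R]_d).
Hypotheses (C_cone : convex_cone C) (C_int : C° !=set0).
Implicit Types (a b k : 'rV[R]_d).

Definition exp_integral a : R := cone_integral C (fun x => expR (- dot a x)).

Definition minimizer k a := forall a', coercive C a' ->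
  exp_integral a + dot a k <= exp_integral a' + dot a' k.

Let minimizer_moment_ge a b k : coercive C a -> minimizer k a ->
  dot b k <= moment C a (dot b).
Proof.
move=> a_coercive a_min.
have [s0 [D [s00 s0P DP]]] := cone_integral_tilt_le C_cone C_int a_coercive (homlip_dot C b).
rewrite -subr_ge0; apply: (first_order_ge0 (w := D) s00) => s s_gt0 ss0.
have {}ss0 : `|s| <= s0 by rewrite gtr0_norm.
have dotE x : dot (a - s *: b) x = dot a x - s * dot b x by rewrite dotBl dotZl.
have tilt_coercive : coercive C (a - s *: b).
  have [x Cx|c c0 cP] := small_tilt_coercive a_coercive (g := dot b) (s := s).
    exact: s0P.
  by exists c => // x Cx; rewrite dotE cP.
have tiltE : cone_integral C (tilted_exp a (dot b) s) = exp_integral (a - s *: b).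
  by congr (cone_integral C _); apply/funext => x; rewrite dotE.
have := a_min _ tilt_coercive; have := DP s ss0; rewrite dotE tiltE tilted_exp0.
rewrite -/(exp_integral a); move: (exp_integral a) (exp_integral _) (moment _ _ _) => I I' m.
lra.
Qed.

Lemma minimizer_moment a b k : coercive C a -> minimizer k a -> moment C a (dot b) = dot b k.
Proof.
move=> a_coercive a_min; apply/eqP; rewrite eq_le minimizer_moment_ge // andbT -lerN2.
have -> : - moment C a (dot b) = moment C a (dot (- b)).
  rewrite -mulN1r -momentZ //; last exact: homlip_dot.
  by congr moment; apply/funext => x; rewrite mulN1r dotNl.
by rewrite -dotNl; exact: minimizer_moment_ge.
Qed.

End Stationarity.

Lemma inf_cluster {R : realType} (T : topologicalType) (K D : set T) (obj : T -> R)
    (mu := inf [set obj a | a in D]) (e0 : R) :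
  compact K -> has_inf [set obj a | a in D] -> 0 < e0 ->
  (forall a, D a -> obj a < mu + e0 -> K a) ->
  exists2 b, K b & forall (e : R) (Z : set T), 0 < e -> closed Z ->
    (forall a, D a -> K a -> obj a < mu + e -> Z a) -> Z b.
Proof.
move=> K_compact D_inf e00 near_K.
pose near_min (e : R) := [set a | D a /\ obj a < mu + e].
pose F := filter_from [set e : R | 0 < e] near_min.
have F_proper : ProperFilter F.
  apply: filter_from_proper => [|e /= e_gt0]; last first.
    by have [_ [a Da <-] a_min] := inf_adherent e_gt0 D_inf; exists a.
  apply: filter_from_filter; first by exists e0.
  move=> e e' /= e_gt0 e'_gt0; exists (Num.min e e'); first by rewrite /= lt_min e_gt0.
  by move=> a [Da]; rewrite addr_minr lt_min => /andP[? ?]; split; split.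
have FK : F K by exists e0 => // a [Da a_min]; exact: near_K.
have [b [Kb b_cluster]] := K_compact F F_proper FK.
exists b => // e Z e_gt0 Z_closed near_Z.
rewrite (closure_id Z).1 //; move: b_cluster; rewrite clusterE; apply.
apply: (@filterS _ _ _ (near_min e `&` K)) => [a [[Da a_min] Ka]|].
  exact: near_Z.
by apply: filterI => //; exists e.
Qed.

Lemma le0_natmul_bounded {R : archiRealFieldType} (a B : R) :
  (forall N, N.+1%:R * a <= B) -> a <= 0.
Proof.
move=> bound; rewrite leNgt; apply/negP => a0.
have := bound (Num.truncn (B / a)); rewrite leNgt -ltr_pdivrMr // truncnS_gt.
by [].
Qed.

Section Minimizers.
Context {R : realType} {d : nat} (C : set 'rV[R]_d).
Hypotheses (C_closed : closed C) (C_cone : convex_cone C) (C_int : C° !=set0).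
Implicit Types (a b k x : 'rV[R]_d).

Lemma ray_lattice_points x : C x -> x != 0 -> exists (v : nat -> 'rV[int]_d) (S : R),
  [/\ injective v, forall i, C (intr_row (v i)) &
      forall i, exists2 s : R, 0 <= s & `|intr_row (v i) - s *: x| <= S].
Proof.
move=> Cx x0; have [u u_deep] := deep_lattice_point C_cone C_int.
have nx : 0 < `|x| by rewrite normr_gt0.
pose q := (Num.truncn (2 / `|x|)).+1; pose y i := (i * q)%:R *: x.
have qx : 2 < q%:R * `|x| by rewrite -ltr_pdivrMr // truncnS_gt.
exists (fun i => floor_row (y i) + u), (1 + `|intr_row u : 'rV[R]_d|).
have dist i : `|intr_row (floor_row (y i)) - y i| <= 1 by rewrite distrC floor_row_dist.
split=> [i j|i|i].
- move=> /addIr ij; apply/eqP; rewrite -(eqr_nat R) -subr_eq0; apply/negPn/negP => ij0.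
  have : `|y i - y j| <= 2.
    rewrite -[y i](subrK (intr_row (floor_row (y i)))) {2}ij -addrA.
    by apply: le_trans (ler_normD _ _) _; apply: lerD; [rewrite distrC|]; exact: dist.
  rewrite /y -scalerBl !natrM -mulrBl normrZ normrM normr_nat leNgt => /negP; apply.
  apply: lt_le_trans qx _; rewrite -mulrA ler_peMl ?mulr_ge0 //.
  by rewrite norm_intr_ge1 // rpredB ?natr_int.
- rewrite -[intr_row _](subrK (y i)) addrC; apply: (coneD C_cone); first exact: (coneZ C_cone).
  by apply: u_deep; rewrite intr_rowD addrAC addrK.
exists (i * q)%:R => //; rewrite intr_rowD addrAC.
by apply: le_trans (ler_normD _ _) _; rewrite lerD2r.
Qed.

Lemma coercive_of_bounded_sums b (B : R) :
  (forall F : {fset 'rV[int]_d},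
     \sum_(v <- F) lattice_term C (fun x => expR (- dot b x)) 1 v <= B) ->
  coercive C b.
Proof.
move=> sums_le; apply: pos_coercive => // x Cx x0; rewrite ltNge; apply/negP => bx.
have [v [S [v_inj Cv near_ray]]] := ray_lattice_points Cx x0.
have dot_le i : dot b (intr_row (v i)) <= d%:R * `|b| * S.
  have [s s0 vS] := near_ray i; rewrite -[intr_row _](subrK (s *: x)) dotDr dotZr.
  apply: (@le_trans _ _ (dot b (intr_row (v i) - s *: x))).
    by rewrite gerDl mulr_ge0_le0.
  apply: le_trans (ler_norm _) _; apply: le_trans (ler_norm_dot _ _) _.
  by rewrite ler_wpM2l ?mulr_ge0.
suff : expR (- (d%:R * `|b| * S)) <= 0 by rewrite leNgt expR_gt0.
apply: (@le0_natmul_bounded _ _ B) => N.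
apply: le_trans (sums_le [fset v i | i in iota 0 N.+1]%fset).
have -> : N.+1%:R * expR (- (d%:R * `|b| * S)) = \sum_(i <- iota 0 N.+1) expR (- (d%:R * `|b| * S)).
  by rewrite big_const_seq count_predT size_iota iter_addr_0 mulr_natl.
have perm_v : perm_eq [fset v i | i in iota 0 N.+1]%fset (map v (iota 0 N.+1)).
  apply: uniq_perm => [||w]; rewrite ?map_inj_uniq ?iota_uniq //.
  by apply/imfsetP/mapP => -[i]; exists i.
rewrite (perm_big _ perm_v) big_map; apply: ler_sum => i _.
by rewrite /lattice_term asboolT // invr1 scale1r ler_expR lerN2.
Qed.

Let exp_dot := fun b x : 'rV[R]_d => expR (- dot b x).

Lemma exp_integral_coercive : exists2 S : R, 0 <= S & forall a, coercive C a ->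
  [/\ 0 <= exp_integral C a,
      lattice_density C (exp_dot a) t @[t --> +oo] --> exp_integral C a &
      forall t, 0 < t -> lattice_density C (exp_dot a) t
        <= expR (`|a| * S / t) * exp_integral C a].
Proof.
have [S S0 unif] := exp_density_cvg_uniform C_cone C_int.
exists (d%:R * S) => [|a a_coercive]; first by rewrite mulr_ge0.
have [ah _] := homlip_dot C a.
have a_lip : (d%:R * `|a|).-lipschitz_C (dot a).
  by move=> [x y] _; rewrite /= -dotBr ler_norm_dot.
have [I0 I_cvg I_ge] := unif _ _ ah (mulr_ge0 (ler0n _ _) (normr_ge0 _)) a_lip a_coercive.
by split => // t t0; rewrite mulrCA mulrA; exact: I_ge.
Qed.

Section Existence.
Variables (k : 'rV[R]_d) (r : R).
Hypotheses (C_pointed : pointed C) (r_gt0 : 0 < r) (k_ball : forall y, `|y - k| <= r -> C y).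

Let C_neq0 : C !=set0.
Proof. by exists k; apply: k_ball; rewrite subrr normr0 ltW. Qed.

Let objective a := exp_integral C a + dot a k.

Let mu := inf [set objective a | a in coercive C].

Let objective_ge a : coercive C a -> dot a k <= objective a.
Proof.
move=> a_coercive; have [S _ /(_ a a_coercive)[I0 _ _]] := exp_integral_coercive.
by rewrite lerDr.
Qed.

Let objective_has_inf : has_inf [set objective a | a in coercive C].
Proof.
split.
  have [a a_coercive] := coercive_exists C_cone C_closed C_neq0 C_pointed.
  by exists (objective a); exists a.
exists 0 => _ [a a_coercive <-]; apply: le_trans (objective_ge a_coercive).
by apply: (coercive_ge0 a_coercive); apply: k_ball; rewrite subrr normr0 ltW.
Qed.

Let M := (mu + 1) / r.

Let near_minimizer_bounded a : coercive C a -> objective a < mu + 1 -> `|a| <= M.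
Proof.
move=> a_coercive a_min; rewrite ler_pdivlMr // mulrC.
apply: le_trans (dual_norm_le r_gt0 k_ball (fun x => coercive_ge0 a_coercive)) _.
exact: le_trans (objective_ge a_coercive) (ltW a_min).
Qed.

Let partial_sum_continuous t (F : {fset 'rV[int]_d}) :
  continuous (fun a => \sum_(v <- F) lattice_term C (exp_dot a) t v).
Proof.
apply: continuous_big => [|v _ a]; first exact: add_continuous.
rewrite /lattice_term; case: asboolP => _; last exact: cst_continuous.
apply: (@continuous_comp _ _ _ (fun a => - dot a (t^-1 *: intr_row v)) expR).
  by apply: continuousN; exact: dot_continuousl.
exact: continuous_expR.
Qed.

(* Finite partial sums are continuous in [a], so the bounds satisfied by near minimizers
   pass to a cluster point [b]. *)
Let cluster_partial_sum_le : exists (b : 'rV[R]_d) (S : R),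
  forall t (F : {fset 'rV[int]_d}), 0 < t ->
  (\sum_(v <- F) lattice_term C (exp_dot b) t v) / t ^+ d <= expR (S / t) * (mu - dot b k).
Proof.
have [S S0 SP] := exp_integral_coercive.
have ball_compact : compact [set a : 'rV[R]_d | `|a| <= M].
  apply: (@closed_norm_le_compact _ _ _ M) => //.
  apply: (@preimage_closed _ _ (fun a : 'rV[R]_d => `|a|) [set y | y <= M]) => [x _|].
    exact: norm_continuous.
  exact: closed_le.
have [b bM b_cluster] := inf_cluster ball_compact objective_has_inf ltr01 near_minimizer_bounded.
exists b, (M * S) => t F t0; set E := expR _; have E0 : 0 < E := expR_gt0 _.
have td0 : 0 < t ^+ d by rewrite exprn_gt0.
pose h a := \sum_(v <- F) lattice_term C (exp_dot a) t v.
pose lhs a := h a / t ^+ d + E * dot a k.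
have lhs_cts : continuous lhs.
  move=> a; apply: (@continuousD _ _ _ (fun x => h x / t ^+ d) (fun x => E * dot x k)).
    by apply: (@continuousM _ _ h (fun=> _));
      [exact: partial_sum_continuous|exact: cst_continuous].
  by apply: (@continuousM _ _ (fun=> E) (dot^~ k));
    [exact: cst_continuous|exact: dot_continuousl].
have lhs_le e : 0 < e -> lhs b <= E * (mu + e).
  move=> e0; apply: (b_cluster e [set a | lhs a <= E * (mu + e)]) => //.
    by apply: (@preimage_closed _ _ lhs [set y | y <= E * (mu + e)]) => [a _|];
      [exact: lhs_cts|exact: closed_le].
  move=> a a_coercive aM a_min /=; have [I0 _ I_ge] := SP a a_coercive.
  apply: (@le_trans _ _ (E * objective a)); last by rewrite ler_pM2l // ltW.
  rewrite /objective mulrDr lerD2r; apply: (@le_trans _ _ (lattice_density C (exp_dot a) t)).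
    rewrite /lattice_density ler_pM2r ?invr_gt0 //; apply: sum_le_rsum => [v|].
      by apply: lattice_term_ge0 => // x _; exact: expR_ge0.
    by apply: exp_decay_summable => //; exact: exp_decay_expR.
  apply: le_trans (I_ge _ t0) _; rewrite ler_wpM2r // ler_expR ler_pM2r ?invr_gt0 //.
  by rewrite ler_wpM2r.
rewrite mulrBr lerBrDr -/(h b) -/(lhs b); apply/ler_addgt0Pr => e e0.
have := lhs_le (e / E) (divr_gt0 e0 E0).
by rewrite mulrDr [E * (e / E)]mulrCA divff ?gt_eqF // mulr1.
Qed.

Lemma minimizer_exists : exists2 a, coercive C a & minimizer C k a.
Proof.
have [b [S b_le]] := cluster_partial_sum_le.
have b_coercive : coercive C b.
  apply: (@coercive_of_bounded_sums _ (expR S * (mu - dot b k))) => F.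
  by have := b_le 1 F ltr01; rewrite expr1n !divr1.
exists b => // a a_coercive; apply: (@le_trans _ _ mu); last first.
  by apply: (ge_inf objective_has_inf.2); exists a.
have [_ _ /(_ b b_coercive)[_ I_cvg _]] := exp_integral_coercive.
rewrite -lerBrDr -[leRHS]mul1r.
have bound_cvg : expR (S / t) * (mu - dot b k) @[t --> +oo] --> 1 * (mu - dot b k).
  by apply: cvgMl; exact: expR_div_cvg1.
apply: (ler_cvg_to I_cvg bound_cvg); near=> t.
have t0 : 0 < t by near: t; exact: nbhs_pinfty_gt.
rewrite /lattice_density ler_pdivrMr ?exprn_gt0 //; apply: rsum_le_bound => [v|F].
  by apply: lattice_term_ge0 => // x _; exact: expR_ge0.
by rewrite -ler_pdivrMr ?exprn_gt0 //; exact: b_le.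
Unshelve. all: by end_near. Qed.

End Existence.

End Minimizers.

(** * Primitive vectors *)

Lemma cvg0_contraction {R : realType} (e : R -> R) (q B : R) : 0 < q < 1 ->
  (\forall t \near +oo, `|e t| <= B) ->
  (forall b, 0 < b -> (\forall t \near +oo, `|e t| <= b) ->
     \forall t \near +oo, `|e t| <= q * b) ->
  e t @[t --> +oo] --> (0 : R).
Proof.
move=> /andP[q0 q1] eB contract; have B1 : 0 < `|B| + 1 by rewrite ltr_wpDl.
have iter_le i : \forall t \near +oo, `|e t| <= q ^+ i * (`|B| + 1).
  elim: i => [|i IH].
    by apply: filterS eB => t; have := ler_norm B; rewrite mul1r; lra.
  by rewrite exprS -mulrA; apply: contract => //; rewrite mulr_gt0 ?exprn_gt0.
apply/cvgrPdist_le => eps eps0; have q_lt1 : `|q| < 1 by rewrite gtr0_norm.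
have /cvgrPdist_le/(_ _ (divr_gt0 eps0 B1))[i _ /(_ i (leqnn i))] := cvg_expr q_lt1.
rewrite sub0r normrN gtr0_norm ?exprn_gt0 // ler_pdivlMr // => qi_small.
by apply: filterS (iter_le i) => t /le_trans; rewrite sub0r normrN; apply.
Qed.

Section ScaleSeries.
Context {R : realType}.
Implicit Types (c : nat -> R) (w : R -> R).

Definition scale_series c w (t : R) : R := rsum (fun j => c j * w (t / j.+1%:R)).

Section Bounded.
Variables (c : nat -> R) (w : R -> R) (M : R).
Hypotheses (c_ge0 : forall j, 0 <= c j) (c_sum : rsummable c).
Hypothesis w_bounded : forall t, 0 < t -> `|w t| <= M.

Let w_bound_ge0 : 0 <= M. Proof. exact: le_trans (w_bounded ltr01). Qed.

Lemma scale_series_summable t : 0 < t -> rsummable (fun j => c j * w (t / j.+1%:R)).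
Proof.
move=> t0; apply: le_rsummable (rsummableZ M c_sum) => j.
by rewrite normrM ger0_norm // mulrC ler_wpM2r // w_bounded // divr_gt0.
Qed.

Lemma scale_series_le_near (b del : R) : 0 <= b -> 0 < del ->
  (\forall t \near +oo, `|w t| <= b) ->
  \forall t \near +oo, `|scale_series c w t| <= b * rsum c + del.
Proof.
move=> b0 del0 [A [_ wb]]; have M1 : 0 < M + 1 by rewrite ltr_wpDl.
have [F F_large] := rsum_adherent c_ge0 c_sum (divr_gt0 del0 M1).
have [tail_sum tailE] := rsum_split F c_sum.
set tail := fun i => _ in tail_sum tailE.
pose n := (\max_(j <- F) j).+1.
near=> t; have t0 : 0 < t by near: t; exact: nbhs_pinfty_gt.
have tA : `|A| * n%:R < t by near: t; apply: nbhs_pinfty_gt; exact: num_real.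
have term_le j : `|c j * w (t / j.+1%:R)| <= b * c j + M * tail j.
  rewrite normrM ger0_norm // /tail mulrC; case: ifPn => jF.
    rewrite mulr0 addr0 ler_wpM2r //; apply: wb; rewrite ltr_pdivlMr //.
    apply: le_lt_trans tA; apply: le_trans (ler_wpM2r _ (ler_norm _)) _ => //.
    by rewrite ler_wpM2l // ler_nat ltnS (big_fsetD1 j) //= leq_maxl.
  by rewrite ler_wpDl ?mulr_ge0 // ler_wpM2r // w_bounded ?divr_gt0.
have [s1 s2] := (rsummableZ b c_sum, rsummableZ M tail_sum).
apply: le_trans (ler_norm_rsum (scale_series_summable t0)) _.
apply: (@le_trans _ _ (rsum (fun j => b * c j + M * tail j))).
  apply: le_rsum => [||j]; [exact/rsummable_norm/scale_series_summable|exact: rsummableD|].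
  exact: term_le.
rewrite rsumD // !rsumZ // lerD2l.
apply: (@le_trans _ _ (M * (del / (M + 1)))); first by rewrite ler_wpM2l //; lra.
by rewrite mulrCA ler_piMr ?(ltW del0) // ler_pdivrMr // mul1r lerDl.
Unshelve. all: by end_near. Qed.

End Bounded.

Section Limits.
Variables (c : nat -> R) (w : R -> R) (M : R).
Hypotheses (c_ge0 : forall j, 0 <= c j) (c_sum : rsummable c).
Hypothesis w_bounded : forall t, 0 < t -> `|w t| <= M.

Let sub_bounded (l : R) t : 0 < t -> `|w t - l| <= M + `|l|.
Proof. by move=> t0; apply: le_trans (ler_normB _ _) _; rewrite lerD2r w_bounded. Qed.

Let scale_series_sub (l : R) t : 0 < t ->
  scale_series c (fun s => w s - l) t = scale_series c w t - l * rsum c.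
Proof.
have w_sum := scale_series_summable c_ge0 c_sum w_bounded.
move=> t0; rewrite -rsumZ // -rsumB; [|exact: w_sum|exact: rsummableZ].
by apply: eq_rsum => j; ring.
Qed.

Lemma scale_series_cvg (l : R) : w t @[t --> +oo] --> l ->
  scale_series c w t @[t --> +oo] --> l * rsum c.
Proof.
move=> /cvgrPdist_le w_cvg; apply/cvgrPdist_le => eps eps0.
have S1 : 0 < rsum c + 1 by rewrite ltr_wpDl // rsum_ge0.
have e2 : 0 < eps / 2 by rewrite divr_gt0.
pose b := eps / 2 / (rsum c + 1); have b0 : 0 < b by exact: divr_gt0.
have bS : b * rsum c <= eps / 2.
  by rewrite /b mulrAC ler_pdivrMr // ler_pM2l ?divr_gt0 // lerDl.
have near_b : \forall t \near +oo, `|w t - l| <= b.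
  by apply: filterS (w_cvg _ b0) => t; rewrite distrC.
have := scale_series_le_near c_ge0 c_sum (@sub_bounded l) (ltW b0) e2 near_b.
apply: filterS2 (nbhs_pinfty_gt (num_real 0)) => t t0.
by rewrite scale_series_sub // distrC; lra.
Qed.

(* Since [c 0 = 1] outweighs the remaining coefficients, the relation
   [scale_series c w -> tau] can be inverted by a contraction argument. *)
Lemma scale_series_inv (tau : R) : c 0 = 1 -> rsum c <= 7 / 4 ->
  scale_series c w t @[t --> +oo] --> tau -> w t @[t --> +oo] --> tau / rsum c.
Proof.
move=> c01 c74 /cvgrPdist_le series_cvg.
have S1 : 1 <= rsum c by rewrite -c01; exact: ler_term_rsum.
have S0 : 0 < rsum c by rewrite (lt_le_trans ltr01).
have [c'_sum splitE] := rsum_split [fset 0%N]%fset c_sum.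
set c' := fun i => _ in c'_sum splitE; rewrite big_seq_fset1 c01 in splitE.
have c'_ge0 j : 0 <= c' j by rewrite /c'; case: ifP.
pose e t := w t - tau / rsum c.
have e_bounded t : 0 < t -> `|e t| <= M + `|tau / rsum c| by exact: sub_bounded.
have eE t : 0 < t -> e t = (scale_series c w t - tau) - scale_series c' e t.
  move=> t0; have := scale_series_sub (tau / rsum c) t0; rewrite divfK ?gt_eqF // => <-.
  have [_] := rsum_split [fset 0%N]%fset (scale_series_summable c_ge0 c_sum e_bounded t0).
  rewrite -/(scale_series c e t) => ->; rewrite big_seq_fset1 c01 mul1r divr1 -addrA.
  rewrite (_ : rsum _ = scale_series c' e t) ?subrr ?addr0 //.
  by apply: eq_rsum => j; rewrite /c'; case: ifP => _; rewrite ?mul0r.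
suff /cvgrPdist_le e_cvg0 : e t @[t --> +oo] --> (0 : R).
  apply/cvgrPdist_le => eps eps0; apply: filterS (e_cvg0 _ eps0) => t.
  by rewrite sub0r normrN distrC.
apply: (@cvg0_contraction _ _ (7 / 8) (M + `|tau / rsum c|)); first by apply/andP; split; lra.
  by apply: filterS (nbhs_pinfty_gt (num_real 0)) => t; exact: e_bounded.
move=> b b0 eb; have b16 : 0 < b / 16 by rewrite divr_gt0.
have tail_le := scale_series_le_near c'_ge0 c'_sum e_bounded (ltW b0) b16 eb.
near=> t; have t0 : 0 < t by near: t; exact: nbhs_pinfty_gt.
have tau_le : `|tau - scale_series c w t| <= b / 16 by near: t; exact: series_cvg.
have tail_small : `|scale_series c' e t| <= b * rsum c' + b / 16 by near: t; exact: tail_le.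
rewrite eE //; apply: le_trans (ler_normB _ _) _; rewrite [X in X + _]distrC.
by have : b * rsum c' <= b * (3 / 4) by [rewrite ler_pM2l //; lra]; lra.
Unshelve. all: by end_near. Qed.

End Limits.

End ScaleSeries.

Section PrimitiveRows.
Context {d : nat}.
Implicit Types (v p : 'rV[int]_d).

Definition gcd_row v : nat := \big[gcdn/0%N]_(j < d) `|v 0%R j|%N.

Definition primitive v : bool := gcd_row v == 1%N.

Definition primitive_part v : 'rV[int]_d := \row_j (v 0%R j %/ gcd_row v)%Z.

Lemma gcd_rowMn v n : gcd_row (v *+ n) = (gcd_row v * n)%N.
Proof.
rewrite /gcd_row; elim/big_rec2: _ => [|j x y _ ->]; first by rewrite mul0n.
by rewrite mulmxnE -mulr_natr abszM natz absz_nat muln_gcdl.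
Qed.

Lemma gcd_row_dvd v j : (gcd_row v %| `|v 0%R j|)%N.
Proof. by rewrite /gcd_row (bigD1 j) //= dvdn_gcdl. Qed.

Lemma gcd_row0 : gcd_row 0 = 0%N.
Proof. by rewrite -(mulr0n 0) gcd_rowMn muln0. Qed.

Lemma gcd_row_gt0 v : v != 0 -> (0 < gcd_row v)%N.
Proof.
rewrite lt0n; apply: contra => /eqP v0; apply/eqP/rowP => j; rewrite mxE.
by have := gcd_row_dvd v j; rewrite v0 dvd0n absz_eq0 => /eqP.
Qed.

Lemma primitive_partK v : primitive_part v *+ gcd_row v = v.
Proof.
apply/rowP => j; rewrite mulmxnE mxE -mulr_natr natz.
by rewrite divzK // dvdzE /= gcd_row_dvd.
Qed.

Lemma primitive_part_primitive v : v != 0 -> primitive (primitive_part v).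
Proof.
move=> /gcd_row_gt0 g0; have := congr1 gcd_row (primitive_partK v); rewrite gcd_rowMn.
by move=> /eqP; rewrite -{2}[gcd_row v]mul1n eqn_pmul2r.
Qed.

Lemma primitive_neq0 p : primitive p -> p != 0.
Proof. by apply: contraL => /eqP ->; rewrite /primitive gcd_row0. Qed.

Lemma primitive_mul_inj p p' n n' : primitive p -> primitive p' ->
  p *+ n.+1 = p' *+ n'.+1 -> n = n' /\ p = p'.
Proof.
move=> /eqP pp /eqP pp' E; have := congr1 gcd_row E.
rewrite !gcd_rowMn pp pp' !mul1n => -[nn]; split => //.
apply/rowP => j; move/rowP: E => /(_ j); rewrite !mulmxnE nn -[LHS]mulr_natr -[RHS]mulr_natr.
by apply: mulIf; rewrite natz.
Qed.

Lemma primitive_partMn p n : primitive p ->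
  primitive_part (p *+ n.+1) = p /\ gcd_row (p *+ n.+1) = n.+1.
Proof.
move=> pp; have gE : gcd_row (p *+ n.+1) = n.+1 by rewrite gcd_rowMn (eqP pp) mul1n.
split => //; have pn0 : p *+ n.+1 != 0.
  by apply/eqP => pn0; move: gE; rewrite pn0 gcd_row0.
have := primitive_partK (p *+ n.+1); rewrite gE => E.
by have [_ ->] := primitive_mul_inj (primitive_part_primitive pn0) pp E.
Qed.

End PrimitiveRows.

Lemma rsum_reindex_support {R : realType} (T U : choiceType) (f : T -> R) (g : U -> R)
    (h : U -> T) (h' : T -> U) : (forall i, 0 <= f i) -> (forall j, 0 <= g j) ->
  (forall j, g j != 0 -> f (h j) = g j /\ h' (h j) = j) ->
  (forall i, f i != 0 -> g (h' i) = f i /\ h (h' i) = i) ->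
  rsummable f -> rsummable g /\ rsum g = rsum f.
Proof.
have bound (T' U' : choiceType) (f' : T' -> R) (g' : U' -> R) (s : U' -> T') (s' : T' -> U') :
    (forall i, 0 <= f' i) ->
    (forall j, g' j != 0 -> f' (s j) = g' j /\ s' (s j) = j) -> rsummable f' ->
    forall F : {fset U'}, \sum_(j <- F) g' j <= rsum f'.
  move=> f'0 g's sf' F; rewrite (bigID (fun j => g' j != 0)) /= [X in _ + X]big1 => [|j].
    rewrite addr0 (eq_bigr (fun j => f' (s j))) => [|j /g's[-> //]].
    rewrite -big_filter; apply: sum_inj_le_rsum => //; first exact: filter_uniq (fset_uniq _).
    move=> j k; rewrite !mem_filter => /andP[/g's[_ sj] _] /andP[/g's[_ sk] _] jk.
    by rewrite -sj jk sk.
  by move=> /negPn/eqP.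
move=> f0 g0 gh fh sf; have g_le := bound _ _ _ _ _ _ f0 gh sf.
have sg := ge0_rsummable g0 g_le; split => //.
apply/eqP; rewrite eq_le rsum_le_bound //=.
by apply: rsum_le_bound => //; exact: bound g0 fh sg.
Qed.

Section PrimitiveSums.
Context {R : realType} {d : nat} (C : set 'rV[R]_d).
Hypothesis C_cone : convex_cone C.
Implicit Types (f : 'rV[R]_d -> R) (p : 'rV[int]_d) (t : R).

Definition primitive_term f t p : R := if primitive p then lattice_term C f t p else 0.

Definition primitive_density f t : R := rsum (primitive_term f t) / t ^+ d.

Lemma primitive_term_ge0 f t p : (forall x, C x -> 0 <= f x) -> 0 < t ->
  0 <= primitive_term f t p.
Proof.
by move=> f0 t0; rewrite /primitive_term; case: ifP => // _; exact: lattice_term_ge0.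
Qed.

Lemma primitive_term_le f t p : (forall x, C x -> 0 <= f x) -> 0 < t ->
  primitive_term f t p <= lattice_term C f t p.
Proof.
by move=> f0 t0; rewrite /primitive_term; case: ifP => // _; exact: lattice_term_ge0.
Qed.

Lemma lattice_termMn f t p n : lattice_term C f t (p *+ n.+1) = lattice_term C f (t / n.+1%:R) p.
Proof.
have n0 : 0 < n.+1%:R :> R by rewrite ltr0n.
rewrite /lattice_term intr_rowMn.
have -> : `[< C (n.+1%:R *: intr_row p) >] = `[< C (intr_row p) >].
  by apply/asboolP/asboolP => [/(coneV C_cone n0)//|]; exact: (coneZ C_cone).
by case: asboolP => // _; rewrite scalerA invfM invrK.
Qed.

Section OneFunction.
Variables (f : 'rV[R]_d -> R) (t : R).
Hypotheses (f_ge0 : forall x, C x -> 0 <= f x) (f0 : f 0 = 0) (t0 : 0 < t).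
Hypothesis f_sum : rsummable (lattice_term C f t).

Let t_div_gt0 j : 0 < t / j.+1%:R.
Proof. by rewrite divr_gt0. Qed.

(* Each nonzero lattice point is a unique positive multiple of a primitive one. *)
Lemma primitive_pairs : rsummable (fun q => primitive_term f (t / q.1.+1%:R) q.2) /\
  rsum (fun q => primitive_term f (t / q.1.+1%:R) q.2) = rsum (lattice_term C f t).
Proof.
apply: (rsum_reindex_support (h := fun q : nat * 'rV[int]_d => q.2 *+ q.1.+1)
    (h' := fun v => ((gcd_row v).-1, primitive_part v))) => //.
- by move=> v; exact: lattice_term_ge0.
- by move=> q; exact: primitive_term_ge0.
- move=> [j p] /=; rewrite /primitive_term; case: ifP => [pp _|]; last by rewrite eqxx.
  by rewrite lattice_termMn; have [-> ->] := primitive_partMn j pp.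
move=> v; have [->|v0] := eqVneq v 0.
  by rewrite /lattice_term intr_row0 scaler0 f0 if_same eqxx.
rewrite /primitive_term /= primitive_part_primitive // -lattice_termMn prednK ?gcd_row_gt0 //.
by rewrite primitive_partK.
Qed.

Lemma lattice_density_primitive :
  lattice_density C f t = scale_series (zeta_coef d) (primitive_density f) t.
Proof.
have [pair_sum pairE] := primitive_pairs.
have [|sj s E] := @ge0_rsum_pair _ _ _ (fun j p => primitive_term f (t / j.+1%:R) p) _ pair_sum.
  by move=> j p; exact: primitive_term_ge0.
rewrite /lattice_density -pairE E mulrC -rsumZ //; apply: eq_rsum => j.
rewrite /primitive_density /zeta_coef expr_div_n; field.
by rewrite !expf_neq0 ?gt_eqF.
Qed.

End OneFunction.

End PrimitiveSums.

Lemma expRN_le_pow {R : realType} n (x : R) : 0 < x -> expR (- x) <= (n%:R / x) ^+ n.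
Proof.
move=> x0; case: n => [|n]; first by rewrite expr0 -expR0 ler_expR oppr_le0 ltW.
have n0 : 0 < n.+1%:R :> R by rewrite ltr0n.
have xn0 : 0 < x / n.+1%:R by rewrite divr_gt0.
rewrite -[n.+1%:R / x]invf_div exprVn expRN lef_pV2 ?posrE ?exprn_gt0 ?expR_gt0 //.
have -> : expR x = expR (x / n.+1%:R) ^+ n.+1 by rewrite -expRM_natl mulrC divfK // gt_eqF.
apply: lerXn2r; rewrite ?nnegrE ?expR_ge0 ?(ltW xn0) //.
by apply: le_trans (expR_ge1Dx _); rewrite lerDr.
Qed.

Section Means.
Context {R : realType} {d : nat} (C : set 'rV[R]_d) (a : 'rV[R]_d).
Hypotheses (d_ge2 : (2 <= d)%N) (C_cone : convex_cone C) (C_int : C° !=set0).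
Hypothesis a_coercive : coercive C a.
Implicit Types (g : 'rV[R]_d -> R) (p : 'rV[int]_d) (t : R).

Definition kappa : R := rsum (@zeta_coef R d.+1) / rsum (@zeta_coef R d).

Let zeta_sum : rsummable (@zeta_coef R d). Proof. exact: (zeta_series d_ge2).1. Qed.

Let zetaS_sum : rsummable (@zeta_coef R d.+1). Proof. exact: (zeta_series (leqW d_ge2)).1. Qed.

Lemma kappa_gt0 : 0 < kappa.
Proof.
have zeta_gt0 m : rsummable (@zeta_coef R m) -> 0 < rsum (@zeta_coef R m).
  by move=> /(ler_term_rsum 0 (zeta_coef_ge0 m)); rewrite zeta_coef0; exact: lt_le_trans.
by rewrite divr_gt0 // zeta_gt0.
Qed.

(* The expectation of [g / t] for the geometric law of parameter [expR (- dot a p / t)]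
   at each primitive [p] of the cone. *)
Definition mean_term g t p : R :=
  if primitive p && `[< C (intr_row p) >]
  then g (intr_row p) / t / (expR (dot a (intr_row p) / t) - 1) else 0.

Lemma mean_term_ge0 g t p : (forall x, C x -> 0 <= g x) -> 0 < t -> 0 <= mean_term g t p.
Proof.
move=> g0 t0; rewrite /mean_term; case: ifP => // /andP[_ /asboolP Cp].
rewrite !divr_ge0 ?g0 ?(ltW t0) // subr_ge0 -expR0 ler_expR divr_ge0 ?(ltW t0) //.
exact: (coercive_ge0 a_coercive).
Qed.

Section OneFunction.
Variable g : 'rV[R]_d -> R.
Hypotheses (hg : homlip C g) (g_ge0 : forall x, C x -> 0 <= g x).

Local Notation f := (laplace a g).

Let f_ge0 x : C x -> 0 <= f x.
Proof. by move=> Cx; rewrite /laplace mulr_ge0 ?expR_ge0 // g_ge0. Qed.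

Let f_at0 : f 0 = 0.
Proof.
have [x /interior_subset Cx] := C_int.
by rewrite /laplace (homlip_eq0 hg) ?mul0r //; exists x.
Qed.

Let f_sum t : 0 < t -> rsummable (lattice_term C f t).
Proof. by move=> t0; apply: exp_decay_summable => //; exact: laplace_decay. Qed.

Let primitive_sum t : 0 < t -> rsummable (primitive_term C f t).
Proof.
move=> t0; apply: le_rsummable (f_sum t0) => p.
by rewrite ger0_norm ?primitive_term_ge0 // primitive_term_le.
Qed.

Let primitive_density_ge0 t : 0 < t -> 0 <= primitive_density C f t.
Proof.
move=> t0; apply: divr_ge0; last by apply/exprn_ge0/ltW.
by apply: rsum_ge0 => p; exact: primitive_term_ge0.
Qed.

Let bounded_large_scale : exists B : R, forall t, 1 <= t -> primitive_density C f t <= B.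
Proof.
have [G G0 gG] := laplace_bound C_cone a_coercive hg.
have half : 0 < (2^-1 : R) by rewrite invr_gt0.
have [B B0 BP] := exp_density_bounded C_cone C_int a_coercive half.
exists (G * B) => t t1; have t0 := lt_le_trans ltr01 t1.
have half_decay := exp_dot_decay a_coercive half.
apply: (@le_trans _ _ (lattice_density C f t)).
  rewrite ler_pM2r ?invr_gt0 ?exprn_gt0 //.
  apply: le_rsum => [||p]; [exact: primitive_sum|exact: f_sum|].
  exact: primitive_term_le.
apply: (@le_trans _ _ (lattice_density C (fun x => G * expR (- (2^-1 * dot a x))) t)).
  apply: le_lattice_density => //; [exact: laplace_decay|exact: exp_decayZ|].
  by move=> x Cx; apply: le_trans (ler_norm _) (gG x Cx).
by rewrite lattice_densityZ // ler_wpM2l // BP.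
Qed.

(* Primitive vectors have norm at least 1, so at small scales the sum is exponentially small. *)
Let bounded_small_scale : exists B : R, forall t, 0 < t -> t <= 1 -> primitive_density C f t <= B.
Proof.
have [G G0 gG] := laplace_bound C_cone a_coercive hg; have [c c0 ac] := a_coercive.
have quarter : 0 < (4^-1 : R) by rewrite invr_gt0.
pose h x := expR (- (4^-1 * dot a x)); pose Q := rsum (lattice_term C h 1).
have h_sum : rsummable (lattice_term C h 1).
  by apply: exp_decay_summable => //; exact: exp_dot_decay.
have h0 v : 0 <= lattice_term C h 1 v.
  by apply: lattice_term_ge0 => // x _; exact: expR_ge0.
exists (G * (4 * d%:R / c) ^+ d * Q) => t t0 t1; rewrite ler_pdivrMr ?exprn_gt0 //.
apply: (@le_trans _ _ (G * expR (- (c / (4 * t))) * Q)); last first.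
  rewrite [leRHS]mulrAC; apply: ler_wpM2r; first exact: rsum_ge0.
  rewrite -[leRHS]mulrA ler_wpM2l //.
  apply: le_trans (expRN_le_pow d _) _; first by rewrite divr_gt0 // mulr_gt0.
  by rewrite -exprMn; apply: eq_ler; congr (_ ^+ _); field; rewrite !gt_eqF.
have coef_ge0 : 0 <= G * expR (- (c / (4 * t))) by rewrite mulr_ge0 ?expR_ge0.
rewrite -rsumZ //; apply: le_rsum => [||p]; [exact: primitive_sum|exact: rsummableZ|].
rewrite /primitive_term; case: ifPn => [pp|_]; last exact: mulr_ge0.
rewrite /lattice_term; case: asboolP => [Cp|_]; last by rewrite mulr0.
have ti : 0 < t^-1 by rewrite invr_gt0.
have Ctp := coneZ C_cone (ltW ti) Cp.
apply: le_trans (ler_norm _) _; apply: le_trans (gG _ Ctp) _.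
rewrite -mulrA ler_wpM2l // invr1 scale1r /h -expRD ler_expR dotZr.
have cp : c <= dot a (intr_row p).
  by apply: le_trans (ac _ Cp); rewrite ler_peMr ?(ltW c0) ?norm_intr_row_ge1 ?primitive_neq0.
have ti1 : 1 <= t^-1 by rewrite invf_ge1.
rewrite (_ : c / (4 * t) = 4^-1 * (c * t^-1)); last by field; rewrite gt_eqF.
move: (dot a (intr_row p)) (t^-1) cp ti1 ti => l u cl u1 u0; nra.
Qed.

Lemma primitive_density_bounded : exists M : R, forall t, 0 < t -> `|primitive_density C f t| <= M.
Proof.
have [[B BP] [B' B'P]] := (bounded_large_scale, bounded_small_scale).
exists (Num.max B B') => t t0; rewrite ger0_norm ?primitive_density_ge0 // le_max.
by have [t1|/ltW t1] := leP 1 t; apply/orP; [left; exact: BP|right; exact: B'P].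
Qed.

Lemma primitive_density_cvg :
  primitive_density C f t @[t --> +oo] --> moment C a g / rsum (@zeta_coef R d).
Proof.
have [M MP] := primitive_density_bounded.
apply: (scale_series_inv (zeta_coef_ge0 d) zeta_sum MP (zeta_coef0 d) (zeta_series d_ge2).2).
apply: cvg_trans (moment_cvg C_cone C_int a_coercive hg); apply: near_eq_cvg; near=> t.
rewrite lattice_density_primitive //; try exact: f_sum; near: t; exact: nbhs_pinfty_gt.
Unshelve. all: by end_near. Qed.

Let mean_termE t p : 0 < t ->
  mean_term g t p = rsum (fun j => j.+1%:R^-1 * primitive_term C f (t / j.+1%:R) p).
Proof.
move=> t0; have zeroE : rsum (fun j : nat => j.+1%:R^-1 * 0 : R) = 0.
  by rewrite -[RHS](@rsum0 R nat); apply: eq_rsum => j; rewrite mulr0.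
rewrite /mean_term /primitive_term; case: (boolP (primitive p)) => [pp|_] /=; last by rewrite zeroE.
rewrite /lattice_term; case: asboolP => [Cp|_]; last by rewrite zeroE.
have x0 : 0 < dot a (intr_row p) / t.
  by rewrite divr_gt0 // (coercive_gt0 a_coercive) // intr_row_eq0 primitive_neq0.
set x := _ / t in x0 *; have q01 : 0 <= expR (- x) < 1 by rewrite expR_ge0 expR_lt1 oppr_lt0.
have [sq Eq] := rsum_geometric q01.
have -> : (expR x - 1)^-1 = expR (- x) * rsum (fun j : nat => expR (- x) ^+ j).
  rewrite Eq expRN; have x1 : 1 < expR x by rewrite expR_gt1.
  by field; rewrite subr_eq0 !gt_eqF ?expR_gt0.
rewrite mulrA -rsumZ //; apply: eq_rsum => j.
have ji : 0 <= (t / j.+1%:R)^-1 by rewrite invr_ge0 divr_ge0 // ltW.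
rewrite /laplace hg.1 // dotZr -expRM_natl invf_div.
rewrite (_ : - (j.+1%:R / t * _) = - x + j%:R * - x); last by rewrite /x -natr1; ring.
rewrite expRD; have j0 : j.+1%:R != 0 :> R by rewrite pnatr_eq0.
by move: (j.+1%:R : R) j0 => z z0; field; rewrite z0 gt_eqF.
Qed.

Lemma mean_series t : 0 < t -> rsummable (mean_term g t) /\
  rsum (mean_term g t) / t ^+ d = scale_series (zeta_coef d.+1) (primitive_density C f) t.
Proof.
move=> t0; have tj j : 0 < t / j.+1%:R by rewrite divr_gt0.
pose H j p := j.+1%:R^-1 * primitive_term C f (t / j.+1%:R) p.
have H_ge0 j p : 0 <= H j p by rewrite mulr_ge0 ?invr_ge0 ?primitive_term_ge0.
have [pair_sum _] := primitive_pairs C_cone f_ge0 f_at0 t0 (f_sum t0).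
have H_sum : rsummable (fun q => H q.1 q.2).
  apply: le_rsummable pair_sum => q; rewrite ger0_norm // /H ler_piMl ?primitive_term_ge0 //.
  by rewrite invf_le1 // ler1n.
have -> : mean_term g t = fun p => rsum (H^~ p) by apply/funext => p; exact: mean_termE.
have [s ->] := ge0_rsum_exchange H_ge0 H_sum; split => //.
rewrite mulrC -rsumZ; last by have [] := ge0_rsum_pair H_ge0 H_sum.
apply: eq_rsum => j; rewrite /H rsumZ; last exact: primitive_sum.
rewrite /zeta_coef /primitive_density expr_div_n [_ ^+ d.+1]exprS.
by field; rewrite !expf_neq0 ?gt_eqF.
Qed.

Lemma mean_cvg : rsum (mean_term g t) / t ^+ d @[t --> +oo] --> kappa * moment C a g.
Proof.
have [M MP] := primitive_density_bounded.
have := scale_series_cvg (zeta_coef_ge0 d.+1) zetaS_sum MP primitive_density_cvg.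
rewrite (_ : _ * rsum (zeta_coef d.+1) = kappa * moment C a g); last by rewrite /kappa; ring.
apply: cvg_trans; apply: near_eq_cvg; near=> t.
by rewrite (mean_series _).2 //; near: t; exact: nbhs_pinfty_gt.
Unshelve. all: by end_near. Qed.

End OneFunction.

End Means.

(** * Independent geometric laws *)

Section TiltedGeometricLaw.
Context {R : realType}.
Implicit Types (w x z : R).

Lemma sum_geometricE (q : R) n : q != 1 -> \sum_(j < n) q ^+ j = (1 - q ^+ n) / (1 - q).
Proof.
move=> q1; have q1' : 1 - q != 0 by rewrite subr_eq0 eq_sym.
by apply: (mulIf q1'); rewrite divfK // mulrC; have := subrX1 q n; lra.
Qed.

Lemma sum_geometric_le (q : R) n : 0 <= q < 1 -> \sum_(j < n) q ^+ j <= (1 - q)^-1.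
Proof.
move=> /andP[q0 q1]; rewrite sum_geometricE ?lt_eqF //; apply: ler_piMl.
  by rewrite invr_ge0 subr_ge0 ltW.
by rewrite gerBl exprn_ge0.
Qed.

Lemma inv1B_le_expR w : `|w| <= 1 / 4 -> (1 - w)^-1 <= expR (w + w ^+ 2).
Proof.
rewrite ler_norml => /andP[w1 w2]; have w0 : 0 < 1 - w by lra.
rewrite -[leLHS]mul1r ler_pdivrMr //.
have [wn|wp] := leP w 0.
  apply: le_trans (ler_wpM2r (ltW w0) (expR_ge1Dx _)); rewrite expr2; nra.
set u := w + w ^+ 2; have u0 : 0 <= u by rewrite /u expr2; nra.
have half_le := expR_ge1Dx (u / 2).
have -> : expR u = expR (u / 2) * expR (u / 2) by rewrite -expRD; congr expR; field.
apply: (@le_trans _ _ ((1 + u / 2) * (1 + u / 2) * (1 - w))); last first.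
  by rewrite ler_wpM2r ?(ltW w0) //; apply: ler_pM => //; lra.
have -> : (1 + u / 2) * (1 + u / 2) * (1 - w)
   = 1 + w ^+ 2 * ((1 - w) * (1 + w) ^+ 2 / 4 - w) by rewrite /u; field.
by rewrite lerDl mulr_ge0 ?sqr_ge0 // expr2; nra.
Qed.

Lemma norm_expR_sub1_le z : `|expR z - 1| <= `|z| * expR `|z|.
Proof.
have ge1 := expR_ge1Dx z; have geN := expR_ge1Dx (- z).
have expRNK : expR z * expR (- z) = 1 by rewrite -expRD subrr expR0.
have e0 := expR_gt0 z; have [z0|z0] := leP 0 z.
  have e1 : 1 <= expR z by lra.
  rewrite !ger0_norm ?subr_ge0 //.
  by have := ler_wpM2l (ltW e0) geN; rewrite expRNK; nra.
have e1 : expR z <= 1 by rewrite -expR0 ler_expR ltW.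
rewrite ler0_norm ?subr_le0 // ltr0_norm //.
have : - z * 1 <= - z * expR (- z) by rewrite ler_pM2l //; lra.
lra.
Qed.

Lemma expR_sub1_ge x : 0 <= x -> x / 2 * expR (x / 2) <= expR x - 1.
Proof.
move=> x0; have half_le := expR_ge1Dx (x / 2).
have -> : expR x = expR (x / 2) * expR (x / 2) by rewrite -expRD; congr expR; field.
nra.
Qed.

Section TiltedRatio.
Variables (x z th : R).
Hypotheses (x_gt0 : 0 < x) (th_ge0 : 0 <= th) (th_le : th <= 1 / 8) (z_le : `|z| <= th * x).

Let e := expR (x / 8).
Let w := (expR z - 1) / (expR x - 1).

Let e_ge1 : 1 <= e. Proof. by rewrite -expR0 ler_expR divr_ge0 // ltW. Qed.
Let e_gt0 : 0 < e. Proof. exact: expR_gt0. Qed.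

Let e_exp n : expR (n%:R * (x / 8)) = e ^+ n. Proof. by rewrite /e expRM_natl. Qed.

Let denominator_gt0 : 0 < expR x - 1. Proof. by rewrite subr_gt0 expR_gt1. Qed.

Let denominator_ge : x / 2 * e ^+ 4 <= expR x - 1.
Proof.
by rewrite -e_exp (_ : 4 * (x / 8) = x / 2); [apply/expR_sub1_ge/ltW|field].
Qed.

Let expR_norm_z_le : expR `|z| <= e.
Proof.
rewrite ler_expR; apply: le_trans z_le _.
by rewrite mulrC ler_pM2l //; move: th_le; lra.
Qed.

Let w_norm_le : `|w| <= 2 * th * e^-1.
Proof.
rewrite normrM normfV (gtr0_norm denominator_gt0) ler_pdivrMr //.
apply: le_trans (norm_expR_sub1_le _) _.
apply: (@le_trans _ _ (th * x * e)); first by apply: ler_pM => //; exact: expR_ge0.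
have coef_ge0 : 0 <= 2 * th * e^-1 by rewrite !mulr_ge0 // invr_ge0 ltW.
apply: le_trans (ler_wpM2l coef_ge0 denominator_ge).
have -> : 2 * th * e^-1 * (x / 2 * e ^+ 4) = th * x * e ^+ 3 by field; rewrite gt_eqF.
rewrite ler_wpM2l //; first by rewrite mulr_ge0 // ltW.
by rewrite -[leLHS]expr1 ler_weXn2l.
Qed.

Let w_sqr_le : w ^+ 2 <= 4 * th ^+ 2 * e^-1.
Proof.
rewrite -[w ^+ 2]real_normK ?num_real //; apply: (@le_trans _ _ ((2 * th * e^-1) ^+ 2)).
  by rewrite lerXn2r ?nnegrE // !mulr_ge0 // invr_ge0 ltW.
rewrite exprMn (_ : (2 * th) ^+ 2 = 4 * th ^+ 2); last by ring.
rewrite ler_wpM2l ?mulr_ge0 ?sqr_ge0 // expr2 ler_piMl ?invr_ge0 ?(ltW e_gt0) //.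
by rewrite invf_le1.
Qed.

Let w_le : w <= z / (expR x - 1) + 8 * th ^+ 2 * e^-1.
Proof.
rewrite -lerBlDl -mulrBl ler_pdivrMr //.
have zx2 : z ^+ 2 <= (th * x) ^+ 2.
  by rewrite -[z ^+ 2]real_normK ?num_real // lerXn2r ?nnegrE // mulr_ge0 // ltW.
apply: le_trans (ler_norm _) _; apply: le_trans (norm_expR_sub1Dx_le z) _.
apply: (@le_trans _ _ ((th * x) ^+ 2 * e)).
  by apply: ler_pM; rewrite ?sqr_ge0 ?expR_ge0.
have coef_ge0 : 0 <= 8 * th ^+ 2 * e^-1.
  by rewrite mulr_ge0 ?invr_ge0 ?(ltW e_gt0) // mulr_ge0 ?sqr_ge0.
apply: le_trans (ler_wpM2l coef_ge0 denominator_ge).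
have -> : 8 * th ^+ 2 * e^-1 * (x / 2 * e ^+ 4) = th ^+ 2 * x * e * (4 * e ^+ 2).
  by field; rewrite gt_eqF.
have -> : (th * x) ^+ 2 * e = th ^+ 2 * x * e * x by ring.
rewrite ler_wpM2l; first by [].
  by rewrite !mulr_ge0 ?sqr_ge0 ?(ltW x_gt0) ?(ltW e_gt0).
by rewrite -e_exp; have := expR_ge1Dx (2 * (x / 8)); lra.
Qed.

Let ratioE : (1 - expR (- x)) / (1 - expR (- (x - z))) = (1 - w)^-1.
Proof.
have [ex0 ex1] := (expR_gt0 x, denominator_gt0).
have -> : 1 - w = (1 - expR (- (x - z))) / (1 - expR (- x)).
  rewrite /w opprB expRD !expRN; field.
  by rewrite !gt_eqF.
by rewrite invf_div.
Qed.

Lemma tilted_ratio_le : (1 - expR (- x)) / (1 - expR (- (x - z)))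
    <= expR (z / (expR x - 1) + 12 * th ^+ 2 * expR (- (x / 8))).
Proof.
rewrite ratioE; apply: le_trans (inv1B_le_expR _) _.
  apply: le_trans w_norm_le _; apply: (@le_trans _ _ (2 * th * 1)); last by move: th_le; lra.
  by rewrite ler_wpM2l ?mulr_ge0 // invf_le1.
by rewrite ler_expR [X in _ <= _ + _ * X]expRN -/e; move: w_sqr_le w_le; lra.
Qed.

End TiltedRatio.

End TiltedGeometricLaw.

Section IndependentGeometricLaws.
Context {R : realType} {I : finType}.
Implicit Types (x z : I -> R) (B : nat).

Lemma prod1B_ge (u : I -> R) : (forall i, 0 <= u i <= 1) ->
  1 - \sum_i u i <= \prod_i (1 - u i).
Proof.
move=> u01; suff : 1 - \sum_i u i <= \prod_i (1 - u i) /\ 0 <= \prod_i (1 - u i) <= 1 by case.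
elim/big_ind2: _ => [|s p s' p' [sp /andP[p0 p1]] [sp' /andP[p'0 p'1]]|i _].
- by rewrite subr0 lexx ler01.
- by split; [nra|apply/andP; split; nra].
- by have /andP[? ?] := u01 i; split; [|apply/andP; split]; lra.
Qed.

Lemma sum_ffun_expR B x :
  \sum_(om : {ffun I -> 'I_B.+1}) expR (- \sum_i (om i)%:R * x i)
    = \prod_i \sum_(j < B.+1) expR (- x i) ^+ j.
Proof.
rewrite bigA_distr_bigA; apply: eq_bigr => om _.
rewrite -sumrN expR_sum; apply: eq_bigr => i _.
by rewrite -expRM_natl mulrN.
Qed.

Let expRN_lt1 (y : R) : 0 < y -> expR (- y) < 1.
Proof. by move=> y0; rewrite expR_lt1 oppr_lt0. Qed.

(* Up to the truncation, the ratio of the two sums is the Laplace transform of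
   [\sum_i om i * z i] under independent geometric laws of parameters [expR (- x i)]. *)
Lemma tilted_sum_le B x z (th : R) :
  0 <= th -> th <= 1 / 8 -> (forall i, 0 < x i) -> (forall i, `|z i| <= th * x i) ->
  1 / 2 <= \prod_i (1 - expR (- x i) ^+ B.+1) ->
  \sum_(om : {ffun I -> 'I_B.+1}) expR (- \sum_i (om i)%:R * (x i - z i))
  <= 2 * expR (\sum_i z i / (expR (x i) - 1) + 12 * th ^+ 2 * \sum_i expR (- (x i / 8)))
     * \sum_(om : {ffun I -> 'I_B.+1}) expR (- \sum_i (om i)%:R * x i).
Proof.
move=> th0 th8 x0 zx trunc; rewrite !sum_ffun_expR.
have xz0 i : 0 < x i - z i.
  by have := ler_norm (z i); have := zx i; have := x0 i; nra.
set T := \prod_i (1 - expR (- x i) ^+ B.+1) in trunc.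
set S := (X in _ <= _ * expR X * _).
have -> : expR S = \prod_i expR (z i / (expR (x i) - 1) + 12 * th ^+ 2 * expR (- (x i / 8))).
  by rewrite -expR_sum big_split /= -mulr_sumr.
set L := \prod_i expR _; pose D := \prod_i (1 - expR (- x i))^-1.
have -> : \prod_i \sum_(j < B.+1) expR (- x i) ^+ j = T * D.
  by rewrite -big_split; apply: eq_bigr => i _; rewrite sum_geometricE ?lt_eqF ?expRN_lt1.
have D0 : 0 <= D by apply: prodr_ge0 => i _; rewrite invr_ge0 subr_ge0 ltW ?expRN_lt1.
have L0 : 0 <= L by apply: prodr_ge0 => i _; exact: expR_ge0.
apply: (@le_trans _ _ (L * D)).
  rewrite -big_split /=; apply: ler_prod => i _; apply/andP; split.
    by apply: sumr_ge0 => j _; rewrite exprn_ge0 ?expR_ge0.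
  apply: (@le_trans _ _ (1 - expR (- (x i - z i)))^-1).
    by apply: sum_geometric_le; rewrite expR_ge0 expRN_lt1.
  rewrite ler_pdivlMr ?subr_gt0 ?expRN_lt1 // mulrC.
  exact: tilted_ratio_le.
rewrite [2 * L]mulrC -mulrA ler_wpM2l // mulrA ler_peMl //; lra.
Qed.

Lemma truncation_exists x : (forall i, 0 < x i) ->
  exists B0, forall B, (B0 <= B)%N -> 1 / 2 <= \prod_i (1 - expR (- x i) ^+ B.+1).
Proof.
move=> x0; pose e : R := (2 * #|I|.+1%:R)^-1.
have e0 : 0 < e by rewrite invr_gt0 mulr_gt0.
have /choice[N NP] : forall i, exists N, forall n, (N <= n)%N -> expR (- x i) ^+ n <= e.
  move=> i; have qn : `|expR (- x i)| < 1 by rewrite ger0_norm ?expR_ge0 ?expRN_lt1.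
  have /cvgrPdist_le/(_ _ e0)[N _ NP] := cvg_expr qn; exists N => n Nn.
  by have := NP n Nn; rewrite sub0r normrN ger0_norm ?exprn_ge0 ?expR_ge0.
exists (\max_i N i) => B BN; apply: le_trans (prod1B_ge _) => [|i]; last first.
  by rewrite exprn_ge0 ?expR_ge0 // exprn_ile1 ?expR_ge0 // ltW ?expRN_lt1.
have : \sum_i expR (- x i) ^+ B.+1 <= \sum_(i : I) e.
  by apply: ler_sum => i _; apply: NP; apply: leqW; apply: leq_trans BN; exact: leq_bigmax.
rewrite sumr_const -mulr_natl; suff : #|I|%:R * e <= 1 / 2 by lra.
rewrite /e invfM mulrCA mul1r ler_piMr ?invr_ge0 //.
by rewrite ler_pdivrMr // mul1r ler_nat.
Qed.

End IndependentGeometricLaws.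

Notation config V B := {ffun V -> 'I_B.+1}.

Section Deviations.
Context {R : realType} {d : nat} (C : set 'rV[R]_d) (a : 'rV[R]_d).
Hypotheses (d_ge2 : (2 <= d)%N) (C_cone : convex_cone C) (C_int : C° !=set0).
Hypothesis a_coercive : coercive C a.
Implicit Types (g : 'rV[R]_d -> R) (p : 'rV[int]_d) (t e del : R) (V : {fset 'rV[int]_d}).

Local Notation kappa := (@kappa R d).
Local Notation moment := (moment C a).
Local Notation mean_term := (mean_term C a).

Definition config_sum g V B (om : config V B) : R :=
  \sum_(p : V) (om p)%:R * g (intr_row (val p)).

Definition weight t V B (om : config V B) : R := expR (- (config_sum (dot a) om / t)).

Definition partition_function t V B : R := \sum_(om : config V B) weight t om.

Definition primitive_in V := forall p, p \in V -> primitive p /\ C (intr_row p).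

Definition captures_mean t V := primitive_in V /\
  rsum (mean_term (dot a) t) - 1 <= \sum_(p <- V) mean_term (dot a) t p.

Definition mild_truncation t V B :=
  1 / 2 <= \prod_(p : V) (1 - expR (- (dot a (intr_row (val p)) / t)) ^+ B.+1).

Lemma weight_gt0 t V B (om : config V B) : 0 < weight t om.
Proof. exact: expR_gt0. Qed.

Lemma partition_function_gt0 t V B : 0 < partition_function t V B.
Proof.
rewrite /partition_function (bigD1 [ffun=> ord0]) //= ltr_pwDl ?weight_gt0 //.
by apply: sumr_ge0 => om _; exact: expR_ge0.
Qed.

Lemma primitive_dot_gt0 p : primitive p -> C (intr_row p) -> 0 < dot a (intr_row p).
Proof.
by move=> pp Cp; apply: (coercive_gt0 a_coercive); rewrite // intr_row_eq0 primitive_neq0.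
Qed.

Lemma captures_mean_exists t (F : {fset 'rV[int]_d}) : 0 < t ->
  exists V, captures_mean t V /\
    forall p, p \in F -> primitive p -> C (intr_row p) -> p \in V.
Proof.
move=> t0; have a_ge0 x : C x -> 0 <= dot a x by exact: coercive_ge0.
have [s _] := mean_series C_cone C_int a_coercive (homlip_dot C a) a_ge0 t0.
have m0 p : 0 <= mean_term (dot a) t p by apply: mean_term_ge0.
have [G G_large] := rsum_adherent m0 s ltr01.
pose inC p := primitive p && `[< C (intr_row p) >].
exists [fset p in (G `|` F)%fset | inC p]%fset; split; last first.
  by move=> p pF pp /asboolP Cp; rewrite !inE pF orbT /inC pp Cp.
split; first by move=> p; rewrite !inE => /and3P[_ pp /asboolP].
apply: (le_trans (ltW G_large)); apply: le_trans (ler_sum_fsubset m0 (fsubsetUl G F)) _.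
rewrite (bigID inC) /= [X in _ + X]big1 ?addr0 => [|p /negbTE np]; last first.
  by rewrite /mean_term -/(inC p) np.
rewrite -big_filter; apply/eq_ler/perm_big; apply: uniq_perm => [||p].
- exact: filter_uniq (fset_uniq _).
- exact: fset_uniq.
by rewrite mem_filter !inE andbC.
Qed.

Lemma sum_mean_le g e : homlip C g -> 0 < e -> \forall t \near +oo, forall V,
  captures_mean t V ->
  \sum_(p <- V) mean_term g t p <= (kappa * moment g + e) * t ^+ d.
Proof.
move=> hg e0; have [G G0 gG] := homlip_le_dot C_cone a_coercive hg.
have ha := homlip_dot C a; have a_ge0 x : C x -> 0 <= dot a x by exact: coercive_ge0.
pose h x := g x + G * dot a x; have hh : homlip C h by apply: homlipD => //; exact: homlipZ.
have h_ge0 x : C x -> 0 <= h x.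
  by move=> Cx; have := gG _ Cx; rewrite /h ler_norml => /andP[]; lra.
have mean_gE t p : mean_term g t p = mean_term h t p - G * mean_term (dot a) t p.
  by rewrite /mean_term /h; case: ifP => _; ring.
pose total t := rsum (mean_term h t) / t ^+ d - G * (rsum (mean_term (dot a) t) / t ^+ d).
have total_cvg : total t @[t --> +oo] --> kappa * moment g.
  have -> : kappa * moment g = kappa * moment h - G * (kappa * moment (dot a)).
    by rewrite momentD ?momentZ //; [ring|exact: homlipZ].
  by apply: cvgB; [|apply: cvgMr]; exact: mean_cvg.
have e2 : 0 < e / 2 by rewrite divr_gt0.
move/cvgrPdist_le/(_ _ e2): total_cvg => total_near.
near=> t => V [V_prim V_mean].
have t1 : 1 <= t by near: t; apply: nbhs_pinfty_ge; exact: num_real.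
have t_large : G / (e / 2) <= t by near: t; apply: nbhs_pinfty_ge; exact: num_real.
have total_le : total t <= kappa * moment g + e / 2.
  have : `|kappa * moment g - total t| <= e / 2 by near: t; exact: total_near.
  by rewrite ler_norml => /andP[]; lra.
have t0 := lt_le_trans ltr01 t1; have td0 : 0 < t ^+ d by rewrite exprn_gt0.
have G_le : G <= e / 2 * t ^+ d.
  rewrite mulrC -ler_pdivrMr //; apply: le_trans t_large _.
  by rewrite -[leLHS]expr1 ler_weXn2l // (leq_trans _ d_ge2).
have [h_sum _] := mean_series C_cone C_int a_coercive hh h_ge0 t0.
have V_h : \sum_(p <- V) mean_term h t p <= rsum (mean_term h t).
  by apply: sum_le_rsum => // p; apply: mean_term_ge0.
under eq_bigr do rewrite mean_gE.
rewrite sumrB -mulr_sumr.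
have total_td : total t * t ^+ d = rsum (mean_term h t) - G * rsum (mean_term (dot a) t).
  by rewrite mulrBl -[G * _ * _]mulrA !divfK ?gt_eqF.
have := ler_wpM2r (ltW td0) total_le; have := ler_wpM2l G0 V_mean.
rewrite total_td; move: V_h G_le.
move: (rsum _) (rsum _) (\sum_(p <- V) _) (\sum_(p <- V) _) (kappa * _) (t ^+ d) => *; lra.
Unshelve. all: by end_near. Qed.

(* Markov's inequality for [expR (y * config_sum g / t)]. *)
Lemma chernoff_config_sum g (G y L t : R) V B : 0 < t -> 0 <= y -> 0 <= G -> y * G <= 1 / 8 ->
  (forall x, C x -> `|g x| <= G * dot a x) -> primitive_in V -> mild_truncation t V B ->
  \sum_(om : config V B | L <= config_sum g om) weight t om
    <= 2 * expR (y * (\sum_(p <- V) mean_term g t p) - y * L / t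
                 + 12 * (y * G) ^+ 2 * \sum_(p <- V) expR (- (8^-1 * dot a (t^-1 *: intr_row p))))
       * partition_function t V B.
Proof.
move=> t0 y0 G0 yG gG V_prim trunc.
pose x (p : V) := dot a (intr_row (val p)) / t; pose z (p : V) := y * (g (intr_row (val p)) / t).
have x0 (p : V) : 0 < x p by have [pp Cp] := V_prim _ (valP p); rewrite divr_gt0 ?primitive_dot_gt0.
have zx (p : V) : `|z p| <= y * G * x p.
  have [pp Cp] := V_prim _ (valP p); rewrite normrM ger0_norm // -mulrA ler_wpM2l //.
  by rewrite normrM (gtr0_norm (_ : 0 < t^-1)) ?invr_gt0 // mulrA ler_pM2r ?invr_gt0 // gG.
have tilted := tilted_sum_le (mulr_ge0 y0 G0) yG x0 zx trunc.
have ZE : \sum_(om : config V B) expR (- \sum_i (om i)%:R * x i) = partition_function t V B.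
  apply: eq_bigr => om _; rewrite /weight /config_sum mulr_suml; congr (expR (- _)).
  by apply: eq_bigr => p _; rewrite mulrA.
have meanE : \sum_i z i / (expR (x i) - 1) = y * \sum_(p <- V) mean_term g t p.
  rewrite big_seq_fsetE mulr_sumr; apply: eq_bigr => p _; rewrite /= /mean_term.
  by have [-> Cp] := V_prim _ (valP p); rewrite asboolT //= /z /x !mulrA.
have decayE : \sum_i expR (- (x i / 8))
    = \sum_(p <- V) expR (- (8^-1 * dot a (t^-1 *: intr_row p))).
  by rewrite big_seq_fsetE; apply: eq_bigr => p _; rewrite dotZr /x; congr (expR (- _)); ring.
rewrite {}ZE {}meanE {}decayE in tilted.
have markov : expR (y * L / t) * (\sum_(om : config V B | L <= config_sum g om) weight t om)
   <= \sum_(om : config V B) expR (- \sum_i (om i)%:R * (x i - z i)).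
  rewrite [leRHS](bigID (fun om => L <= config_sum g om)) /= mulr_sumr.
  apply: ler_wpDr; first by apply: sumr_ge0 => om _; exact: expR_ge0.
  apply: ler_sum => om Lg; rewrite /weight -expRD ler_expR.
  have -> : \sum_i (om i)%:R * (x i - z i)
      = config_sum (dot a) om / t - y * config_sum g om / t.
    rewrite /config_sum mulr_suml -mulrA mulr_suml mulr_sumr -sumrB.
    by apply: eq_bigr => p _; rewrite /x /z; ring.
  by rewrite opprB lerD2r ler_pM2r ?invr_gt0 // ler_wpM2l.
rewrite -(ler_pM2l (expR_gt0 (y * L / t))); apply: le_trans (le_trans markov tilted) _.
rewrite [leRHS]mulrCA [leRHS]mulrA -[X in _ <= X * _]mulrA -expRD.
by apply: eq_ler; congr (_ * expR _ * _); ring.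
Qed.

Lemma sum_expRN_dot_le (s : R) : 0 < s -> exists2 E : R, 0 <= E &
  forall t V, 1 <= t -> primitive_in V ->
  \sum_(p <- V) expR (- (s * dot a (t^-1 *: intr_row p))) <= E * t ^+ d.
Proof.
move=> s0; have [E E0 density_le] := exp_density_bounded C_cone C_int a_coercive s0.
exists E => // t V t1 V_prim; have t0 : 0 < t := lt_le_trans ltr01 t1.
have := density_le _ t1; rewrite ler_pdivrMr ?exprn_gt0 //; apply: le_trans.
have decay := exp_decay_summable C_cone (exp_dot_decay a_coercive s0) t0.
apply: le_trans (sum_le_rsum V _ decay).
  rewrite big_seq [leRHS]big_seq; apply: ler_sum => p /V_prim[_ Cp].
  by rewrite /lattice_term asboolT.
by move=> p; apply: lattice_term_ge0 => // w _; exact: expR_ge0.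
Qed.

Lemma upper_deviation g del : homlip C g -> 0 < del -> exists2 eta : R, 0 < eta &
  \forall t \near +oo, forall V B, captures_mean t V -> mild_truncation t V B ->
  \sum_(om : config V B | (kappa * moment g + del) * t ^+ d.+1 <= config_sum g om) weight t om
    <= 2 * expR (- (eta * t ^+ d)) * partition_function t V B.
Proof.
move=> hg del0; have [G G0 gG] := homlip_le_dot C_cone a_coercive hg.
have eighth : 0 < (8^-1 : R) by rewrite invr_gt0.
have [E E0 decay_sum_le] := sum_expRN_dot_le eighth.
pose D := 12 * G ^+ 2 * E; have D0 : 0 <= D by rewrite mulr_ge0 // mulr_ge0 ?sqr_ge0.
have G1 : 0 < 8 * (G + 1) by rewrite mulr_gt0 // ltr_wpDl.
have D1 : 0 < 4 * (D + 1) by rewrite mulr_gt0 // ltr_wpDl.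
pose y := Num.min (8 * (G + 1))^-1 (del / (4 * (D + 1))).
have y0 : 0 < y by rewrite lt_min invr_gt0 G1 divr_gt0.
have yG : y * G <= 1 / 8.
  have : y * (8 * (G + 1)) <= 1 by rewrite -ler_pdivlMr // div1r ge_min lexx.
  by move: y0; lra.
have yD : D * y <= del / 4.
  have : y * (4 * (D + 1)) <= del by rewrite -ler_pdivlMr // ge_min lexx orbT.
  by move: y0; lra.
have del4 : 0 < del / 4 by rewrite divr_gt0.
have mean_near := sum_mean_le hg del4.
exists (del * y / 2); first by rewrite divr_gt0 // mulr_gt0.
near=> t => V B V_mean trunc.
have t1 : 1 <= t by near: t; apply: nbhs_pinfty_ge; exact: num_real.
have mean_le : \sum_(p <- V) mean_term g t p <= (kappa * moment g + del / 4) * t ^+ d.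
  by move: V V_mean {trunc}; near: t; exact: mean_near.
have t0 := lt_le_trans ltr01 t1; have td0 : 0 < t ^+ d by rewrite exprn_gt0.
have V_prim := V_mean.1; have decay_le := decay_sum_le t V t1 V_prim.
apply: le_trans (chernoff_config_sum _ t0 (ltW y0) G0 yG gG V_prim trunc) _.
rewrite ler_wpM2r ?(ltW (partition_function_gt0 _ _ _)) // ler_pM2l // ler_expR.
have -> : y * ((kappa * moment g + del) * t ^+ d.+1) / t = y * (kappa * moment g + del) * t ^+ d.
  by rewrite exprS; field; rewrite gt_eqF.
have quad_le : 12 * (y * G) ^+ 2 * \sum_(p <- V) expR (- (8^-1 * dot a (t^-1 *: intr_row p)))
    <= del / 4 * y * t ^+ d.
  apply: (@le_trans _ _ (12 * (y * G) ^+ 2 * (E * t ^+ d))).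
    by rewrite ler_wpM2l // mulr_ge0 ?sqr_ge0.
  have -> : 12 * (y * G) ^+ 2 * (E * t ^+ d) = D * y * (y * t ^+ d) by rewrite /D; ring.
  by rewrite -[leRHS]mulrA ler_wpM2r // mulr_ge0 // ltW.
have := ler_wpM2l (ltW y0) mean_le; move: quad_le.
move: (kappa * moment g) (\sum_(p <- V) _) (12 * _ * _) => *; lra.
Unshelve. all: by end_near. Qed.

Lemma exists_pos_lower_bound (I : finType) (u : I -> R) : (forall i, 0 < u i) ->
  exists2 e : R, 0 < e & forall i, e <= u i.
Proof.
move=> u0; exists (\big[Num.min/1]_i u i) => [|i]; last exact: bigmin_le_cond.
by apply/bigmin_gtP; split => //= i _; exact: u0.
Qed.

Lemma deviation_family (I : finType) (F : I -> 'rV[R]_d -> R) del :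
  (forall i, homlip C (F i)) -> 0 < del -> exists2 eta : R, 0 < eta &
  \forall t \near +oo, forall V B, captures_mean t V -> mild_truncation t V B ->
  \sum_(om : config V B |
      [exists i, del * t ^+ d.+1 <= `|config_sum (F i) om - kappa * moment (F i) * t ^+ d.+1|])
    weight t om
  <= #|I|%:R * 4 * expR (- (eta * t ^+ d)) * partition_function t V B.
Proof.
move=> hF del0; pose Fs (q : I * bool) x := (-1) ^+ q.2 * F q.1 x.
have hFs q : homlip C (Fs q) by exact: homlipZ.
have /choice[et etP] : forall q, exists eta : R, 0 < eta /\
    \forall t \near +oo, forall V B, captures_mean t V -> mild_truncation t V B ->
    \sum_(om : config V B | (kappa * moment (Fs q) + del) * t ^+ d.+1 <= config_sum (Fs q) om)
      weight t om <= 2 * expR (- (eta * t ^+ d)) * partition_function t V B.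
  by move=> q; have [eta eta0 etaP] := upper_deviation (hFs q) del0; exists eta.
have [eta eta0 eta_le] := exists_pos_lower_bound (fun q => (etP q).1).
exists eta => //; have near_all := filter_forall _ (fun q => (etP q).2).
near=> t => V B V_mean trunc; have t0 : 0 < t by near: t; exact: nbhs_pinfty_gt.
have Z0 := ltW (partition_function_gt0 t V B).
have one_le q : \sum_(om : config V B | (kappa * moment (Fs q) + del) * t ^+ d.+1
      <= config_sum (Fs q) om) weight t om
    <= 2 * expR (- (eta * t ^+ d)) * partition_function t V B.
  apply: (@le_trans _ _ (2 * expR (- (et q * t ^+ d)) * partition_function t V B)).
    by move: q V B V_mean trunc {Z0}; near: t; exact: near_all.
  by rewrite ler_wpM2r // ler_pM2l // ler_expR lerN2 ler_wpM2r // exprn_ge0 // ltW.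
have -> : #|I|%:R * 4 * expR (- (eta * t ^+ d)) * partition_function t V B
    = \sum_(q : I * bool) 2 * expR (- (eta * t ^+ d)) * partition_function t V B.
  by rewrite sumr_const card_prod card_bool -[RHS]mulr_natl natrM; ring.
apply: le_trans (ler_sum _ (fun q _ => one_le q)).
under [leRHS]eq_bigr do rewrite big_mkcond.
rewrite exchange_big big_mkcond /=; apply: ler_sum => om _.
have terms_ge0 q : 0 <= if (kappa * moment (Fs q) + del) * t ^+ d.+1 <= config_sum (Fs q) om
    then weight t om else 0 by case: ifP => // _; exact: ltW (weight_gt0 _ _).
case: ifP => [/existsP[i]|_]; last exact: sumr_ge0.
have FsE b : config_sum (Fs (i, b)) om = (-1) ^+ b * config_sum (F i) om.
  by rewrite /config_sum mulr_sumr; apply: eq_bigr => p _; rewrite mulrCA.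
rewrite ler_normr => /orP[] far; [rewrite (bigD1 (i, false))|rewrite (bigD1 (i, true))] => //=.
all: rewrite ifT; first by rewrite lerDl sumr_ge0.
all: by rewrite FsE momentZ //= ?expr0 ?expr1; lra.
Unshelve. all: by end_near. Qed.

End Deviations.

(** * Zonotopes *)

Lemma big_option (M : nmodType) (I : finType) (F : option I -> M) :
  \sum_o F o = F None + \sum_i F (Some i).
Proof.
rewrite (bigD1 None) //=; congr (_ + _).
by rewrite (reindex_omap Some id) => [|[]] //=; apply: eq_bigl => i; rewrite eqxx.
Qed.

Section FiniteZonotopes.
Context {R : realType} {d : nat}.
Implicit Types (x y u w : 'rV[R]_d).

Definition fin_zonotope (I : finType) (v : I -> 'rV[R]_d) : set 'rV[R]_d :=
  [set x | exists al : I -> R, (forall i, 0 <= al i <= 1) /\ x = \sum_i al i *: v i].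

Lemma zonotope_enum_val (I : finType) (v : I -> 'rV[R]_d) :
  zonotope (fun i : 'I_#|I| => v (enum_val i)) = fin_zonotope v.
Proof.
apply/seteqP; split => x [al [al01 ->]].
  exists (fun i => al (enum_rank i)); split => //.
  rewrite [RHS](reindex (@enum_val I predT)) /=; last exact: onW_bij (enum_val_bij _).
  by apply: eq_bigr => i _; rewrite enum_valK.
exists (fun i => al (enum_val i)); split => //.
by rewrite [LHS](reindex (@enum_val I predT)) //; exact: onW_bij (enum_val_bij _).
Qed.

Definition zonotope_support (I : finType) (v : I -> 'rV[R]_d) u : R :=
  \sum_i Num.max 0 (dot u (v i)).

Lemma dot_le_zonotope_support (I : finType) (v : I -> 'rV[R]_d) u x :
  fin_zonotope v x -> dot u x <= zonotope_support v u.
Proof.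
move=> [al [al01 ->]]; rewrite dot_sumr; apply: ler_sum => i _.
rewrite dotZr; have /andP[al0 al1] := al01 i.
by have [uv|uv] := leP 0 (dot u (v i)); nra.
Qed.

Lemma zonotope_support_attained (I : finType) (v : I -> 'rV[R]_d) u :
  exists2 x, fin_zonotope v x & dot u x = zonotope_support v u.
Proof.
pose al i : R := (0 <= dot u (v i))%R%:R.
exists (\sum_i al i *: v i).
  by exists al; split => // i; rewrite /al ler0n lern1 leq_b1.
rewrite dot_sumr; apply: eq_bigr => i _; rewrite dotZr /al.
by have [uv|uv] := leP 0 (dot u (v i)); rewrite ?mul1r ?mul0r.
Qed.

Lemma eq_zonotope_support (I J : finType) (v : I -> 'rV[R]_d) (w : J -> 'rV[R]_d) :
  fin_zonotope v = fin_zonotope w -> zonotope_support v =1 zonotope_support w.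
Proof.
move=> vw u; apply/eqP; rewrite eq_le; apply/andP; split.
  have [x vx <-] := zonotope_support_attained v u.
  by apply: dot_le_zonotope_support; rewrite -vw.
have [x wx <-] := zonotope_support_attained w u.
by apply: dot_le_zonotope_support; rewrite vw.
Qed.

Lemma exists_pos_mul_lt (I : eqType) (s : seq I) (A B : I -> R) :
  (forall i, i \in s -> 0 < A i) ->
  exists2 e, 0 < e & forall i, i \in s -> e * `|B i| < A i.
Proof.
elim: s => [|i s IH] A0; first by exists 1.
have [|e e0 eP] := IH; first by move=> j js; apply: A0; rewrite inE js orbT.
have Ai : 0 < A i by apply: A0; rewrite inE eqxx.
have Bi : 0 < `|B i| + 1 by rewrite ltr_wpDl.
exists (Num.min e (A i / (`|B i| + 1))); first by rewrite lt_min e0 divr_gt0.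
move=> j; rewrite inE => /orP[/eqP ->|js]; last first.
  by apply: le_lt_trans (eP _ js); rewrite ler_wpM2r // ge_min lexx.
apply: (@le_lt_trans _ _ (A i / (`|B i| + 1) * `|B i|)).
  by rewrite ler_wpM2r // ge_min lexx orbT.
by rewrite mulrAC ltr_pdivrMr // ltr_pM2l // ltrDl.
Qed.

Lemma generic_orthogonal x0 (s : seq 'rV[R]_d) :
  (forall x, x \in s -> exists w, dot w x0 = 0 /\ dot w x != 0) ->
  exists u, dot u x0 = 0 /\ forall x, x \in s -> dot u x != 0.
Proof.
elim: s => [|x s IH] sP; first by exists 0; rewrite dotC dot0r.
have [|u [u0 us]] := IH; first by move=> y ys; apply: sP; rewrite inE ys orbT.
have [|w [w0 wx]] := sP x; first by rewrite inE eqxx.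
have [ux|ux] := eqVneq (dot u x) 0; last first.
  by exists u; split => // y; rewrite inE => /orP[/eqP ->|]; [|exact: us].
have [|e e0 eP] := @exists_pos_mul_lt _ s (fun y => `|dot u y|) (fun y => dot w y).
  by move=> y ys; rewrite normr_gt0 us.
exists (u + e *: w); rewrite dotDl dotZl u0 w0 mulr0 addr0; split => // y.
rewrite inE dotDl dotZl => /orP[/eqP ->|ys]; first by rewrite ux add0r mulf_neq0 // gt_eqF.
apply: contraTneq (eP _ ys) => /eqP; rewrite addr_eq0 => /eqP ->.
by rewrite normrN normrM (gtr0_norm e0) ltxx.
Qed.

Lemma nonparallel_orthogonal x0 x : x0 != 0 -> (forall lam, x != lam *: x0) ->
  exists w, dot w x0 = 0 /\ dot w x != 0.
Proof.
move=> x0_neq0 nonpar; pose lam := dot x x0 / dot x0 x0.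
have ortho : dot (x - lam *: x0) x0 = 0.
  by rewrite dotBl dotZl /lam divfK ?subrr // gt_eqF ?dotxx_gt0.
exists (x - lam *: x0); split => //; apply: contra (nonpar lam) => /eqP ortho_x.
rewrite -subr_eq0 (@dotxx_eq0 _ _ (x - lam *: x0)) // dotBr dotZr ortho ortho_x.
by rewrite mulr0 subrr.
Qed.

(* The kinks of [u |-> max 0 <u, x_i>] lie on pairwise distinct hyperplanes: a second
   difference across a generic point of the hyperplane of [x_i] isolates [c i]. *)
Lemma kink_independence (I : finType) (x : I -> 'rV[R]_d) (c : I -> R) :
  (forall i, x i != 0) -> (forall i j lam, i != j -> x j != lam *: x i) ->
  (forall u, \sum_i c i * Num.max 0 (dot u (x i)) = 0) -> forall i, c i = 0.
Proof.
move=> x_neq0 nonpar sum0 i0; pose others := [seq i <- enum I | i != i0].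
have othersE i : (i \in others) = (i != i0) by rewrite mem_filter mem_enum andbT.
have [|u [u0 u_others]] := @generic_orthogonal (x i0) [seq x i | i <- others].
  move=> y /mapP[i]; rewrite othersE => ii ->.
  by apply: nonparallel_orthogonal => // lam; apply: nonpar; rewrite eq_sym.
have [|e e0 eP] := @exists_pos_mul_lt _ others
    (fun i => `|dot u (x i)|) (fun i => dot (x i0) (x i)).
  by move=> i ii; rewrite normr_gt0 u_others // map_f.
pose kink i := Num.max 0 (dot (u + e *: x i0) (x i)) + Num.max 0 (dot (u - e *: x i0) (x i))
               - 2 * Num.max 0 (dot u (x i)).
have kink_others i : i != i0 -> kink i = 0.
  rewrite -othersE => /eP; rewrite -{1}(gtr0_norm e0) -normrM /kink dotDl dotBl dotZl.
  move: (e * _) (dot u _) => y z; rewrite ltr_norml.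
  have [z0|z0] := leP 0 z.
    by rewrite ger0_norm // => /andP[? ?]; rewrite !max_r; first [ring|lra].
  by rewrite ltr0_norm // => /andP[? ?]; rewrite !max_l; first [ring|lra].
have kink_i0 : kink i0 = e * dot (x i0) (x i0).
  have ex0 : 0 < e * dot (x i0) (x i0) by rewrite mulr_gt0 ?dotxx_gt0.
  rewrite /kink dotDl dotBl dotZl u0 maxxx add0r sub0r max_r ?ltW // max_l; first ring.
  by rewrite oppr_le0 ltW.
have : \sum_i c i * kink i = 0.
  under eq_bigr do rewrite mulrBr mulrDr mulrCA.
  by rewrite sumrB big_split /= -mulr_sumr !sum0 mulr0 addr0 subrr.
rewrite (bigD1 i0) //= big1 ?addr0 => [|i /kink_others ->]; last by rewrite mulr0.
by move=> /eqP; rewrite kink_i0 !mulf_eq0 (gt_eqF e0) (gt_eqF (dotxx_gt0 _)) ?orbF // => /eqP.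
Qed.

Section Merge.
Variables (I J : finType) (c : I -> R) (y : I -> 'rV[R]_d) (x : J -> 'rV[R]_d).
Hypotheses (x_inj : injective x) (c_ge0 : forall i, 0 <= c i).
Hypothesis y_in_x : forall i, c i != 0 -> exists j, y i = x j.

Lemma sum_merge (al : I -> R) :
  \sum_i al i *: (c i *: y i) = \sum_j (\sum_(i | y i == x j) al i * c i) *: x j.
Proof.
under [RHS]eq_bigr do rewrite scaler_suml.
rewrite (exchange_big_dep xpredT) //=; apply: eq_bigr => i _.
rewrite scalerA; have [->|ci] := eqVneq (c i) 0.
  by rewrite mulr0 scale0r big1 // => j _; rewrite scale0r.
have [j yj] := y_in_x ci; rewrite (bigD1 j) ?yj //= big1 ?addr0 // => j' /andP[/eqP jj' nj].
by case/negP: nj; apply/eqP; apply: x_inj.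
Qed.

Lemma fin_zonotope_merge :
  fin_zonotope (fun i => c i *: y i)
  = fin_zonotope (fun j => (\sum_(i | y i == x j) c i) *: x j).
Proof.
apply/seteqP; split => z [al [al01 ->]]; last first.
  exists (fun i => if [pick j | y i == x j] is Some j then al j else 0); split => [i|].
    by case: pickP => [j _|_] //; rewrite lexx ler01.
  rewrite sum_merge; apply: eq_bigr => j _; rewrite scalerA; congr (_ *: _).
  rewrite mulr_sumr; apply: eq_bigr => i /eqP yi; congr (_ * _).
  by case: pickP => [j'|/(_ j)]; rewrite yi ?eqxx // => /eqP/x_inj ->.
pose al_sum j := \sum_(i | y i == x j) al i * c i; pose c_sum j := \sum_(i | y i == x j) c i.
have al_le j : al_sum j <= c_sum j.
  by apply: ler_sum => i _; have /andP[? ?] := al01 i; rewrite ler_piMl.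
have al_ge0 j : 0 <= al_sum j.
  by apply: sumr_ge0 => i _; have /andP[? ?] := al01 i; rewrite mulr_ge0.
rewrite sum_merge; exists (fun j => al_sum j / c_sum j); split => [j|].
  have [->|cj] := eqVneq (c_sum j) 0; first by rewrite invr0 mulr0 lexx ler01.
  have cj0 : 0 < c_sum j by rewrite lt_def cj sumr_ge0.
  by rewrite divr_ge0 ?(ltW cj0) // ler_pdivrMr // mul1r al_le.
apply: eq_bigr => j _; rewrite scalerA; congr (_ *: _); rewrite -/(al_sum j) -/(c_sum j).
have [cj|cj] := eqVneq (c_sum j) 0; last by rewrite divfK.
by rewrite cj mulr0; apply/eqP; rewrite eq_le al_ge0 andbT -cj.
Qed.

End Merge.

End FiniteZonotopes.

Section IntegralZonotopes.
Context {R : realType} {d : nat} (C : set 'rV[R]_d) (a : 'rV[R]_d).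
Hypotheses (C_cone : convex_cone C) (C_pointed : pointed C).
Implicit Types (p q w K : 'rV[int]_d) (V : {fset 'rV[int]_d}).

Definition config_gen V B (om : config V B) (p : V) : 'rV[R]_d :=
  (om p)%:R *: intr_row (val p).

Definition config_endpoint V B (om : config V B) : 'rV[int]_d :=
  \sum_(p : V) val p *+ om p.

Lemma intr_row_sum (I : Type) (s : seq I) (w : I -> 'rV[int]_d) :
  intr_row (\sum_(i <- s) w i) = \sum_(i <- s) intr_row (w i) :> 'rV[R]_d.
Proof. exact: (big_morph _ (@intr_rowD R d) (@intr_row0 R d)). Qed.

Lemma intr_row_endpoint V B (om : config V B) :
  intr_row (config_endpoint om) = \sum_p config_gen om p.
Proof. by rewrite intr_row_sum; apply: eq_bigr => p _; rewrite intr_rowMn. Qed.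

Lemma primitive_nonparallel p q (lam : R) : primitive p -> primitive q ->
  C (intr_row p) -> C (intr_row q) -> p != q -> intr_row q != lam *: intr_row p.
Proof.
move=> p_prim q_prim Cp Cq; apply: contra => /eqP pq.
have p0 : intr_row p != 0 :> 'rV[R]_d by rewrite intr_row_eq0 primitive_neq0.
have q0 : intr_row q != 0 :> 'rV[R]_d by rewrite intr_row_eq0 primitive_neq0.
have lam_neq0 : lam != 0 by apply: contra q0 => /eqP l0; rewrite pq l0 scale0r.
have lam0 : 0 < lam.
  rewrite lt_def lam_neq0 leNgt; apply/negP => lam_lt0.
  apply: (pointed_coneN C_cone C_pointed Cp p0).
  apply: (@coneV _ _ _ C_cone (- lam)); first by rewrite oppr_gt0.
  by rewrite scalerN scaleNr opprK -pq.
have [j pj] := row_neq0P (primitive_neq0 p_prim).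
have qj : `|q 0 j|%:R = lam * `|p 0 j|%:R :> R.
  have /rowP/(_ j) := pq; rewrite !mxE !natr_absz !intr_norm => ->.
  by rewrite normrM (gtr0_norm lam0).
have cross : q *+ `|p 0%R j| = p *+ `|q 0%R j|.
  by apply: (@intr_row_inj R); rewrite !intr_rowMn qj pq scalerA mulrC.
have pj0 : (0 < `|p 0%R j|)%N by rewrite absz_gt0.
have qj0 : (0 < `|q 0%R j|)%N by rewrite -(ltr0n R) qj mulr_gt0 // ltr0n.
rewrite -(prednK pj0) -(prednK qj0) in cross.
by have [_ ->] := primitive_mul_inj q_prim p_prim cross.
Qed.

(* The extra generator [y] may be parallel to some element of [V]; it is known, so the
   remaining generators are still determined. *)
Definition padded_gen V B (om : config V B) (y : 'rV[R]_d) (o : option V) : 'rV[R]_d :=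
  if o is Some p then config_gen om p else y.

Lemma padded_zonotope_inj V B (om om' : config V B) y : primitive_in C V ->
  fin_zonotope (padded_gen om y) = fin_zonotope (padded_gen om' y) -> om = om'.
Proof.
move=> V_prim /eq_zonotope_support support_eq.
suff omE (p : V) : (om p)%:R - (om' p)%:R = 0 :> R.
  by apply/ffunP => p; apply/val_inj/eqP; rewrite -(eqr_nat R) -subr_eq0 omE.
move: p; apply: (@kink_independence _ _ _ (fun p : V => intr_row (val p))) => [p|p q lam pq|u].
- by have [p_prim _] := V_prim _ (valP p); rewrite intr_row_eq0 primitive_neq0.
- have [p_prim Cp] := V_prim _ (valP p); have [q_prim Cq] := V_prim _ (valP q).
  by apply: primitive_nonparallel => //; rewrite (inj_eq val_inj).
have := support_eq u; rewrite /zonotope_support !big_option /= => /addrI/eqP.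
rewrite -subr_eq0 -sumrB => /eqP; apply: etrans; apply: eq_bigr => p _.
by rewrite mulrBl /config_gen !dotZr !maxr_pMr // !mulr0.
Qed.

Lemma padded_zonotopes V B (om : config V B) y K :
  primitive_in C V -> C (intr_row y) -> config_endpoint om + y = K ->
  zonotopes C (intr_row K) (fin_zonotope (padded_gen om (intr_row y))).
Proof.
move=> V_prim Cy <-.
exists #|{: option V}|, (fun i => padded_gen om (intr_row y) (enum_val i)); split.
- move=> i; case: (enum_val i) => [p|] /=; last by split => //; exact: intr_row_integral.
  rewrite /config_gen -intr_rowMn; split; first exact: intr_row_integral.
  by rewrite intr_rowMn; apply: coneZ => //; exact: (V_prim _ (valP p)).2.
- by rewrite zonotope_enum_val.
rewrite -(big_enum_val (padded_gen om (intr_row y))) big_option /= -intr_row_endpoint.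
by rewrite intr_rowD addrC.
Qed.

Lemma bounded_lattice_fset (M : nat) : exists F : {fset 'rV[int]_d},
  forall p, (forall j, (`|p 0%R j| <= M)%N) -> p \in F.
Proof.
pose h (g : {ffun 'I_d -> 'I_(M + M).+1}) : 'rV[int]_d := \row_j ((g j : nat)%:Z - M%:Z).
exists [fset h g | g : {ffun 'I_d -> 'I_(M + M).+1}]%fset => p pM.
apply/imfsetP; exists [ffun j => inord `|(p 0 j + M%:Z)%R|%N] => //.
apply/rowP => j; rewrite mxE ffunE; move: (p 0 j) (pM j) => z zM.
by rewrite inordK; lia.
Qed.

Lemma primitive_part_cone w : w != 0 -> C (intr_row w) -> C (intr_row (primitive_part w)).
Proof.
move=> /gcd_row_gt0 w0; rewrite -{1}(primitive_partK w) intr_rowMn.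
by apply: coneV => //; rewrite ltr0n.
Qed.

Lemma zonotope_primitive_parts V m (w : 'I_m -> 'rV[int]_d)
    (N := fun p => (\sum_(i | primitive_part (w i) == p) gcd_row (w i))%N) :
  (forall i, w i != 0 -> primitive_part (w i) \in V) ->
  zonotope (fun i => intr_row (w i))
    = fin_zonotope (fun p : V => (N (val p))%:R *: intr_row (val p) : 'rV[R]_d) /\
  \sum_i w i = \sum_(p : V) val p *+ N (val p).
Proof.
move=> wV; pose y i : 'rV[R]_d := intr_row (primitive_part (w i)).
pose c i : R := (gcd_row (w i))%:R; pose x (p : V) : 'rV[R]_d := intr_row (val p).
have x_inj : injective x by move=> p q /intr_row_inj/val_inj.
have y_in_x i : c i != 0 -> exists p : V, y i = x p.
  rewrite pnatr_eq0 => ci; suff /wV pV : w i != 0 by exists (FSetSub pV).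
  by apply: contra ci => /eqP ->; rewrite gcd_row0.
have NE (p : V) : (N (val p))%:R = \sum_(i | y i == x p) c i.
  by rewrite natr_sum; apply: eq_bigl => i; rewrite (inj_eq (@intr_row_inj R d)).
have wE i : intr_row (w i) = c i *: y i by rewrite -intr_rowMn primitive_partK.
split.
  rewrite (_ : (fun i => intr_row (w i)) = fun i => c i *: y i); last exact/funext.
  rewrite [LHS](fin_zonotope_merge x_inj _ y_in_x) //.
  by congr fin_zonotope; apply/funext => p; rewrite NE.
apply: (@intr_row_inj R); rewrite !intr_row_sum.
under eq_bigr do rewrite wE -[c _ *: _]scale1r.
rewrite (sum_merge x_inj y_in_x); apply: eq_bigr => p _; rewrite intr_rowMn NE.
by congr (_ *: _); apply: eq_bigr => i _; rewrite mul1r.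
Qed.

Lemma zonotopes_config V B (c : R) K T : 0 < c -> (forall x, C x -> c * `|x| <= dot a x) ->
  primitive_in C V -> (forall p, primitive p -> C (intr_row p) ->
    c * `|intr_row p : 'rV[R]_d| <= dot a (intr_row K) -> p \in V) ->
  dot a (intr_row K) <= c * B%:R -> zonotopes C (intr_row K) T ->
  exists2 om : config V B, config_endpoint om = K & T = fin_zonotope (config_gen om).
Proof.
move=> c0 a_ge V_prim V_all K_le [m [v [vC -> vK]]].
have a_ge0 x : C x -> 0 <= dot a x.
  by move=> Cx; apply: le_trans (a_ge _ Cx); rewrite mulr_ge0 // ltW.
have /choice[w vE] : forall i, exists w, v i = intr_row w.
  by move=> i; apply: integral_intr_row; exact: (vC i).1.
have Cw i : C (intr_row (w i)) by rewrite -vE; exact: (vC i).2.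
have wK : \sum_i w i = K.
  by apply: (@intr_row_inj R); rewrite intr_row_sum -vK; apply: eq_bigr => i _.
have wV i : w i != 0 -> primitive_part (w i) \in V.
  move=> wi; have Cp := primitive_part_cone wi (Cw i).
  apply: V_all (primitive_part_primitive wi) (Cp) _; apply: le_trans (a_ge _ Cp) _.
  rewrite -wK intr_row_sum dot_sumr (bigD1 i) //= -{2}(primitive_partK (w i)) intr_rowMn dotZr.
  apply: ler_wpDr; first by apply: sumr_ge0 => j _; exact: a_ge0.
  by rewrite ler_peMl ?a_ge0 // ler1n gcd_row_gt0.
have [zonE sumE] := zonotope_primitive_parts wV.
set N := fun p => (\sum_(i | primitive_part (w i) == p) gcd_row (w i))%N in zonE sumE.
have N_le (p : V) : (N (val p) < B.+1)%N.
  have [p_prim Cp] := V_prim _ (valP p).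
  rewrite ltnS -(ler_nat R) -(ler_pM2l c0); apply: le_trans K_le.
  apply: (@le_trans _ _ ((N (val p))%:R * dot a (intr_row (val p)))).
    rewrite mulrC ler_wpM2l //; apply: le_trans (a_ge _ Cp).
    by rewrite ler_peMr ?(ltW c0) // norm_intr_row_ge1 // primitive_neq0.
  rewrite -wK sumE intr_row_sum dot_sumr (bigD1 p) //= intr_rowMn dotZr lerDl.
  apply: sumr_ge0 => q _; rewrite intr_rowMn dotZr mulr_ge0 // a_ge0 //.
  exact: (V_prim _ (valP q)).2.
exists [ffun p => inord (N (val p))].
  by rewrite -wK sumE; apply: eq_bigr => p _; rewrite ffunE inordK.
rewrite (_ : v = fun i => intr_row (w i)); last exact/funext.
by rewrite zonE; congr fin_zonotope; apply/funext => p; rewrite /config_gen ffunE inordK.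
Qed.

End IntegralZonotopes.

(** * The limit shape *)

Section ConcentratedPartition.
Context {R : realType} {d : nat} (C : set 'rV[R]_d) (a : 'rV[R]_d).
Hypotheses (C_cone : convex_cone C) (a_coercive : coercive C a).
Implicit Types (x th : 'rV[R]_d).

Lemma grid_cover (h : R) : 0 < h -> exists F : {fset 'rV[int]_d}, forall x, C x ->
  exists2 p, p \in F & `|x - dot a x *: (h *: intr_row p)| <= h * dot a x.
Proof.
move=> h0; have [c c0 a_ge] := a_coercive.
pose M := (Num.truncn ((c * h)^-1 + 1)).+1; have [F FP] := @bounded_lattice_fset d M.
exists F => x Cx; have ax_ge0 := coercive_ge0 a_coercive Cx.
have M_ge : (c * h)^-1 + 1 <= M%:R by rewrite ltW // truncnS_gt.
have [ax0|ax_neq0] := eqVneq (dot a x) 0.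
  exists 0; first by apply: FP => j; rewrite mxE.
  by rewrite (coercive_eq0 a_coercive Cx ax0) intr_row0 scaler0 scaler0 subr0 normr0 dot0r mulr0.
have ax0 : 0 < dot a x by rewrite lt_def ax_neq0.
pose y := (h * dot a x)^-1 *: x; have hax : 0 < h * dot a x by rewrite mulr_gt0.
have xE : x = (h * dot a x) *: y by rewrite scalerA mulfV ?scale1r // gt_eqF.
have y_le : `|y| <= (c * h)^-1.
  rewrite normrZ gtr0_norm ?invr_gt0 // ler_pdivrMl //.
  have -> : h * dot a x * (c * h)^-1 = c^-1 * dot a x by field; rewrite !gt_eqF.
  by rewrite ler_pdivlMl // a_ge.
exists (floor_row y).
  apply: FP => j; rewrite -(ler_nat R) natr_absz intr_norm; apply: le_trans M_ge.
  have -> : (floor_row y 0 j)%:~R = (intr_row (floor_row y)) 0 j :> R by rewrite [RHS]mxE.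
  apply: le_trans (ler_coord_norm _ j) _; rewrite -(subKr y (intr_row _)).
  by apply: le_trans (ler_normB _ _) (lerD y_le (floor_row_dist _)).
rewrite scalerA [_ * h]mulrC {1}xE -scalerBr normrZ gtr0_norm //.
by rewrite ler_piMr ?floor_row_dist // ltW.
Qed.

Definition bump (eta : R) th x : R :=
  2 / eta * Num.max 0 (eta * dot a x - `|x - dot a x *: th|).

Section Bump.
Variables (eta : R) (th : 'rV[R]_d).
Hypothesis eta_gt0 : 0 < eta.

Lemma bump_ge0 x : 0 <= bump eta th x.
Proof. by rewrite mulr_ge0 ?divr_ge0 ?(ltW eta_gt0) // le_max lexx. Qed.

Lemma homlip_bump : homlip C (bump eta th).
Proof.
apply/homlipZ/homlip_max => //; first exact: homlip0.
by apply: homlipB => //; [exact/homlipZ/homlip_dot|exact: homlip_dist].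
Qed.

Lemma dot_le_bump x : `|x - dot a x *: th| <= eta / 2 * dot a x -> dot a x <= bump eta th x.
Proof.
move=> near_x; rewrite /bump mulrAC ler_pdivlMr // mulrC.
rewrite -ler_pdivrMl // le_max; apply/orP; right; rewrite mulrC; lra.
Qed.

Lemma bump_eq0 x : eta * dot a x <= `|x - dot a x *: th| -> bump eta th x = 0.
Proof. by move=> far_x; rewrite /bump max_l ?mulr0 // subr_le0. Qed.

End Bump.

(* The increments of [min (dot a) (\sum_(j < i) bump_j)] add up to [dot a]. *)
Lemma concentrated_partition (eta : R) : 0 < eta ->
  exists (m : nat) (th : 'I_m -> 'rV[R]_d) (xi : 'I_m -> 'rV[R]_d -> R),
  [/\ forall i, homlip C (xi i), forall i x, C x -> 0 <= xi i x,
      forall x, C x -> \sum_i xi i x = dot a x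
    & forall i, concentrated C a eta (th i) (xi i)].
Proof.
move=> eta0; have eta2 : 0 < eta / 2 by rewrite divr_gt0.
have [F F_cover] := grid_cover eta2.
pose th i : 'rV[R]_d := (eta / 2) *: intr_row (nth 0 F i).
pose S i x := Num.min (dot a x) (\sum_(j <- iota 0 i) bump eta (th j) x).
have S_homlip i : homlip C (S i).
  apply: homlip_min => //; first exact: homlip_dot.
  by apply: homlip_sum => // j; exact: homlip_bump.
have sumS i x : \sum_(j <- iota 0 i.+1) bump eta (th j) x
    = \sum_(j <- iota 0 i) bump eta (th j) x + bump eta (th i) x.
  by rewrite -addn1 iotaD big_cat /= add0n big_seq1.
have S_le i x : S i x <= S i.+1 x.
  by rewrite /S sumS le_min ge_min lexx /= ge_min lerDl bump_ge0 ?orbT.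
exists (size F), (fun i => th i), (fun i x => S i.+1 x - S i x); split.
- by move=> i; exact: homlipB.
- by move=> i x Cx; rewrite subr_ge0.
- move=> x Cx; rewrite -(big_mkord xpredT (fun i => S i.+1 x - S i x)) telescope_sumr //.
  rewrite {2}/S big_nil min_r ?subr0; last exact: coercive_ge0 a_coercive Cx.
  have [p pF p_near] := F_cover x Cx; rewrite /S min_l //.
  rewrite (bigD1_seq (index p F)) ?iota_uniq ?mem_iota ?index_mem //=.
  apply: ler_wpDr; first by apply: sumr_ge0 => i _; exact: bump_ge0.
  by apply: dot_le_bump => //; rewrite /th nth_index.
move=> i x Cx; have [near_x|far_x] := leP `|x - dot a x *: th i| (eta * dot a x).
  by rewrite mulrC ler_wpM2r // subr_ge0.
by rewrite /S sumS (bump_eq0 (ltW far_x)) addr0 subrr !mulr0 mul0r.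
Qed.

End ConcentratedPartition.

Section ExcessBound.
Context {R : realType} {d : nat}.
Implicit Types A B : set 'rV[R]_d.

Lemma excess_le A B (eps : R) :
  (forall x, A x -> exists2 y, B y & d%:R * `|x - y| <= eps) -> (excess A B <= eps%:E)%E.
Proof.
move=> AB; apply: ge_ereal_sup => _ [x Ax <-]; have [y By xy] := AB x Ax.
apply: (@le_trans _ _ (eucl_norm (x - y))%:E); first by apply: ereal_inf_lbound; exists y.
by rewrite lee_fin; apply: le_trans (eucl_norm_le _) xy.
Qed.

End ExcessBound.

Lemma exists_ratio {R : realFieldType} (u v : R) : 0 <= u <= v ->
  exists r, 0 <= r <= 1 /\ r * v = u.
Proof.
move=> /andP[u0 uv]; have [v0|v_neq0] := eqVneq v 0.
  by exists 0; rewrite lexx ler01 mul0r; split=> //; apply/le_anti; rewrite u0 -v0 uv.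
have v0 : 0 < v by rewrite lt_def v_neq0 (le_trans u0).
by exists (u / v); rewrite divfK // ler_pdivrMr // mul1r uv divr_ge0 // ltW.
Qed.

Section LimitShape.
Context {R : realType} {d : nat} (C : set 'rV[R]_d) (a : 'rV[R]_d).
Hypotheses (C_cone : convex_cone C) (C_int : C° !=set0) (a_coercive : coercive C a).
Implicit Types (xi : 'rV[R]_d -> R) (x z : 'rV[R]_d).

Local Notation moment := (moment C a).
Local Notation vector_moment := (vector_moment C a).

Definition admissible xi := homlip C xi /\ forall x, C x -> 0 <= xi x <= dot a x.

(* The zonoid generated by the measure with density [expR (- dot a x)] on [C]. *)
Definition limit_shape : set 'rV[R]_d := [set vector_moment xi | xi in admissible].

Lemma limit_shape_convex : convex_set limit_shape.
Proof.
move=> _ _ lam /set_mem[xi [hxi xi01] <-] /set_mem[zeta [hzeta zeta01] <-].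
apply/mem_set; rewrite /conv /=.
exists (fun x => lam%:num * xi x + (1 - lam%:num) * zeta x).
  split; first by apply: homlipD => //; exact: homlipZ.
  move=> x Cx; have /andP[xi0 xi1] := xi01 _ Cx; have /andP[zeta0 zeta1] := zeta01 _ Cx.
  have lam0 : 0 <= lam%:num by []; have lam1 : lam%:num <= 1 by [].
  by apply/andP; split; nra.
by rewrite vector_momentD ?vector_momentZ //; exact: homlipZ.
Qed.

Lemma limit_shape_nonempty : limit_shape !=set0.
Proof.
exists (vector_moment (fun=> 0)); exists (fun=> 0) => //; split; first exact: homlip0.
by move=> x Cx; rewrite lexx (coercive_ge0 a_coercive).
Qed.

Section Discretization.
Variables (k : 'rV[R]_d) (eta : R) (m : nat).
Variables (th : 'I_m -> 'rV[R]_d) (xi : 'I_m -> 'rV[R]_d -> R).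
Hypotheses (moment_dot : moment (dot a) = dot a k) (eta_ge0 : 0 <= eta).
Hypotheses (xi_homlip : forall i, homlip C (xi i)) (xi_ge0 : forall i x, C x -> 0 <= xi i x).
Hypothesis xi_sum : forall x, C x -> \sum_i xi i x = dot a x.
Hypothesis xi_conc : forall i, concentrated C a eta (th i) (xi i).
Variables (V : {fset 'rV[int]_d}) (B : nat) (om : config V B) (n del : R).
Hypotheses (V_prim : primitive_in C V) (n_gt0 : 0 < n).
Hypothesis om_end : \sum_p config_gen om p = n *: k.
Hypothesis om_close : forall i, `|config_sum (xi i) om / n - moment (xi i)| <= del.

Let e (p : V) : 'rV[R]_d := intr_row (val p).

Let Ce p : C (e p). Proof. exact: (V_prim (valP p)).2. Qed.
#[local] Hint Resolve Ce : core.

Let dot_e_gt0 p : 0 < dot a (e p).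
Proof. by have [p_prim Cp] := V_prim (valP p); exact: (primitive_dot_gt0 a_coercive). Qed.

Let xi_e_ge0 i p : 0 <= xi i (e p). Proof. exact: xi_ge0. Qed.

Let config_sum_xi : \sum_i config_sum (xi i) om = n * dot a k.
Proof.
rewrite -dotZr -om_end dot_sumr exchange_big; apply: eq_bigr => p _.
by rewrite -mulr_sumr (xi_sum (Ce p)) dotZr.
Qed.

Let moment_xi : \sum_i moment (xi i) = dot a k.
Proof. by rewrite -moment_dot -moment_sum //; apply: eq_moment => //; exact: homlip_dot. Qed.

Let discrete_moment_dist (b : V -> 'I_m -> R) : (forall p i, 0 <= b p i <= (om p)%:R) ->
  `|n^-1 *: (\sum_p (\sum_i b p i * xi i (e p) / dot a (e p)) *: e p)
    - n^-1 *: (\sum_i (\sum_p b p i * xi i (e p)) *: th i)| <= eta * dot a k.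
Proof.
move=> b_bound; rewrite -scalerBr normrZ gtr0_norm ?invr_gt0 // ler_pdivrMl //.
have -> : n * (eta * dot a k) = \sum_p \sum_i eta * ((om p)%:R * xi i (e p)).
  rewrite mulrCA -config_sum_xi mulr_sumr exchange_big; apply: eq_bigr => i _.
  by rewrite mulr_sumr.
under [X in _ - X]eq_bigr do rewrite scaler_suml.
rewrite [X in _ - X]exchange_big -sumrB; apply: le_trans (ler_norm_sum _ _ _) _.
apply: ler_sum => p _; rewrite scaler_suml -sumrB; apply: le_trans (ler_norm_sum _ _ _) _.
apply: ler_sum => i _; have /andP[b0 b_le] := b_bound p i.
have -> : (b p i * xi i (e p) / dot a (e p)) *: e p - (b p i * xi i (e p)) *: th i
   = (b p i * xi i (e p) / dot a (e p)) *: (e p - dot a (e p) *: th i).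
  by rewrite scalerBr scalerA divfK // gt_eqF.
rewrite normrZ ger0_norm; last by rewrite divr_ge0 ?mulr_ge0 // ltW.
rewrite mulrAC ler_pdivrMr // -mulrA.
apply: le_trans (ler_wpM2l b0 (xi_conc i (Ce p))) _.
have eta_dot : 0 <= eta * dot a (e p) by rewrite mulr_ge0 // ltW.
by have := ler_wpM2l eta_dot (ler_wpM2r (xi_e_ge0 i p) b_le); lra.
Qed.

Let weighted_mean_dist (be : 'I_m -> R) : (forall i, 0 <= be i <= 1) ->
  `|n^-1 *: (\sum_i (be i * config_sum (xi i) om) *: th i)
    - \sum_i (be i * moment (xi i)) *: th i| <= del * \sum_i `|th i|.
Proof.
move=> be01; rewrite scaler_sumr -sumrB mulr_sumr.
apply: le_trans (ler_norm_sum _ _ _) _; apply: ler_sum => i _.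
have /andP[be0 be1] := be01 i; rewrite scalerA -scalerBl normrZ ler_wpM2r //.
have -> : n^-1 * (be i * config_sum (xi i) om) - be i * moment (xi i)
  = be i * (config_sum (xi i) om / n - moment (xi i)) by ring.
by rewrite normrM ger0_norm //; apply: le_trans (om_close i); rewrite ler_piMl.
Qed.

Let continuous_moment_dist (F : 'I_m -> 'rV[R]_d -> R) : (forall i, homlip C (F i)) ->
  (forall i x, C x -> 0 <= F i x <= xi i x) -> (forall i, concentrated C a eta (th i) (F i)) ->
  `|\sum_i moment (F i) *: th i - \sum_i vector_moment (F i)| <= eta * dot a k.
Proof.
move=> F_homlip F_bound F_conc; rewrite -sumrB; apply: le_trans (ler_norm_sum _ _ _) _.
rewrite -moment_xi mulr_sumr; apply: ler_sum => i _; rewrite distrC.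
have F_ge0 x : C x -> 0 <= F i x by move=> Cx; have /andP[] := F_bound i x Cx.
apply: le_trans (vector_moment_concentrated C_cone C_int a_coercive _ _ F_ge0 (F_conc i)) _ => //.
by rewrite ler_wpM2l //; apply: le_moment => // x Cx; have /andP[] := F_bound i x Cx.
Qed.

Definition discretization_error : R := 2 * eta * dot a k + del * \sum_i `|th i|.

(* Both sums are compared with [\sum_i (be i * moment (xi i)) *: th i]. *)
Let discretization_dist (b : V -> 'I_m -> R) (be : 'I_m -> R) (F : 'I_m -> 'rV[R]_d -> R) :
  (forall p i, 0 <= b p i <= (om p)%:R) -> (forall i, 0 <= be i <= 1) ->
  (forall i, \sum_p b p i * xi i (e p) = be i * config_sum (xi i) om) ->
  (forall i, homlip C (F i)) -> (forall i x, C x -> 0 <= F i x <= xi i x) ->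
  (forall i, concentrated C a eta (th i) (F i)) ->
  (forall i, moment (F i) = be i * moment (xi i)) ->
  `|n^-1 *: (\sum_p (\sum_i b p i * xi i (e p) / dot a (e p)) *: e p)
    - \sum_i vector_moment (F i)| <= discretization_error.
Proof.
move=> b_bound be01 b_sum F_homlip F_bound F_conc F_moment.
have := continuous_moment_dist F_homlip F_bound F_conc.
under eq_bigr do rewrite F_moment.
have := weighted_mean_dist be01; have := discrete_moment_dist b_bound.
under [X in `|_ - _ *: X| <= _ -> _]eq_bigr do rewrite b_sum.
set P := n^-1 *: _; set Q := n^-1 *: _; set S := \sum_i _ *: _; set U := \sum_i vector_moment _.
move=> PQ QS SU; apply: le_trans (ler_distD Q _ _) _.
by have := ler_distD S Q U; rewrite /discretization_error; lra.
Qed.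

Lemma zonotope_near_limit_shape x : fin_zonotope (config_gen om) x ->
  exists2 z, limit_shape z & `|n^-1 *: x - z| <= discretization_error.
Proof.
move=> [al [al01 ->]] {x}; pose al_sum i := \sum_p al p * (om p)%:R * xi i (e p).
have al_sum_bound i : 0 <= al_sum i <= config_sum (xi i) om.
  apply/andP; split; first apply: sumr_ge0 => p _; last apply: ler_sum => p _.
    by have /andP[? ?] := al01 p; rewrite !mulr_ge0.
  by have /andP[? ?] := al01 p; rewrite ler_wpM2r // ler_piMl.
have /choice[be beP] := fun i => exists_ratio (al_sum_bound i).
have be01 i := (beP i).1; have be_xi_bound i x : C x -> 0 <= be i * xi i x <= xi i x.
  by move=> Cx; have /andP[? ?] := be01 i; rewrite mulr_ge0 ?ler_piMl ?xi_ge0.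
have be_homlip i : homlip C (fun x => be i * xi i x) by exact: homlipZ.
exists (vector_moment (fun x => \sum_i be i * xi i x)).
  exists (fun x => \sum_i be i * xi i x) => //; split; first exact: homlip_sum.
  move=> x Cx; rewrite -xi_sum // sumr_ge0 /= => [|i _]; first by apply: ler_sum => i _;
    have /andP[] := be_xi_bound i x Cx.
  by have /andP[] := be_xi_bound i x Cx.
have zonE : \sum_p al p *: config_gen om p
    = \sum_p (\sum_i al p * (om p)%:R * xi i (e p) / dot a (e p)) *: e p.
  apply: eq_bigr => p _; rewrite -mulr_suml -mulr_sumr xi_sum //.
  by rewrite mulfK ?gt_eqF // scalerA.
rewrite zonE vector_moment_sum //.
apply: (discretization_dist (b := fun p _ => al p * (om p)%:R) _ be01) => //.
- by move=> p _; have /andP[? ?] := al01 p; rewrite mulr_ge0 ?ler_piMl.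
- by move=> i; rewrite (beP i).2.
- by move=> i x Cx; have /andP[be0 _] := be01 i; have := ler_wpM2l be0 (xi_conc i Cx); lra.
by move=> i; rewrite momentZ.
Qed.

Lemma limit_shape_near_zonotope z : limit_shape z ->
  exists2 x, fin_zonotope (config_gen om) x & `|n^-1 *: x - z| <= discretization_error.
Proof.
move=> [zeta [zeta_homlip zeta01] <-]; pose F i x := zeta x * xi i x / dot a x.
have F_homlip i : homlip C (F i) by exact: homlip_mul_div.
have ratio01 x : C x -> 0 <= zeta x / dot a x <= 1.
  move=> Cx; have /andP[zeta0 zeta1] := zeta01 _ Cx; have ax0 := coercive_ge0 a_coercive Cx.
  rewrite divr_ge0 //=; have [->|ax_neq0] := eqVneq (dot a x) 0; first by rewrite invr0 mulr0.
  by rewrite ler_pdivrMr ?mul1r // lt_def ax_neq0.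
have FE i x : F i x = zeta x / dot a x * xi i x by rewrite /F mulrAC.
have F_bound i x : C x -> 0 <= F i x <= xi i x.
  by move=> Cx; have /andP[? ?] := ratio01 _ Cx; rewrite FE mulr_ge0 ?ler_piMl ?xi_ge0.
have F_conc i : concentrated C a eta (th i) (F i).
  move=> x Cx; have /andP[ratio0 _] := ratio01 _ Cx.
  by have := ler_wpM2l ratio0 (xi_conc i Cx); rewrite FE; lra.
have F_sum x : C x -> \sum_i F i x = zeta x.
  move=> Cx; have /andP[zeta0 zeta1] := zeta01 _ Cx; rewrite -mulr_suml -mulr_sumr xi_sum //.
  have [ax0|ax0] := eqVneq (dot a x) 0; last by rewrite mulfK.
  by rewrite ax0 invr0 mulr0; apply/le_anti; rewrite zeta0 -ax0 zeta1.
have moment_bound i : 0 <= moment (F i) <= moment (xi i).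
  by apply/andP; split; [apply: moment_ge0|apply: le_moment] => // x Cx;
    have /andP[] := F_bound i x Cx.
have /choice[be beP] := fun i => exists_ratio (moment_bound i); have be01 i := (beP i).1.
pose al p := \sum_i be i * xi i (e p) / dot a (e p).
have al01 p : 0 <= al p <= 1.
  rewrite /al -mulr_suml; apply/andP; split.
    rewrite divr_ge0 ?(ltW (dot_e_gt0 p)) // sumr_ge0 // => i _.
    by have /andP[? ?] := be01 i; rewrite mulr_ge0.
  rewrite ler_pdivrMr // mul1r -xi_sum //; apply: ler_sum => i _.
  by have /andP[? ?] := be01 i; rewrite ler_piMl.
exists (\sum_p al p *: config_gen om p); first by exists al.
have zonE : \sum_p al p *: config_gen om p
    = \sum_p (\sum_i be i * (om p)%:R * xi i (e p) / dot a (e p)) *: e p.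
  apply: eq_bigr => p _; rewrite scalerA; congr (_ *: _).
  by rewrite /al mulr_suml; apply: eq_bigr => i _; ring.
have -> : vector_moment zeta = \sum_i vector_moment (F i).
  rewrite -vector_moment_sum //; apply: eq_vector_moment => // [|x Cx]; last by rewrite F_sum.
  exact: homlip_sum.
rewrite zonE; apply: (discretization_dist (b := fun p i => be i * (om p)%:R) _ be01) => //.
- by move=> p i; have /andP[? ?] := be01 i; rewrite mulr_ge0 ?ler_piMl.
- by move=> i; rewrite /config_sum mulr_sumr; apply: eq_bigr => p _; rewrite mulrA.
by move=> i; rewrite (beP i).2.
Qed.

Lemma hausdorff_dist_limit_shape_le (eps : R) : d%:R * discretization_error <= eps ->
  (hausdorff_dist [set n^-1 *: x | x in fin_zonotope (config_gen om)] limit_shape <= eps%:E)%E.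
Proof.
move=> err_le; rewrite /hausdorff_dist ge_max; apply/andP; split; apply: excess_le.
  move=> _ [x x_zon <-]; have [z z_shape xz] := zonotope_near_limit_shape x_zon.
  by exists z => //; apply: le_trans err_le; rewrite ler_wpM2l.
move=> z /limit_shape_near_zonotope[x x_zon xz]; exists (n^-1 *: x); first by exists x.
by apply: le_trans err_le; rewrite distrC ler_wpM2l.
Qed.

End Discretization.

End LimitShape.

(** * Counting zonotopes *)

Section FiniteCard.
Context {T : choiceType} {I : finType}.

Lemma finite_card_le_image (f : I -> T) (P : pred I) (A : set T) :
  A `<=` [set f i | i in [set i | P i]] -> finite_set A /\ (finite_card A <= #|P|)%N.
Proof.
move=> Af; have A_fin : finite_set A.
  by apply: sub_finite_set Af _; apply: finite_image; exact: finite_finset.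
split => //; rewrite /finite_card cardE -(size_map f).
apply: uniq_leq_size => // x; rewrite in_fset_set // inE => /Af[i /= Pi <-].
by apply: map_f; rewrite mem_enum.
Qed.

Lemma card_le_finite_card (J : finType) (g : I -> T) (h : I -> J) (P : pred I) (A : set T) :
  finite_set A -> (forall i, P i -> A (g i)) ->
  (forall i i', P i -> P i' -> g i = g i' -> h i = h i' -> i = i') ->
  (#|P| <= finite_card A * #|J|)%N.
Proof.
move=> A_fin PA inj; rewrite cardE -(size_map (fun i => (g i, h i))).
rewrite [#|J|]cardE -(size_allpairs pair); apply: uniq_leq_size.
  rewrite map_inj_in_uniq ?enum_uniq // => i i'; rewrite !mem_enum => Pi Pi' [].
  exact: inj.
move=> x /mapP[i]; rewrite mem_enum => Pi ->; apply/allpairsP.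
exists (g i, h i) => /=; split => //; last by rewrite mem_enum.
by rewrite in_fset_set // inE; exact: PA.
Qed.

End FiniteCard.

Lemma exists_pos_mul_le {R : realFieldType} (eps B : R) : 0 < eps -> 0 <= B ->
  exists2 e, 0 < e & e * B <= eps.
Proof.
move=> eps0 B0; have B1 : 0 < B + 1 by rewrite ltr_wpDl.
exists (eps / (B + 1)); first by rewrite divr_gt0.
by rewrite mulrAC ler_pdivrMr // ler_pM2l // lerDl.
Qed.

Lemma pow_expRN_le_near {R : realType} (d q : nat) (u A e : R) : (0 < d)%N -> 0 < u -> 0 <= A ->
  0 < e -> \forall t \near +oo, A * t ^+ q * expR (- (u * t ^+ d)) <= e.
Proof.
move=> d0 u0 A0 e0; pose D := A * (q.+1%:R / u) ^+ q.+1.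
near=> t; have t1 : 1 <= t by near: t; apply: nbhs_pinfty_ge; exact: num_real.
have t0 : 0 < t := lt_le_trans ltr01 t1.
have D_le : D / e <= t by near: t; apply: nbhs_pinfty_ge; exact: num_real.
apply: (@le_trans _ _ (D / t)); last by rewrite ler_pdivrMr // mulrC -ler_pdivrMr.
have -> : D / t = A * t ^+ q * (q.+1%:R / (u * t)) ^+ q.+1.
  by rewrite /D !expr_div_n !exprMn [t ^+ q.+1]exprS; field; rewrite !gt_eqF ?exprn_gt0.
rewrite ler_wpM2l ?mulr_ge0 ?exprn_ge0 ?(ltW t0) //.
apply: le_trans (expRN_le_pow q.+1 (mulr_gt0 u0 t0)).
by rewrite ler_expR lerN2 ler_pM2l // -[leLHS]expr1 ler_weXn2l.
Unshelve. all: by end_near. Qed.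

Lemma near_infty_root {R : realType} (s : R) (d : nat) (P : R -> Prop) : 0 < s ->
  (\forall t \near +oo, P t) -> \forall n \near \oo, exists2 t, P t & n%:R = s * t ^+ d.+1.
Proof.
move=> s0 [M [_ MP]]; pose A := Num.max M 0; have A0 : 0 <= A by rewrite le_max lexx orbT.
near=> n; have n_gt : s * A ^+ d.+1 < n%:R by near: n; exact: nbhs_infty_gtr.
pose t := (n%:R / s) `^ (d.+1%:R^-1).
have tE : t ^+ d.+1 = n%:R / s.
  rewrite -powR_mulrn ?powR_ge0 // -powRrM mulVf ?pnatr_eq0 // powRr1 //.
  by rewrite divr_ge0 // ltW.
exists t; last by rewrite tE mulrC divfK // gt_eqF.
apply: MP; apply: (@le_lt_trans _ _ A); first by rewrite le_max lexx.
rewrite ltNge; apply: contraTN n_gt => tA; rewrite -leNgt.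
by rewrite -ler_pdivrMl // mulrC -tE lerXn2r // nnegrE // powR_ge0.
Unshelve. all: by end_near. Qed.

Section ZonotopeCounts.
Context {R : realType} {d : nat} (C : set 'rV[R]_d) (a : 'rV[R]_d).
Hypotheses (C_cone : convex_cone C) (C_int : C° !=set0).
Implicit Types (V : {fset 'rV[int]_d}) (t : R) (K : 'rV[int]_d).

Definition represents_zonotopes K V B := forall T, zonotopes C (intr_row K) T ->
  exists2 om : config V B, config_endpoint om = K & T = fin_zonotope (config_gen om).

Lemma truncation_for_zonotopes t K : coercive C a -> 0 < t ->
  exists V B, [/\ captures_mean C a t V, mild_truncation a t V B & represents_zonotopes K V B].
Proof.
move=> a_coercive t0; have [c c0 a_ge] := a_coercive.
pose M := (Num.truncn (dot a (intr_row K) / c)).+1.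
have M_ge : dot a (intr_row K) / c <= M%:R by rewrite ltW // truncnS_gt.
have [F FP] := @bounded_lattice_fset d M.
have [V [V_mean FV]] := captures_mean_exists C_cone C_int a_coercive F t0.
have x_gt0 (p : V) : 0 < dot a (intr_row (val p)) / t.
  have [p_prim Cp] := V_mean.1 _ (valP p).
  by rewrite divr_gt0 // (primitive_dot_gt0 a_coercive).
have [B0 B0P] := truncation_exists x_gt0.
exists V, (maxn B0 M); split => [//||T]; first by apply: B0P; exact: leq_maxl.
apply: (zonotopes_config C_cone c0 a_ge V_mean.1) => [p p_prim Cp p_le|].
  apply: FV => //; apply: FP => j; rewrite -(ler_nat R) natr_absz intr_norm.
  apply: le_trans M_ge; rewrite ler_pdivlMr // mulrC; apply: le_trans p_le.
  by rewrite ler_pM2l //; have := ler_coord_norm (intr_row p : 'rV[R]_d) j; rewrite mxE.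
by rewrite mulrC -ler_pdivrMr //; apply: le_trans M_ge _; rewrite ler_nat leq_maxr.
Qed.

Lemma finite_zonotopes K V B : represents_zonotopes K V B ->
  finite_set (zonotopes C (intr_row K)).
Proof.
move=> rep; apply: (finite_card_le_image (f := fun om : config V B => fin_zonotope (config_gen om))
  (P := xpredT) _).1.
by move=> T /rep[om _ ->]; exists om.
Qed.

Lemma config_sum_dot V B (om : config V B) (b : 'rV[R]_d) :
  config_sum (dot b) om = dot b (intr_row (config_endpoint om)).
Proof. by rewrite intr_row_endpoint dot_sumr; apply: eq_bigr => p _; rewrite dotZr. Qed.

Lemma config_sum_coord V B (om : config V B) j :
  config_sum (fun x : 'rV[R]_d => x 0 j) om = intr_row (config_endpoint om) 0 j.
Proof. by rewrite intr_row_endpoint summxE; apply: eq_bigr => p _; rewrite [RHS]mxE. Qed.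

Lemma weight_endpoint t V B (om : config V B) :
  weight a t om = expR (- (dot a (intr_row (config_endpoint om)) / t)).
Proof. by rewrite /weight config_sum_dot. Qed.

Lemma finite_card_zonotopes_le t K V B (A : set (set 'rV[R]_d)) (P : pred (config V B)) :
  represents_zonotopes K V B -> A `<=` zonotopes C (intr_row K) ->
  (forall om, config_endpoint om = K -> A (fin_zonotope (config_gen om)) -> P om) ->
  (finite_card A)%:R * expR (- (dot a (intr_row K) / t)) <= \sum_(om | P om) weight a t om.
Proof.
move=> rep AK AP; pose PK om := (config_endpoint om == K) && P om.
have A_image : A `<=` [set fin_zonotope (config_gen om) | om in [set om | PK om]].
  move=> T AT; have [om omK TE] := rep _ (AK _ AT).
  by exists om => //=; rewrite /PK omK eqxx AP // -TE.
apply: (@le_trans _ _ (\sum_(om | PK om) weight a t om)).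
  rewrite (eq_bigr (fun=> expR (- (dot a (intr_row K) / t)))) => [|om /andP[/eqP omK _]].
    rewrite sumr_const -[leRHS]mulr_natl ler_wpM2r ?expR_ge0 // ler_nat.
    exact: (finite_card_le_image A_image).2.
  by rewrite weight_endpoint omK.
rewrite [leLHS]big_mkcond [leRHS]big_mkcond; apply: ler_sum => om _; rewrite /PK.
by case: (_ == _) => //=; case: ifP => // _; exact: ltW (weight_gt0 _ _ _).
Qed.

(* A configuration becomes a zonotope with endpoint [K] once the generator
   [K - config_endpoint om] is added; the zonotope and the endpoint determine it. *)
Lemma card_padded_le K V B M (P : pred (config V B)) : pointed C -> primitive_in C V ->
  finite_set (zonotopes C (intr_row K)) ->
  (forall om, P om -> C (intr_row (K - config_endpoint om))) ->
  (forall om, P om -> forall j, (`|config_endpoint om 0%R j| <= M)%N) ->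
  (#|P| <= num_zonotopes C (intr_row K) * (M + M).+1 ^ d)%N.
Proof.
move=> C_pointed V_prim fin_zon PC P_le; pose y (om : config V B) := K - config_endpoint om.
pose box (om : config V B) := [ffun j : 'I_d =>
  inord `|(config_endpoint om 0 j + M%:Z)%R|%N : 'I_(M + M).+1].
have -> : ((M + M).+1 ^ d = #|{: {ffun 'I_d -> 'I_(M + M).+1}}|)%N.
  by rewrite card_ffun !card_ord.
apply: (@card_le_finite_card _ _ _ (fun om => fin_zonotope (padded_gen om (intr_row (y om))))
  box) => // [om Pom|om om' Pom Pom' zon_eq /ffunP box_eq].
  by apply: padded_zonotopes => //; [exact: PC|rewrite /y addrC subrK].
have endpoint_eq : config_endpoint om = config_endpoint om'.
  apply/rowP => j; have := P_le _ Pom j; have := P_le _ Pom' j; have := box_eq j.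
  rewrite !ffunE; move: (_ 0 j) (_ 0 j) => z z' /(congr1 val) /=.
  by move=> E zM z'M; move: E; rewrite !inordK; lia.
by move: zon_eq; rewrite /y endpoint_eq; exact: (padded_zonotope_inj C_cone C_pointed V_prim).
Qed.

(* If [C] contains the ball of radius [r] around [k], the point
   [(1 + e) * s *: k - x = (e * s) *: (k + (e * s)^-1 *: (s *: k - x))] lies in [C]. *)
Lemma cone_padding k (r e s : R) x : (forall y, `|y - k| <= r -> C y) -> 0 < e -> 0 < s ->
  `|x - s *: k| <= e * r * s -> C (((1 + e) * s) *: k - x).
Proof.
move=> kr e0 s0 x_near; have es0 : 0 < e * s by rewrite mulr_gt0.
have -> : ((1 + e) * s) *: k - x = (e * s) *: (k - (e * s)^-1 *: (x - s *: k)).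
  rewrite [RHS]scalerBr [in RHS]scalerA mulfV ?gt_eqF // scale1r.
  by rewrite mulrDl mul1r scalerDl opprB addrA [_ + s *: k]addrC.
apply: (coneZ C_cone (ltW es0)); apply: kr.
rewrite addrAC subrr sub0r normrN normrZ gtr0_norm ?invr_gt0 // ler_pdivrMl //.
by apply: le_trans x_near _; apply: eq_ler; ring.
Qed.

End ZonotopeCounts.

Section Concentration.
Context {R : realType} {d : nat} (C : set 'rV[R]_d) (k0 : 'rV[int]_d) (a : 'rV[R]_d) (r : R).
Local Notation k := (@intr_row R d k0).
Hypotheses (d_ge2 : (2 <= d)%N) (C_cone : convex_cone C) (C_int : C° !=set0).
Hypotheses (C_pointed : pointed C) (r_gt0 : 0 < r) (kr : forall y, `|y - k| <= r -> C y).
Hypothesis a_coercive : coercive C a.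
Hypothesis moment_dot : forall b, moment C a (dot b) = dot b k.
Implicit Types (V : {fset 'rV[int]_d}) (t e eps del s : R).

Local Notation kappa := (@kappa R d).
Local Notation l := (dot a k).

Let kappa_gt0 : 0 < kappa. Proof. exact: kappa_gt0. Qed.

Let l_ge0 : 0 <= l.
Proof. by apply: (coercive_ge0 a_coercive); apply: kr; rewrite subrr normr0 ltW. Qed.

Let moment_coord j : moment C a (fun x => x 0 j) = k 0 j.
Proof.
by rewrite -dot_delta -moment_dot; congr moment; apply/funext => x; rewrite dot_delta.
Qed.

Definition typical V B del t (om : config V B) :=
  `|intr_row (config_endpoint om) - (kappa * t ^+ d.+1) *: k| <= del * t ^+ d.+1.

Lemma typical_weight_ge del : 0 < del -> \forall t \near +oo, forall V B,
  captures_mean C a t V -> mild_truncation a t V B ->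
  partition_function a t V B / 2 <= \sum_(om : config V B | typical del t om) weight a t om.
Proof.
move=> del0; pose coord (j : 'I_d) (x : 'rV[R]_d) : R := x 0 j.
have coord_homlip j : homlip C (coord j) by exact: homlip_coord.
have [eta eta0 deviant_near] := deviation_family d_ge2 C_cone C_int a_coercive coord_homlip del0.
near=> t => V B V_mean trunc.
have t0 : 0 < t by near: t; exact: nbhs_pinfty_gt.
have exp_le : #|'I_d|%:R * 4 * expR (- (eta * t ^+ d)) <= 2^-1.
  have four_d : 0 <= #|'I_d|%:R * 4 :> R by rewrite mulr_ge0.
  rewrite (_ : #|'I_d|%:R * 4 = #|'I_d|%:R * 4 * t ^+ 0); last by rewrite expr0 mulr1.
  near: t.
  by apply: pow_expRN_le_near; rewrite ?invr_gt0 // (leq_trans _ d_ge2).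
have deviant_le : \sum_(om : config V B | [exists j, del * t ^+ d.+1 <=
      `|config_sum (coord j) om - kappa * moment C a (coord j) * t ^+ d.+1|]) weight a t om
    <= #|'I_d|%:R * 4 * expR (- (eta * t ^+ d)) * partition_function a t V B.
  by move: V B V_mean trunc; near: t; exact: deviant_near.
have Z0 := partition_function_gt0 a t V B.
have atypical_le : \sum_(om : config V B | ~~ typical del t om) weight a t om
    <= partition_function a t V B / 2.
  rewrite [leRHS]mulrC; apply: le_trans (ler_wpM2r (ltW Z0) exp_le).
  apply: le_trans deviant_le; rewrite [leLHS]big_mkcond [leRHS]big_mkcond /=.
  apply: ler_sum => om _; case: ifP => [atypical|_]; last first.
    by case: ifP => // _; exact: ltW (weight_gt0 _ _ _).
  rewrite ifT //; apply: contraNT atypical => /existsPn close.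
  apply: row_norm_le => [|j]; first by rewrite mulr_ge0 ?exprn_ge0 // ltW.
  have := close j; rewrite -ltNge /coord config_sum_coord moment_coord => /ltW.
  by rewrite !mxE [kappa * _ * _]mulrAC.
have : partition_function a t V B = \sum_(om : config V B | typical del t om) weight a t om
    + \sum_(om : config V B | ~~ typical del t om) weight a t om.
  by rewrite /partition_function (bigID (typical del t)).
by move: atypical_le; lra.
Unshelve. all: by end_near. Qed.

Lemma typical_norm_le V B del t (om : config V B) : 0 <= t -> typical del t om ->
  `|intr_row (config_endpoint om) : 'rV[R]_d| <= (kappa * `|k| + del) * t ^+ d.+1.
Proof.
move=> t0 om_near; rewrite -(subrK ((kappa * t ^+ d.+1) *: k) (intr_row _)).
apply: le_trans (ler_normD _ _) (le_trans (lerD om_near (lexx _)) _).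
rewrite normrZ ger0_norm; last by rewrite mulr_ge0 ?exprn_ge0 // ltW.
by apply: eq_ler; ring.
Qed.

Lemma typical_weight_le V B del t (om : config V B) : 0 < t -> typical del t om ->
  weight a t om <= expR (- ((kappa * l - d%:R * `|a| * del) * t ^+ d)).
Proof.
move=> t0 om_near; rewrite weight_endpoint ler_expR lerN2 ler_pdivlMr //.
have -> : (kappa * l - d%:R * `|a| * del) * t ^+ d * t
    = kappa * t ^+ d.+1 * l - d%:R * `|a| * (del * t ^+ d.+1) by rewrite exprS; ring.
have := ler_norm_dot a (intr_row (config_endpoint om) - (kappa * t ^+ d.+1) *: k).
rewrite dotBr dotZr => /le_trans/(_ (ler_wpM2l _ om_near)).
by rewrite mulr_ge0 // ler_norml => /(_ isT)/andP[]; lra.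
Qed.

Lemma card_typical_le e t n V B : 0 < e -> 1 <= t ->
  n%:R = (1 + e) * kappa * t ^+ d.+1 -> primitive_in C V ->
  finite_set (zonotopes C (intr_row (k0 *+ n) : 'rV[R]_d)) ->
  #|@typical V B (e * r * kappa) t|%:R
    <= (2 * (kappa * `|k| + e * r * kappa) + 3) ^+ d * t ^+ (d.+1 * d)
       * (num_zonotopes C (n%:R *: k))%:R :> R.
Proof.
move=> e0 t1 nE V_prim fin_zon; set b := kappa * `|k| + _; have t0 : 0 < t := lt_le_trans ltr01 t1.
set T := t ^+ d.+1 in nE; have T0 : 0 < T by rewrite exprn_gt0.
have T1 : 1 <= T by rewrite exprn_ege1.
have erk0 : 0 < e * r * kappa by rewrite mulr_gt0 // mulr_gt0.
have b0 : 0 <= b by rewrite addr_ge0 ?(ltW erk0) // mulr_ge0 // ltW.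
pose M := (Num.truncn (b * T)).+1.
have card_le : (#|@typical V B (e * r * kappa) t|
    <= num_zonotopes C (n%:R *: k) * (M + M).+1 ^ d)%N.
  rewrite -intr_rowMn; apply: card_padded_le => // om om_typical.
    rewrite intr_rowB intr_rowMn nE -mulrA.
    apply: (cone_padding C_cone kr e0); first exact: mulr_gt0.
    by move: om_typical; rewrite /typical -mulrA.
  move=> j; rewrite -(ler_nat R) natr_absz intr_norm.
  apply: (@le_trans _ _ (b * T)); last by rewrite ltW // truncnS_gt.
  apply: le_trans (typical_norm_le (ltW t0) om_typical).
  by have := ler_coord_norm (intr_row (config_endpoint om) : 'rV[R]_d) j; rewrite mxE.
apply: (@le_trans _ _ ((M + M).+1 ^ d * num_zonotopes C (n%:R *: k))%N%:R).
  by rewrite ler_nat mulnC.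
rewrite natrM ler_wpM2r // natrX exprM -/T -exprMn lerXn2r ?nnegrE //.
  by rewrite mulr_ge0 ?(ltW T0) // addr_ge0 ?mulr_ge0.
have M_le : M%:R <= b * T + 1 by rewrite /M -natr1 lerD2r truncn_le mulr_ge0 // ltW.
by rewrite -natr1 natrD; nra.
Qed.

Lemma partition_function_le e : 0 < e -> exists2 A : R, 0 <= A &
  \forall t \near +oo, forall (n : nat) V B, n%:R = (1 + e) * kappa * t ^+ d.+1 ->
  captures_mean C a t V -> mild_truncation a t V B -> represents_zonotopes C (k0 *+ n) V B ->
  partition_function a t V B <= A * t ^+ (d.+1 * d)
    * expR (- ((kappa * l - d%:R * `|a| * (e * r * kappa)) * t ^+ d))
    * (num_zonotopes C (n%:R *: k))%:R.
Proof.
move=> e0; pose del := e * r * kappa; have del0 : 0 < del by rewrite mulr_gt0 // mulr_gt0.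
pose b := kappa * `|k| + del.
have b0 : 0 <= b by rewrite addr_ge0 ?(ltW del0) // mulr_ge0 // ltW.
have b3 : 0 <= 2 * b + 3 by rewrite addr_ge0 // mulr_ge0.
exists (2 * (2 * b + 3) ^+ d); first by rewrite mulr_ge0 ?exprn_ge0.
have typical_near := typical_weight_ge del0.
near=> t => n V B nE V_mean trunc rep; set Z := partition_function a t V B.
have t1 : 1 <= t by near: t; apply: nbhs_pinfty_ge; exact: num_real.
have t0 : 0 < t := lt_le_trans ltr01 t1.
have typical_ge : Z / 2 <= \sum_(om : config V B | typical del t om) weight a t om.
  by move: V B V_mean trunc {rep} @Z; near: t; exact: typical_near.
have := card_typical_le B e0 t1 nE V_mean.1 (finite_zonotopes rep); rewrite -/del -/b => card_le.
set E := expR _; have sum_le : \sum_(om : config V B | typical del t om) weight a t om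
    <= #|@typical V B del t|%:R * E.
  rewrite mulr_natl -sumr_const; apply: ler_sum => om; exact: typical_weight_le.
move: (le_trans typical_ge (le_trans sum_le (ler_wpM2r (expR_ge0 _) card_le))).
by rewrite -/E ler_pdivrMr // => Z_le; apply: le_trans Z_le _; apply: eq_ler; ring.
Unshelve. all: by end_near. Qed.

Definition far_zonotopes eps n : set (set 'rV[R]_d) :=
  [set T | zonotopes C (n%:R *: k) T /\
    (eps%:E < hausdorff_dist [set (n%:R^-1 : R) *: x | x in T] (limit_shape C a))%E].

Lemma rescaled_sum_close (y mu s n e del : R) : 0 < s -> n = (1 + e) * s -> 0 < e ->
  0 <= mu <= l -> e * l <= del / 2 -> `|y - mu * s| <= del / 2 * s -> `|y / n - mu| <= del.
Proof.
move=> s0 nE e0 /andP[mu0 mu_l] e_le y_close.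
have n0 : 0 < n by rewrite nE mulr_gt0 // addr_gt0.
have -> : y / n - mu = ((y - mu * s) - e * mu * s) / n.
  by rewrite nE; field; rewrite !gt_eqF // addr_gt0.
have e_mu : e * mu <= del / 2 by apply: le_trans e_le; rewrite ler_pM2l.
have del0 : 0 <= del by have := mulr_ge0 (ltW e0) mu0; lra.
rewrite normrM (gtr0_norm (_ : 0 < n^-1)) ?invr_gt0 // ler_pdivrMr //.
apply: le_trans (ler_normB _ _) _; rewrite [X in _ + X <= _]ger0_norm; last first.
  by rewrite !mulr_ge0 // ltW.
have := mulr_ge0 (mulr_ge0 del0 (ltW e0)) (ltW s0); have := ler_wpM2r (ltW s0) e_mu.
by rewrite nE; lra.
Qed.

Lemma far_zonotopes_card_le eps : 0 < eps -> exists e0 eta A : R,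
  [/\ 0 < e0, 0 < eta, 0 <= A &
  forall e, 0 < e -> e <= e0 -> \forall t \near +oo, forall (n : nat) V B,
  n%:R = (1 + e) * kappa * t ^+ d.+1 -> captures_mean C a t V -> mild_truncation a t V B ->
  represents_zonotopes C (k0 *+ n) V B ->
  (finite_card (far_zonotopes eps n))%:R * expR (- (n%:R * l / t))
    <= A * expR (- (eta * t ^+ d)) * partition_function a t V B].
Proof.
move=> eps0; have eps2 : 0 < eps / 2 by rewrite divr_gt0.
have l2 : 0 <= 2 * d%:R * l by rewrite !mulr_ge0.
have [eta eta0 eta_le] := exists_pos_mul_le eps2 l2.
have [m [th [xi [xi_homlip xi_ge0 xi_sum xi_conc]]]] :=
  concentrated_partition C_cone a_coercive eta0.
have th_ge0 : 0 <= d%:R * \sum_i `|th i| by rewrite mulr_ge0 ?sumr_ge0.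
have [del del0 del_le] := exists_pos_mul_le eps2 th_ge0.
have err_le : d%:R * discretization_error a k eta th del <= eps.
  by rewrite /discretization_error; lra.
have del2 : 0 < del / 2 by rewrite divr_gt0.
have [e0 e0_gt0 e0_l] := exists_pos_mul_le del2 l_ge0.
have del_kappa : 0 < del / 2 * kappa by rewrite mulr_gt0.
have [eta' eta'0 deviant_near] :=
  deviation_family d_ge2 C_cone C_int a_coercive xi_homlip del_kappa.
exists e0, eta', (#|'I_m|%:R * 4); split => // e e_gt0 e_le.
have e_l : e * l <= del / 2 by apply: le_trans e0_l; rewrite ler_wpM2r.
have moment_bound i : 0 <= moment C a (xi i) <= l.
  apply/andP; split; first by apply: moment_ge0 => // x; exact: xi_ge0.
  rewrite -moment_dot; apply: le_moment => // [|x Cx]; first exact: homlip_dot.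
  by rewrite -xi_sum // (bigD1 i) //= lerDl sumr_ge0 // => j _; exact: xi_ge0.
near=> t => n V B nE V_mean trunc rep.
have t0 : 0 < t by near: t; exact: nbhs_pinfty_gt.
have T0 : 0 < t ^+ d.+1 by rewrite exprn_gt0.
have deviant_le : \sum_(om : config V B | [exists i, del / 2 * kappa * t ^+ d.+1 <=
      `|config_sum (xi i) om - kappa * moment C a (xi i) * t ^+ d.+1|]) weight a t om
    <= #|'I_m|%:R * 4 * expR (- (eta' * t ^+ d)) * partition_function a t V B.
  by move: V B V_mean trunc {rep}; near: t; exact: deviant_near.
have n0 : 0 < n%:R :> R by rewrite nE mulr_gt0 // mulr_gt0 // addr_gt0.
apply: le_trans deviant_le; rewrite -dotZr -intr_rowMn.
apply: (finite_card_zonotopes_le _ _ rep) => [T [T_zon _]|om om_end]; first by rewrite intr_rowMn.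
move=> [_]; apply: contraPT => /existsPn close; apply/negP; rewrite -leNgt.
apply: (hausdorff_dist_limit_shape_le C_cone C_int a_coercive (moment_dot a) (ltW eta0)
  xi_homlip xi_ge0 xi_sum xi_conc V_mean.1 n0 _ _ err_le) => [|i].
  by rewrite -intr_row_endpoint om_end intr_rowMn.
apply: (rescaled_sum_close (s := kappa * t ^+ d.+1) _ _ e_gt0 (moment_bound i) e_l).
- by rewrite mulr_gt0.
- by rewrite nE mulrA.
have := close i; rewrite -ltNge => /ltW.
by rewrite [moment C a _ * _]mulrCA -!mulrA.
Unshelve. all: by end_near. Qed.

Lemma concentration eps : 0 < eps -> exists2 s : R, 0 < s & forall e, 0 < e ->
  \forall t \near +oo, forall n : nat, n%:R = s * t ^+ d.+1 ->
    (finite_card (far_zonotopes eps n))%:R / (num_zonotopes C (n%:R *: k))%:R <= e :> R.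
Proof.
move=> eps0; have [e0 [eta [A [e0_gt0 eta0 A0 far_card_le]]]] := far_zonotopes_card_le eps0.
pose Q := kappa * (l + d%:R * `|a| * r).
have Q0 : 0 <= Q.
  by rewrite mulr_ge0 ?(ltW kappa_gt0) // addr_ge0 // mulr_ge0 ?(ltW r_gt0) // mulr_ge0.
have eta2 : 0 < eta / 2 by rewrite divr_gt0.
have [e1 e1_gt0 e1_le] := exists_pos_mul_le eta2 Q0.
pose e := Num.min e0 e1; have e_gt0 : 0 < e by rewrite lt_min e0_gt0.
have eQ : e * Q <= eta / 2 by apply: le_trans e1_le; rewrite ler_wpM2r // ge_min lexx orbT.
have [A' A'0 Z_near] := partition_function_le e_gt0.
have e_le : e <= e0 by rewrite ge_min lexx.
have far_near := far_card_le e e_gt0 e_le.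
exists ((1 + e) * kappa) => [|e' e'_gt0]; first by rewrite mulr_gt0 // addr_gt0.
near=> t => n nE; have t0 : 0 < t by near: t; exact: nbhs_pinfty_gt.
have AA'_le : A * A' * t ^+ (d.+1 * d) * expR (- (eta / 2 * t ^+ d)) <= e'.
  by near: t; apply: pow_expRN_le_near; rewrite ?mulr_ge0 // (leq_trans _ d_ge2).
have [V [B [V_mean trunc rep]]] :=
  truncation_for_zonotopes C_cone C_int (k0 *+ n) a_coercive t0.
have Z_le : partition_function a t V B <= A' * t ^+ (d.+1 * d)
    * expR (- ((kappa * l - d%:R * `|a| * (e * r * kappa)) * t ^+ d))
    * (num_zonotopes C (n%:R *: k))%:R.
  by move: n V B nE V_mean trunc rep; near: t; exact: Z_near.
have far_le : (finite_card (far_zonotopes eps n))%:R * expR (- (n%:R * l / t))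
    <= A * expR (- (eta * t ^+ d)) * partition_function a t V B.
  by move: n V B nE V_mean trunc rep {Z_le}; near: t; exact: far_near.
have [->|N_neq0] := eqVneq (num_zonotopes C (n%:R *: k)) 0%N.
  by rewrite invr0 mulr0 ltW.
rewrite ler_pdivrMr ?ltr0n ?lt0n //; apply: le_trans (ler_wpM2r (ler0n _ _) AA'_le).
rewrite -(ler_pM2r (expR_gt0 (- (n%:R * l / t)))); apply: le_trans far_le _.
have AE0 : 0 <= A * expR (- (eta * t ^+ d)) by rewrite mulr_ge0 ?expR_ge0.
apply: le_trans (ler_wpM2l AE0 Z_le) _.
have exponent_le : expR (- (eta * t ^+ d)) *
     expR (- ((kappa * l - d%:R * `|a| * (e * r * kappa)) * t ^+ d))
   <= expR (- (eta / 2 * t ^+ d)) * expR (- (n%:R * l / t)).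
  rewrite -!expRD ler_expR.
  have -> : n%:R * l / t = (1 + e) * kappa * l * t ^+ d.
    by rewrite nE exprS; field; rewrite gt_eqF.
  have := ler_wpM2r (exprn_ge0 d (ltW t0)) eQ; rewrite /Q; lra.
have := ler_wpM2l (_ : 0 <= A * A' * t ^+ (d.+1 * d) * (num_zonotopes C (n%:R *: k))%:R)
  exponent_le.
rewrite !mulr_ge0 ?exprn_ge0 ?(ltW t0) // => /(_ isT); congr (_ <= _); ring.
Unshelve. all: by end_near. Qed.

End Concentration.

Theorem theorem1p1 (R : realType) (d : nat) (C : set 'rV[R]_d) (k : 'rV[R]_d)
    (hd : (2 <= d)%N)
    (C_closed : closed C) (C_cone : convex_cone C) (C_pointed : pointed C)
    (C_int : C° !=set0)
    (k_int : integral_vector k) (k_in : C° k) :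
  exists T0 : set 'rV[R]_d,
    [/\ convex_set T0, T0 !=set0 &
      forall eps : R, 0 < eps ->
        (finite_card [set T | zonotopes C (n%:R *: k) T /\
            (eps%:E < hausdorff_dist [set (n%:R^-1 : R) *: x | x in T] T0)%E])%:R
          / (num_zonotopes C (n%:R *: k))%:R @[n --> \oo] --> (0 : R)].
Proof.
have [r r0 kr] := interior_norm_le k_in.
have [a a_coercive a_min] := minimizer_exists C_closed C_cone C_int C_pointed r0 kr.
have moment_dot b := minimizer_moment C_cone C_int b a_coercive a_min.
have [k0 kE] := integral_intr_row k_int; rewrite {}kE in kr moment_dot *.
exists (limit_shape C a); split.
- exact: limit_shape_convex.
- exact: limit_shape_nonempty.
move=> eps eps0; have [s s0 far_le] :=
  concentration hd C_cone C_int C_pointed r0 kr a_coercive moment_dot eps0.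
apply/cvgrPdist_le => e e0; have := near_infty_root d s0 (far_le e e0).
apply: filterS => n [t far_n nE].
by rewrite sub0r normrN ger0_norm ?divr_ge0 // far_n.
Qed.
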